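(* In the sense of analytic continuation in the parameter $\phi$, $$\int_{0}^{\infty}\operatorname{Im}\!\left(\zeta\!\left(\tfrac12+iv\right)\right)\tanh(\pi v)\,dv=-\gamma;$$ that is, $$\lim_{\phi\to\pi^{-}}\int_{0}^{\infty}\operatorname{Im}\!\left(\zeta\!\left(\tfrac12+iv\right)\right)\frac{\sinh(\phi v)}{\cosh(\pi v)}\,dv=-\gamma.$$
   Context: $\zeta$ is the Riemann zeta function and $\gamma$ is the Euler–Mascheroni constant. The integral with $\tanh(\pi v)$ is not claimed to converge; it is assigned the value, continued to $\phi=\pi$, of the integral with $\tanh(\pi v)$ replaced by $\sinh(\phi v)/\cosh(\pi v)$, which converges for real $|\phi|<\pi$. *)

(* Defs.v *)
(* Stdlib real numbers, with Coquelicot. *)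
From Stdlib Require Import Reals.
From Coquelicot Require Import Coquelicot.
Open Scope R_scope.

(* Near z0, f is the sum of a convergent power series centred at z0.  Used both
   over C (complex analyticity) and over R (real analyticity). *)
Definition analytic_at {K : AbsRing} (f : K -> K) (z0 : K) : Prop :=
  exists a : nat -> K,
    locally (T := AbsRing_UniformSpace K) z0
      (fun z => is_pseries (V := AbsRing_NormedModule K) a (minus z z0) (f z)).

Definition Cexp (z : C) : C :=
  (exp (Re z) * cos (Im z), exp (Re z) * sin (Im z)).

(* zeta is the Dirichlet series sum_(n >= 1) n^(-s) on Re s > 1, continued
   analytically to C \ {1}.  By the identity theorem this determines zeta
   everywhere except for the irrelevant value zeta 1.  The n-th term below is
   (n+1)^(-s) = exp (- s ln (n+1)). *)
Definition is_riemann_zeta (zeta : C -> C) : Prop :=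
  (forall s : C, 1 < Re s ->
     is_series (V := C_NormedModule)
       (fun n : nat => Cexp (Copp s * RtoC (ln (INR (S n))))%C) (zeta s)) /\
  (forall s : C, s <> RtoC 1 -> analytic_at (K := C_AbsRing) zeta s).

(* The limit of 1 + 1/2 + ... + 1/(n+1) - ln (n+1). *)
Definition euler_gamma : R :=
  real (Lim_seq (fun n : nat =>
    sum_n (fun k : nat => / INR (S k)) n - ln (INR (S n)))).

Definition integrand (zeta : C -> C) (phi v : R) : R :=
  Im (zeta (1 / 2, v)) * (sinh (phi * v) / cosh (PI * v)).

(* RInt_gen is a total operator: it is the improper integral only where the
   latter converges. *)
Definition zeta_integral (zeta : C -> C) (phi : R) : R :=
  RInt_gen (integrand zeta phi) (at_point 0) (Rbar_locally p_infty).

(* f, given on ]a, b[, has an analytic continuation up to and including b, whose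
   value at b is l. *)
Definition continued_value (f : R -> R) (a b l : R) : Prop :=
  exists F : R -> R,
    (forall x, a < x < b -> F x = f x) /\
    (forall x, a < x <= b -> analytic_at (K := R_AbsRing) F x) /\
    F b = l.

(* Main.v *)
(* On the critical line [zeta s] is approximated by
     [sum_(n <= P) n^(-s) - m^(s-1) sum_(j <= m P) j^(-s)], with [m = P^2]:
   the pole terms of the two Euler-Maclaurin truncations cancel and the factor
   [m^(s-1)] makes the second copy of zeta negligible.  Since
     [int_0^oo sin (a v) sinh (phi v) / cosh (pi v) dv
        = sin (phi/2) sinh (a/2) / (cos phi + cosh a)],
   integrating the approximation termwise gives minus the difference between
   [sum_(n <= P) kappa n] and a Riemann sum of [int_0^P kappa], where
     [kappa x = sin (phi/2) (x - 1) / (x^2 + 2 x cos phi + 1)].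
   Letting [P] tend to infinity, the integral is
     [- phi cos (phi/2) - sin (phi/2)
        (gamma + sum_(n >= 1) ((n - 1) / (n^2 + 2 n cos phi + 1) - 1/n))]
   for [|phi| < pi].  This is real analytic on the whole line (with the term [n = 1]
   read as [-1]), and at [phi = pi] the sum telescopes to [0]. *)

(* Integrating the approximation termwise is legitimate only if its error is controlled uniformly in
   [v] against a weight that decays like [exp (-(pi - |phi|) v)]. The truncation error at [N] grows,
   up to a linear factor, no faster than [exp (2 v / N)]; hence for every [d > 0] it is eventually
   at most [eps_n exp (d v)] with [eps_n -> 0], and [d = (pi - |phi|) / 2] suffices. The choice
   [m = P^2] gives [|m^(s-1)| = 1/P] on the critical line, while the Riemann sum of mesh [1/P^2]
   over [[0, P]] errs by [O(1/P)]. The critical line is reached from [Re s > 1] along horizontal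
   rays at height [v <> 0], which avoid the pole, so an identity theorem for real analytic functions
   is enough. Analyticity of sums, products and composites comes from a weighted [l^1] norm on
   coefficients, in place of contour integrals. The sine transform rests on [1/cosh (pi v) = 2 sum
   (-1)^k exp (-(2k+1) pi v)]. The resulting series of rational functions is summed in Cesaro mean,
   as the Fourier expansion at [t = 0] of an elementary function on [[0, 1/2]]. *)
Require Import Defs.
From Stdlib Require Import Reals Lra Lia ClassicalEpsilon.
From Coquelicot Require Import Coquelicot.
Open Scope R_scope.

(** * Complex power series *)

(* Moore-Osgood exchange of limits. *)
Lemma filterlim_uniform_approx {K : AbsRing} {V : NormedModule K} {T : Type}
    (F : (T -> Prop) -> Prop) (FF : Filter F) (A : T -> V) (B : nat -> T -> V)
    (G : nat -> V) (L : V) (eps : nat -> R) :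
  eventually (fun n => F (fun x => norm (minus (A x) (B n x)) <= eps n)) ->
  is_lim_seq eps 0 ->
  (forall n, filterlim (B n) F (locally (G n))) ->
  filterlim G eventually (locally L) ->
  filterlim A F (locally L).
Proof.
  intros HA He HB HG.
  apply filterlim_locally_ball_norm; intros e.
  pose proof (proj1 (filterlim_locally_ball_norm (K := K) G L) HG) as HG'.
  assert (e3 : 0 < e / 3) by (destruct e; simpl; lra).
  specialize (HG' (mkposreal _ e3)).
  apply is_lim_seq_spec in He.
  specialize (He (mkposreal _ e3)); simpl in *.
  destruct HA as [n1 HA], HG' as [n2 HG'], He as [n3 He].
  set (n := (n1 + n2 + n3)%nat).
  specialize (HA n ltac:(unfold n; lia)); specialize (HG' n ltac:(unfold n; lia)).
  specialize (He n ltac:(unfold n; lia)).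
  pose proof (proj1 (filterlim_locally_ball_norm (K := K) (B n) (G n)) (HB n)
                (mkposreal _ e3)) as HBn.
  generalize (filter_and _ _ HA HBn); apply filter_imp.
  unfold ball_norm in *; simpl in *; intros x [H1 H2].
  replace (minus (A x) L) with
    (plus (minus (A x) (B n x)) (plus (minus (B n x) (G n)) (minus (G n) L))).
  - eapply Rle_lt_trans; [apply norm_triangle|].
    apply Rle_lt_trans with (eps n + (norm (minus (B n x) (G n)) + norm (minus (G n) L))).
    + apply Rplus_le_compat; [exact H1 | apply norm_triangle].
    + apply Rabs_def2 in He. lra.
  - now rewrite <- !minus_trans.
Qed.

Lemma Cseries_spec (a : nat -> C) (l : C) :
  is_series (V := C_NormedModule) a l <->
  forall eps : posreal, eventually (fun n => Cmod (sum_n a n - l)%C < eps).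
Proof.
  split; intros H.
  - exact (proj1 (filterlim_locally_ball_norm (K := C_AbsRing) (U := C_NormedModule) _ _) H).
  - exact (proj2 (filterlim_locally_ball_norm (K := C_AbsRing) (U := C_NormedModule) _ _) H).
Qed.

(** [is_pseries] lives over [AbsRing_NormedModule C_AbsRing], the series over [C_NormedModule]. Both
    limits are restated through the norm, which is [Cmod] in either structure. *)
Lemma is_pseries_C_series (a : nat -> C) (h l : C) :
  is_pseries (K := C_AbsRing) (V := AbsRing_NormedModule C_AbsRing) a h l <->
  is_series (V := C_NormedModule) (fun k => Cmult (Cpow h k) (a k)) l.
Proof.
  assert (E : forall k, scal (V := AbsRing_NormedModule C_AbsRing) (pow_n (K := C_AbsRing) h k) (a k) = (Cpow h k * a k)%C).
  { reflexivity. }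
  unfold is_pseries, is_series.
  etransitivity.
  { apply (filterlim_locally_ball_norm (K := C_AbsRing) (U := AbsRing_NormedModule C_AbsRing)). }
  symmetry; etransitivity.
  { apply (filterlim_locally_ball_norm (K := C_AbsRing) (U := C_NormedModule)). }
  split; intros H eps; destruct (H eps) as [N HN]; exists N; intros n Hn;
    specialize (HN n Hn); unfold ball_norm in *;
    [ change (norm (minus (G := C_AbsRing) (sum_n (fun k => scal (V := AbsRing_NormedModule C_AbsRing) (pow_n (K := C_AbsRing) h k) (a k)) n) l) < eps);
     rewrite (sum_n_ext _ _ n E); exact HN
    | change (norm (minus (G := C_AbsRing) (sum_n (fun k => scal (V := AbsRing_NormedModule C_AbsRing) (pow_n (K := C_AbsRing) h k) (a k)) n) l) < eps) in HN;
     rewrite (sum_n_ext _ _ n E) in HN; exact HN].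
Qed.

Notation is_Cseries := (is_series (V := C_NormedModule)).

Ltac eqR := match goal with |- @eq _ ?a ?b => change (@eq R a b) end.
Ltac eqC := match goal with |- @eq _ ?a ?b => change (@eq C a b) end.

Lemma sum_n_SnR (u : nat -> R) n : sum_n u (S n) = sum_n u n + u (S n).
Proof. exact (sum_Sn u n). Qed.

Lemma sum_n_SnC (u : nat -> C) n : sum_n u (S n) = (sum_n u n + u (S n))%C.
Proof. exact (sum_Sn u n). Qed.

Lemma sum_n_le_series (u : nat -> R) (l : R) (n : nat) :
  (forall k, 0 <= u k) -> is_series u l -> sum_n u n <= l.
Proof.
  intros Hu Hl.
  apply (is_lim_seq_incr_compare (sum_n u)); [exact Hl|].
  intros k. rewrite sum_n_SnR. specialize (Hu (S k)). lra.
Qed.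

Lemma series_nonneg_bounded (u : nat -> R) (M : R) :
  (forall k, 0 <= u k) -> (forall n, sum_n u n <= M) ->
  exists l, is_series u l /\ l <= M.
Proof.
  intros Hu HM.
  destruct (ex_finite_lim_seq_incr (sum_n u) M) as [l Hl].
  - intros k. rewrite sum_n_SnR. specialize (Hu (S k)). lra.
  - exact HM.
  - exists l; split; [exact Hl|].
    apply (is_lim_seq_le (sum_n u) (fun _ => M) l M); auto.
    apply is_lim_seq_const.
Qed.

Lemma Cmod_sum_n_sub (u : nat -> C) (m : nat -> R) (N p : nat) :
  (forall n, (N < n)%nat -> Cmod (u n) <= m n) ->
  Cmod (sum_n u (N + p) - sum_n u N)%C <= sum_n m (N + p) - sum_n m N.
Proof.
  intros H; induction p as [|p IH].
  - rewrite Nat.add_0_r. unfold Rminus. rewrite Rplus_opp_r.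
    replace (sum_n u N - sum_n u N)%C with (RtoC 0) by (unfold Cminus; ring).
    rewrite Cmod_0; lra.
  - rewrite Nat.add_succ_r, sum_n_SnR, sum_n_SnC.
    replace (sum_n u (N + p) + u (S (N + p)) - sum_n u N)%C with
      (sum_n u (N + p) - sum_n u N + u (S (N + p)))%C by ring.
    eapply Rle_trans; [apply Cmod_triangle|].
    specialize (H (S (N + p)) ltac:(lia)). lra.
Qed.

Lemma Cseries_tail_le (u : nat -> C) (l : C) (m : nat -> R) (M : R) (N : nat) :
  is_Cseries u l -> (forall n, 0 <= m n) ->
  (forall n, (N < n)%nat -> Cmod (u n) <= m n) -> is_series m M ->
  Cmod (l - sum_n u N)%C <= M - sum_n m N.
Proof.
  intros Hu Hm0 Hm HM.
  apply le_epsilon; intros e He.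
  destruct (proj1 (Cseries_spec u l) Hu (mkposreal e He)) as [n0 Hn0]; simpl in Hn0.
  specialize (Hn0 (N + n0)%nat ltac:(lia)).
  replace (l - sum_n u N)%C with
    (- (sum_n u (N + n0) - l) + (sum_n u (N + n0) - sum_n u N))%C by ring.
  eapply Rle_trans; [apply Cmod_triangle|]. rewrite Cmod_opp.
  pose proof (Cmod_sum_n_sub u m N n0 Hm).
  pose proof (sum_n_le_series m M (N + n0) Hm0 HM). lra.
Qed.

Lemma Cseries_le (u : nat -> C) (l : C) (m : nat -> R) (M : R) :
  is_Cseries u l -> (forall n, Cmod (u n) <= m n) -> is_series m M ->
  Cmod l <= M.
Proof.
  intros Hu Hm HM.
  assert (Hm0 : forall k, 0 <= m k).
  { intros k; eapply Rle_trans; [apply Cmod_ge_0 | apply Hm]. }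
  pose proof (Cseries_tail_le u l m M 0 Hu Hm0 (fun n _ => Hm n) HM) as H.
  rewrite !sum_O in H.
  replace l with (l - u 0%nat + u 0%nat)%C by ring.
  eapply Rle_trans; [apply Cmod_triangle|]. specialize (Hm 0%nat). lra.
Qed.

Lemma ex_Cseries_le (u : nat -> C) (m : nat -> R) (M : R) :
  (forall n, Cmod (u n) <= m n) -> is_series m M -> exists l, is_Cseries u l.
Proof.
  intros Hm HM.
  destruct (ex_series_le (V := C_CompleteNormedModule) u m) as [l Hl].
  - exact Hm.
  - exists M; exact HM.
  - exists l; exact Hl.
Qed.

Lemma is_series_sum_n {K : AbsRing} {V : NormedModule K} (u : nat -> nat -> V)
    (l : nat -> V) (N : nat) :
  (forall k, is_series (u k) (l k)) ->
  is_series (fun n => sum_n (fun k => u k n) N) (sum_n l N).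
Proof.
  intros H; induction N as [|N IH].
  - rewrite sum_O. apply (is_series_ext (u 0%nat)); [|apply H].
    intros n; now rewrite sum_O.
  - rewrite sum_Sn.
    apply (is_series_ext (fun n => plus (sum_n (fun k => u k n) N) (u (S N) n))).
    + intros n; now rewrite sum_Sn.
    + apply is_series_plus; [exact IH | apply H].
Qed.

Lemma is_series_tail_lim (m : nat -> R) (M : R) :
  is_series m M -> is_lim_seq (fun N => M - sum_n m N) 0.
Proof.
  intros H. replace (Finite 0) with (Finite (M - M)) by (f_equal; ring).
  apply is_lim_seq_minus'; [apply is_lim_seq_const | exact H].
Qed.

(* [f] is the sum of a power series at [z0] whose weighted l^1 norm
   [sum |a_k| r^k] is at most [M]: a Banach algebra norm. *)
Definition analytic_bound (f : C -> C) (z0 : C) (r M : R) : Prop :=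
  exists a : nat -> C,
    (forall n, sum_n (fun k => Cmod (a k) * r ^ k) n <= M) /\
    (forall h, Cmod h <= r ->
       is_Cseries (fun k => Cpow h k * a k)%C (f (z0 + h)%C)).

Lemma Cmod_pow_mult_le (h a : C) (r : R) (k : nat) :
  Cmod h <= r -> Cmod (Cpow h k * a)%C <= Cmod a * r ^ k.
Proof.
  intros H. rewrite Cmod_mult, Cmod_pow, Rmult_comm.
  apply Rmult_le_compat_l; [apply Cmod_ge_0|].
  apply pow_incr; split; [apply Cmod_ge_0 | exact H].
Qed.

(** * The algebra of power series of finite weighted norm *)

Section Closure.
Variables (z0 : C) (r : R).
Hypothesis r_gt0 : 0 < r.

Let term_ge0 (a : nat -> C) k : 0 <= Cmod (a k) * r ^ k.
Proof. apply Rmult_le_pos; [apply Cmod_ge_0 | apply pow_le; lra]. Qed.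

Lemma analytic_bound_ge0 f M : analytic_bound f z0 r M -> 0 <= M.
Proof.
  intros (a & Ha & _). specialize (Ha 0%nat). rewrite sum_O in Ha.
  pose proof (term_ge0 a 0). lra.
Qed.

Lemma analytic_bound_Cmod f M h :
  analytic_bound f z0 r M -> Cmod h <= r -> Cmod (f (z0 + h)%C) <= M.
Proof.
  intros (a & Ha & Hf) Hh.
  destruct (series_nonneg_bounded _ M (term_ge0 a) Ha) as (l & Hl & HlM).
  apply Rle_trans with l; [|exact HlM].
  apply (Cseries_le _ _ _ _ (Hf h Hh) (fun k => Cmod_pow_mult_le h (a k) r k Hh) Hl).
Qed.

Lemma analytic_bound_le f M M' :
  analytic_bound f z0 r M -> M <= M' -> analytic_bound f z0 r M'.
Proof.
  intros (a & Ha & Hf) HM; exists a; split; [|exact Hf].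
  intros n; specialize (Ha n); lra.
Qed.

Lemma analytic_bound_ext f g M :
  (forall h, Cmod h <= r -> f (z0 + h)%C = g (z0 + h)%C) ->
  analytic_bound f z0 r M -> analytic_bound g z0 r M.
Proof.
  intros E (a & Ha & Hf); exists a; split; [exact Ha|].
  intros h Hh; rewrite <- E by exact Hh; now apply Hf.
Qed.

(** Completeness of the algebra, in the form of Weierstrass's theorem: coefficients add up index by
    index, and summability of the norms allows the order of summation to be exchanged. *)
Lemma analytic_bound_series (f : nat -> C -> C) (g : C -> C) (m : nat -> R) (M : R) :
  (forall n, analytic_bound (f n) z0 r (m n)) -> is_series m M ->
  (forall h, Cmod h <= r -> is_Cseries (fun n => f n (z0 + h)%C) (g (z0 + h)%C)) ->
  analytic_bound g z0 r M.
Proof.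
  intros Hf HM Hg.
  assert (HA : exists a : nat -> nat -> C, forall n,
    (forall p, sum_n (fun k => Cmod (a n k) * r ^ k) p <= m n) /\
    (forall h, Cmod h <= r ->
       is_Cseries (fun k => Cpow h k * a n k)%C (f n (z0 + h)%C))).
  (* Countable choice: each coefficient sequence is only known to exist. *)
  { exists (fun n => proj1_sig (constructive_indefinite_description _ (Hf n))).
    intros n. exact (proj2_sig (constructive_indefinite_description _ (Hf n))). }
  destruct HA as [a Ha].
  assert (Hm0 : forall n, 0 <= m n) by (intros n; exact (analytic_bound_ge0 _ _ (Hf n))).
  assert (Hak : forall n k, Cmod (a n k) * r ^ k <= m n).
  { intros n k. apply Rle_trans with (sum_n (fun k => Cmod (a n k) * r ^ k) k); [|apply Ha].
    destruct k as [|k]; [rewrite sum_O; lra|]. rewrite sum_n_SnR.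
    assert (0 <= sum_n (fun k0 : nat => Cmod (a n k0) * r ^ k0) k); [|lra].
    clear -r_gt0 term_ge0. induction k as [|k IH]; [rewrite sum_O | rewrite sum_n_SnR].
    - apply term_ge0.
    - pose proof (term_ge0 (a n) (S k)). lra. }
  assert (Hb : forall k, exists b, is_Cseries (fun n => a n k) b).
  { intros k. apply (ex_Cseries_le _ (fun n => / r ^ k * m n) (/ r ^ k * M)).
    - intros n. specialize (Hak n k).
      assert (0 < r ^ k) by (apply pow_lt; exact r_gt0).
      apply Rmult_le_reg_r with (r ^ k); [assumption|].
      eapply Rle_trans; [exact Hak|]. right. field. lra.
    - apply (is_series_scal_l (/ r ^ k) m M HM). }
  assert (Hb' : exists b : nat -> C, forall k, is_Cseries (fun n => a n k) (b k)).
  { exists (fun k => proj1_sig (constructive_indefinite_description _ (Hb k))).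
    intros k. exact (proj2_sig (constructive_indefinite_description _ (Hb k))). }
  clear Hb; destruct Hb' as [b Hb].
  assert (HbK : forall h, forall K, is_Cseries
    (fun n => sum_n (fun k => Cpow h k * a n k)%C K) (sum_n (fun k => Cpow h k * b k)%C K)).
  { intros h K.
    apply (is_series_sum_n (V := C_NormedModule) (fun k n => Cpow h k * a n k)%C (fun k => Cpow h k * b k)%C).
    intros k. exact (is_series_scal_l (V := C_NormedModule) (Cpow h k) _ _ (Hb k)). }
  assert (HnK : forall h K n, Cmod h <= r -> Cmod (sum_n (fun k => Cpow h k * a n k)%C K) <= m n).
  { intros h K n Hh. apply Rle_trans with (sum_n (fun k => Cmod (a n k) * r ^ k) K); [|apply Ha].
    induction K as [|K IH]; [rewrite !sum_O; now apply Cmod_pow_mult_le|].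
    rewrite sum_n_SnC, sum_n_SnR. eapply Rle_trans; [apply Cmod_triangle|].
    apply Rplus_le_compat; [exact IH | now apply Cmod_pow_mult_le]. }
  exists b; split.
  - intros K.
    (* [s] is the [k]-th column sum of absolute values. It dominates the [k]-th term of the new
       norm, and finitely many columns together stay below [M]. *)
    assert (Habs : forall k, exists s, is_series (fun n => Cmod (a n k) * r ^ k) s /\ Cmod (b k) * r ^ k <= s).
    { intros k. 
      destruct (ex_series_le (V := R_CompleteNormedModule) (fun n => Cmod (a n k) * r ^ k) m) as [s Hs].
      - intros n. unfold norm; simpl. unfold abs; simpl. rewrite Rabs_pos_eq; [apply Hak | apply term_ge0].
      - exists M; exact HM.
      - exists s; split; [exact Hs|].
        apply Rle_trans with (Cmod (RtoC (r ^ k) * b k)%C).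
        + rewrite Cmod_mult, Cmod_R, Rabs_pos_eq by (apply pow_le; lra). lra.
        + apply (Cseries_le (fun n => RtoC (r ^ k) * a n k)%C _ (fun n => Cmod (a n k) * r ^ k) s).
          * exact (is_series_scal_l (V := C_NormedModule) (RtoC (r ^ k)) _ _ (Hb k)).
          * intros n. rewrite Cmod_mult, Cmod_R, Rabs_pos_eq by (apply pow_le; lra). lra.
          * exact Hs. }
    assert (Hs : exists s : nat -> R, forall k, is_series (fun n => Cmod (a n k) * r ^ k) (s k) /\ Cmod (b k) * r ^ k <= s k).
    { exists (fun k => proj1_sig (constructive_indefinite_description _ (Habs k))).
      intros k. exact (proj2_sig (constructive_indefinite_description _ (Habs k))). }
    destruct Hs as [s Hs].
    apply Rle_trans with (sum_n s K).
    + rewrite !sum_n_Reals. apply sum_Rle. intros k _. apply Hs.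
    + pose proof (is_series_sum_n (fun k n => Cmod (a n k) * r ^ k) s K (fun k => proj1 (Hs k))) as H1.
      apply (is_lim_seq_le (sum_n (fun n => sum_n (fun k => Cmod (a n k) * r ^ k) K)) (sum_n m) (sum_n s K) M);
        [|exact H1 | exact HM].
      intros n. rewrite (sum_n_Reals _ n), (sum_n_Reals m n). apply sum_Rle. intros j _. apply Ha.
  - intros h Hh.
    (* Truncating after the [N]-th function costs at most the tail [M - sum_n m N], uniformly in the
       degree [K]. *)
    apply (filterlim_uniform_approx eventually _ _
      (fun N K => sum_n (fun k => sum_n (fun n => Cpow h k * a n k)%C N) K)
      (fun N => sum_n (fun n => f n (z0 + h)%C) N) _ (fun N => M - sum_n m N)).
    + exists 0%nat; intros N _; exists 0%nat; intros K _.
      change (Cmod (sum_n (fun k => Cpow h k * b k)%C K -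
        sum_n (fun k => sum_n (fun n => Cpow h k * a n k)%C N) K)%C <= M - sum_n m N).
      rewrite (sum_n_switch (G := C_AbelianMonoid) (fun k n => Cpow h k * a n k)%C K N).
      apply (Cseries_tail_le (fun n => sum_n (fun k => Cpow h k * a n k)%C K)); [apply HbK | exact Hm0 | | exact HM].
      intros n _; now apply HnK.
    + now apply is_series_tail_lim.
    + intros N.
      apply (filterlim_ext (sum_n (fun k => sum_n (fun n => Cpow h k * a n k)%C N))); [reflexivity|].
      apply (is_series_sum_n (V := C_NormedModule) (fun n k => Cpow h k * a n k)%C).
      intros n. now apply Ha.
    + exact (Hg h Hh).
Qed.
End Closure.

Lemma is_series_first (u : nat -> C) (l : C) :
  u 0%nat = l -> (forall k, u (S k) = RtoC 0) -> is_Cseries u l.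
Proof.
  intros H0 HS. apply Cseries_spec. intros eps; exists 0%nat; intros n _.
  assert (E : sum_n u n = l).
  { induction n as [|n IH]; [now rewrite sum_O|]. rewrite sum_n_SnC, IH, HS. apply Cplus_0_r. }
  rewrite E. replace (l - l)%C with (RtoC 0) by ring. rewrite Cmod_0. apply cond_pos.
Qed.

Lemma analytic_bound_const (z0 : C) (r : R) (c : C) :
  analytic_bound (fun _ => c) z0 r (Cmod c).
Proof.
  exists (fun k => match k with O => c | S _ => RtoC 0 end); split.
  - induction n as [|n IH]; [rewrite sum_O; simpl; lra|].
    rewrite sum_n_SnR, Cmod_0. lra.
  - intros h _. apply is_series_first; simpl; [ring | intros k; ring].
Qed.

Lemma analytic_bound_plus f g (z0 : C) (r M N : R) :
  analytic_bound f z0 r M -> analytic_bound g z0 r N -> 0 < r ->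
  analytic_bound (fun z => f z + g z)%C z0 r (M + N).
Proof.
  intros (a & Ha & Hf) (b & Hb & Hg) Hr.
  exists (fun k => a k + b k)%C; split.
  - intros n. apply Rle_trans with
      (sum_n (fun k => Cmod (a k) * r ^ k) n + sum_n (fun k => Cmod (b k) * r ^ k) n).
    + induction n as [|n IH]; [rewrite !sum_O|rewrite !sum_n_SnR].
      * simpl. pose proof (Cmod_triangle (a 0%nat) (b 0%nat)). lra.
      * assert (0 <= r ^ S n) by (apply pow_le; lra).
        pose proof (Rmult_le_compat_r _ _ _ H (Cmod_triangle (a (S n)) (b (S n)))). lra.
    + specialize (Ha n); specialize (Hb n); lra.
  - intros h Hh.
    apply (is_series_ext (V := C_NormedModule) (fun k => plus (Cpow h k * a k)%C (Cpow h k * b k)%C)).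
    + intros k. change (Cpow h k * a k + Cpow h k * b k = Cpow h k * (a k + b k))%C. ring.
    + exact (is_series_plus (V := C_NormedModule) _ _ _ _ (Hf h Hh) (Hg h Hh)).
Qed.

Lemma analytic_bound_scal (c : C) f (z0 : C) (r M : R) :
  analytic_bound f z0 r M ->
  analytic_bound (fun z => c * f z)%C z0 r (Cmod c * M).
Proof.
  intros (a & Ha & Hf).
  exists (fun k => c * a k)%C; split.
  - intros n. rewrite (sum_n_ext _ (fun k => mult (Cmod c) (Cmod (a k) * r ^ k))).
    + rewrite (sum_n_mult_l (K := R_Ring)).
      apply Rmult_le_compat_l; [apply Cmod_ge_0 | apply Ha].
    + intros k. rewrite Cmod_mult. unfold mult; simpl. ring.
  - intros h Hh.
    apply (is_series_ext (V := C_NormedModule) (fun k => scal c (Cpow h k * a k)%C)).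
    + intros k. change (c * (Cpow h k * a k) = Cpow h k * (c * a k))%C. ring.
    + exact (is_series_scal_l (V := C_NormedModule) c _ _ (Hf h Hh)).
Qed.

Lemma analytic_bound_shift f (z0 : C) (r M : R) :
  0 < r -> analytic_bound f z0 r M ->
  analytic_bound (fun z => (z - z0) * f z)%C z0 r (r * M).
Proof.
  intros Hr (a & Ha & Hf).
  exists (fun k => match k with O => RtoC 0 | S k => a k end); split.
  - assert (E : forall n, sum_n (fun k => Cmod match k with 0%nat => 0 | S k0 => a k0 end * r ^ k) (S n)
        = r * sum_n (fun k => Cmod (a k) * r ^ k) n).
    { induction n as [|n IH]; [rewrite sum_n_SnR, !sum_O | rewrite sum_n_SnR, IH, sum_n_SnR].
      - rewrite Cmod_0; simpl; ring.
      - simpl; ring. }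
    intros [|n].
    + rewrite sum_O, Cmod_0. specialize (Ha 0%nat). rewrite sum_O in Ha.
      pose proof (Cmod_ge_0 (a 0%nat)). simpl in *. rewrite Rmult_0_l.
      apply Rmult_le_pos; lra.
    + rewrite E. apply Rmult_le_compat_l; [lra | apply Ha].
  - intros h Hh. specialize (Hf h Hh).
    apply (is_series_decr_1 (V := C_NormedModule)).
    replace (z0 + h - z0)%C with h by ring.
    apply (is_series_ext (V := C_NormedModule) (fun k => scal h (Cpow h k * a k)%C)).
    + intros k. change (h * (Cpow h k * a k) = h * Cpow h k * a k)%C. ring.
    + replace (plus _ _) with (scal (V := C_NormedModule) h (f (z0 + h)%C)).
      * exact (is_series_scal_l (V := C_NormedModule) h _ _ Hf).
      * change (h * f (z0 + h) = h * f (z0 + h) + - (1 * 0))%C. ring.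
Qed.

Lemma analytic_bound_monomial_mult g (z0 : C) (r N : R) (k : nat) :
  0 < r -> analytic_bound g z0 r N ->
  analytic_bound (fun z => Cpow (z - z0) k * g z)%C z0 r (r ^ k * N).
Proof.
  intros Hr Hg; induction k as [|k IH].
  - simpl. rewrite Rmult_1_l.
    apply (analytic_bound_ext z0 r g); [|exact Hg]. intros h _; ring.
  - apply (analytic_bound_le z0 r _ (r * (r ^ k * N))); [|simpl; lra].
    apply (analytic_bound_ext z0 r (fun z => (z - z0) * (Cpow (z - z0) k * g z))%C).
    + intros h _. simpl. ring.
    + now apply analytic_bound_shift.
Qed.

(** Only [f] is expanded: [f g] is the sum of the functions [a_k (z - z0)^k g], of norm at most
    [|a_k| r^k N], which [analytic_bound_series] adds up. *)
Lemma analytic_bound_mult f g (z0 : C) (r M N : R) :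
  0 < r -> analytic_bound f z0 r M -> analytic_bound g z0 r N ->
  analytic_bound (fun z => f z * g z)%C z0 r (M * N).
Proof.
  intros Hr (a & Ha & Hf) Hg.
  pose proof (analytic_bound_ge0 z0 r Hr g N Hg) as HN.
  destruct (series_nonneg_bounded (fun k => Cmod (a k) * r ^ k) M) as (l & Hl & HlM); [|exact Ha|].
  { intros k. apply Rmult_le_pos; [apply Cmod_ge_0 | apply pow_le; lra]. }
  apply (analytic_bound_le z0 r _ (l * N)); [|now apply Rmult_le_compat_r].
  apply (analytic_bound_series z0 r Hr
    (fun k z => a k * (Cpow (z - z0) k * g z))%C _ (fun k => Cmod (a k) * r ^ k * N)).
  - intros k. rewrite Rmult_assoc. apply analytic_bound_scal.
    now apply analytic_bound_monomial_mult.
  - apply (is_series_scal_r N _ _ Hl).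
  - intros h Hh.
    apply (is_series_ext (V := C_NormedModule) (fun k => scal (g (z0 + h)%C) (Cpow h k * a k)%C)).
    + intros k. replace (z0 + h - z0)%C with h by ring.
      change (g (z0 + h) * (Cpow h k * a k) = a k * (Cpow h k * g (z0 + h)))%C. ring.
    + rewrite Cmult_comm. exact (is_series_scal_l (V := C_NormedModule) _ _ _ (Hf h Hh)).
Qed.

Lemma analytic_bound_pow g (z0 : C) (r rho : R) (k : nat) :
  0 < r -> analytic_bound g z0 r rho ->
  analytic_bound (fun z => Cpow (g z) k) z0 r (rho ^ k).
Proof.
  intros Hr Hg; induction k as [|k IH].
  - simpl. pose proof (analytic_bound_const z0 r 1) as H. now rewrite Cmod_1 in H.
  - simpl. now apply analytic_bound_mult.
Qed.

(** Substitution into a power series: [phi (g z)] is the sum of [c_k (g z)^k], and [g^k] has norm at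
    most [rho^k]. *)
Lemma analytic_bound_comp g (phi : C -> C) (c : nat -> C) (z0 : C) (r rho S : R) :
  0 < r -> analytic_bound g z0 r rho ->
  is_series (fun k => Cmod (c k) * rho ^ k) S ->
  (forall w, Cmod w <= rho -> is_Cseries (fun k => c k * Cpow w k)%C (phi w)) ->
  analytic_bound (fun z => phi (g z)) z0 r S.
Proof.
  intros Hr Hg HS Hphi.
  apply (analytic_bound_series z0 r Hr (fun k z => c k * Cpow (g z) k)%C _
    (fun k => Cmod (c k) * rho ^ k)); [|exact HS|].
  - intros k. apply analytic_bound_scal. now apply analytic_bound_pow.
  - intros h Hh. apply Hphi. now apply (analytic_bound_Cmod z0 r Hr g).
Qed.

Lemma is_Cseries_geom (q : C) :
  Cmod q < 1 -> is_Cseries (fun k => Cpow q k) (/ (1 - q))%C.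
Proof.
  intros Hq.
  assert (H1 : (1 - q)%C <> RtoC 0).
  { intros E. assert (q = RtoC 1) by (replace q with (1 - (1 - q))%C by ring; rewrite E; ring).
    subst q. rewrite Cmod_1 in Hq. lra. }
  assert (E : forall n, (sum_n (fun k => Cpow q k) n - / (1 - q) = - / (1 - q) * Cpow q (S n))%C).
  { induction n as [|n IH].
    - rewrite sum_O. simpl. field. exact H1.
    - rewrite sum_n_SnC.
      replace (sum_n (fun k => Cpow q k) n + Cpow q (S n) - / (1 - q))%C with
        (sum_n (fun k => Cpow q k) n - / (1 - q) + Cpow q (S n))%C by ring.
      rewrite IH. simpl. field. exact H1. }
  apply Cseries_spec; intros eps.
  pose proof (is_lim_seq_geom (Cmod q)) as Hg.
  rewrite Rabs_pos_eq in Hg by apply Cmod_ge_0. specialize (Hg Hq).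
  pose proof (is_lim_seq_scal_l _ (Cmod (- / (1 - q))%C) _ Hg) as Hl.
  simpl in Hl. rewrite Rmult_0_r in Hl.
  apply is_lim_seq_spec in Hl. destruct (Hl eps) as [N HN].
  exists N; intros n Hn. rewrite E, Cmod_mult, Cmod_pow.
  specialize (HN (S n) ltac:(lia)). rewrite Rminus_0_r in HN.
  eapply Rle_lt_trans; [apply Rle_abs | exact HN].
Qed.

(** Neumann series [1/(c0 + g) = (1/c0) sum (- g / c0)^k], of ratio [rho / |c0| < 1] in norm. *)
Lemma analytic_bound_inv g (c0 : C) (z0 : C) (r rho : R) :
  0 < r -> analytic_bound g z0 r rho -> rho < Cmod c0 ->
  analytic_bound (fun z => / (c0 + g z))%C z0 r (/ (Cmod c0 - rho)).
Proof.
  intros Hr Hg Hrho.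
  pose proof (analytic_bound_ge0 z0 r Hr g rho Hg) as Hrho0.
  assert (Hc0 : c0 <> RtoC 0) by (apply Cmod_gt_0; lra).
  apply (analytic_bound_comp g (fun w => / (c0 + w))%C
    (fun k => / c0 * Cpow (- / c0) k)%C z0 r rho); [exact Hr | exact Hg | |].
  - apply (is_series_ext (fun k => / Cmod c0 * (rho / Cmod c0) ^ k)).
    + intros k. rewrite Cmod_mult, Cmod_pow, Cmod_opp, Cmod_inv by exact Hc0.
      unfold Rdiv. rewrite Rpow_mult_distr. eqR. ring.
    + replace (/ (Cmod c0 - rho)) with (/ Cmod c0 * / (1 - rho / Cmod c0)) by (field; lra).
      apply (is_series_scal_l (V := R_NormedModule) (/ Cmod c0) (fun k => (rho / Cmod c0) ^ k)).
      apply is_series_geom. rewrite Rabs_pos_eq.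
      * apply Rmult_lt_reg_r with (Cmod c0); [lra|]. unfold Rdiv. rewrite Rmult_assoc, Rinv_l; lra.
      * apply Rmult_le_pos; [lra | left; apply Rinv_0_lt_compat; lra].
  - intros w Hw.
    assert (Hq : Cmod (- / c0 * w)%C < 1).
    { rewrite Cmod_mult, Cmod_opp, Cmod_inv by exact Hc0.
      apply Rmult_lt_reg_l with (Cmod c0); [lra|].
      rewrite <- Rmult_assoc, Rinv_r; lra. }
    apply (is_series_ext (V := C_NormedModule) (fun k => scal (/ c0)%C (Cpow (- / c0 * w) k)%C)).
    + intros k. change (/ c0 * Cpow (- / c0 * w) k = / c0 * Cpow (- / c0) k * Cpow w k)%C.
      rewrite Cpow_mult_l. ring.
    + assert (Hd : (c0 + w)%C <> RtoC 0).
      { intros E. assert (w = (- c0)%C) by (replace w with (c0 + w - c0)%C by ring; rewrite E; ring).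
        subst w. rewrite Cmod_opp in Hw. lra. }
      replace (/ (c0 + w))%C with (/ c0 * / (1 - - / c0 * w))%C.
      * exact (is_series_scal_l (V := C_NormedModule) (/ c0)%C _ _ (is_Cseries_geom _ Hq)).
      * field. repeat split; auto. 
Qed.

(** * The complex exponential *)

Lemma exp_mono (x y : R) : x <= y -> exp x <= exp y.
Proof.
  intros [H|H]; [left; now apply exp_increasing | right; now rewrite H].
Qed.

Lemma Cexp_plus (z w : C) : Cexp (z + w)%C = (Cexp z * Cexp w)%C.
Proof.
  destruct z as [a b], w as [c d]. unfold Cexp, Cmult; simpl.
  rewrite exp_plus, cos_plus, sin_plus. f_equal; ring.
Qed.

Lemma Cexp_0 : Cexp 0 = RtoC 1.
Proof. unfold Cexp; simpl. rewrite exp_0, cos_0, sin_0. unfold RtoC. f_equal; ring. Qed.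

Lemma Cmod_Cexp (z : C) : Cmod (Cexp z) = exp (Re z).
Proof.
  unfold Cmod, Cexp; simpl fst; simpl snd.
  replace ((exp (Re z) * cos (Im z)) ^ 2 + (exp (Re z) * sin (Im z)) ^ 2) with
    ((exp (Re z))² * ((sin (Im z))² + (cos (Im z))²)) by (unfold Rsqr; ring).
  rewrite sin2_cos2, Rmult_1_r. apply sqrt_Rsqr. left; apply exp_pos.
Qed.

Lemma is_derive_Re_Cexp (c z : C) (t : R) :
  is_derive (fun t : R => Re (c * Cexp (RtoC t * z))%C) t
    (Re (c * z * Cexp (RtoC t * z))%C).
Proof.
  destruct c as [p q], z as [x y]. unfold Cexp, Cmult, Re, Im, RtoC; simpl.
  auto_derive; [trivial|]. unfold Rminus. ring.
Qed.

Lemma is_derive_n_Re_Cexp (c z : C) (n : nat) (t : R) :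
  is_derive_n (fun t : R => Re (c * Cexp (RtoC t * z))%C) n t
    (Re (c * Cpow z n * Cexp (RtoC t * z))%C).
Proof.
  revert t; induction n as [|n IH]; intros t.
  - change (Cpow z 0) with (RtoC 1). now rewrite Cmult_1_r.
  - change (is_derive (Derive_n (fun t : R => Re (c * Cexp (RtoC t * z))%C) n) t
      (Re (c * (z * Cpow z n) * Cexp (RtoC t * z))%C)).
    apply (is_derive_ext (fun t : R => Re (c * Cpow z n * Cexp (RtoC t * z))%C)).
    + intros s. symmetry. apply is_derive_n_unique, IH.
    + replace (c * (z * Cpow z n))%C with (c * Cpow z n * z)%C by ring.
      apply is_derive_Re_Cexp.
Qed.

Lemma Re_sum_n (u : nat -> C) (n : nat) : Re (sum_n u n) = sum_n (fun k => Re (u k)) n.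
Proof.
  induction n as [|n IH]; [now rewrite !sum_O|].
  rewrite sum_n_SnC, sum_n_SnR, <- IH. reflexivity.
Qed.

Lemma Im_sum_n (u : nat -> C) (n : nat) : Im (sum_n u n) = sum_n (fun k => Im (u k)) n.
Proof.
  induction n as [|n IH]; [now rewrite !sum_O|].
  rewrite sum_n_SnC, sum_n_SnR, <- IH. reflexivity.
Qed.

Lemma sum_n_Cmult_l (c : C) (u : nat -> C) (n : nat) :
  sum_n (fun k => c * u k)%C n = (c * sum_n u n)%C.
Proof. exact (sum_n_mult_l (K := C_Ring) c u n). Qed.

Lemma sum_n_Rmult_l (c : R) (u : nat -> R) (n : nat) :
  sum_n (fun k => c * u k) n = c * sum_n u n.
Proof. exact (sum_n_mult_l (K := R_Ring) c u n). Qed.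

Lemma sum_n_Rmult_r (c : R) (u : nat -> R) (n : nat) :
  sum_n (fun k => u k * c) n = sum_n u n * c.
Proof. exact (sum_n_mult_r (K := R_Ring) c u n). Qed.

(** Taylor's theorem with Lagrange remainder concerns real functions, so it is applied to
    [t -> Re (conj w * exp (t z))], where [w] is the very remainder to be bounded. Its own remainder
    is then [|w|^2] up to sign, and the Lagrange form bounds it by [|w|] times the claim. *)
Lemma Cexp_remainder_le (z : C) (n : nat) :
  Cmod (sum_n (fun k => RtoC (/ INR (Factorial.fact k)) * Cpow z k)%C n - Cexp z)%C
    <= exp (Cmod z) * (Cmod z ^ S n / INR (Factorial.fact (S n))).
Proof.
  set (w := (sum_n (fun k => RtoC (/ INR (Factorial.fact k)) * Cpow z k)%C n - Cexp z)%C).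
  set (c := Cconj w).
  destruct (Taylor_Lagrange (fun t : R => Re (c * Cexp (RtoC t * z))%C) n 0 1) as (t & Ht & E).
  { lra. }
  { intros t _ k _. destruct k as [|k]; [exact I|].
    exists (Re (c * Cpow z (S k) * Cexp (RtoC t * z))%C).
    exact (is_derive_n_Re_Cexp c z (S k) t). }
  rewrite <- sum_n_Reals in E.
  rewrite (sum_n_ext _ (fun k => Re (c * (RtoC (/ INR (Factorial.fact k)) * Cpow z k))%C)) in E.
  2:{ intros k. rewrite (is_derive_n_unique _ _ _ _ (is_derive_n_Re_Cexp c z k 0)).
      rewrite Rminus_0_r, pow1. replace (RtoC 0 * z)%C with (RtoC 0) by ring.
      rewrite Cexp_0, Cmult_1_r.
      destruct c as [p q], (Cpow z k) as [x y]. unfold Cmult, Re, RtoC; simpl.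
      field. apply INR_fact_neq_0. }
  rewrite <- Re_sum_n, sum_n_Cmult_l in E.
  rewrite (is_derive_n_unique _ _ _ _ (is_derive_n_Re_Cexp c z (S n) t)) in E.
  rewrite Rminus_0_r, pow1, Cmult_1_l in E.
  assert (Ew : Cmod w ^ 2 = - (1 / INR (Factorial.fact (S n)) * Re (c * Cpow z (S n) * Cexp (RtoC t * z))%C)).
  { pose proof (Cmod2_conj w) as H. apply (f_equal Re) in H.
    fold c in H.
    change (Cmod w ^ 2 = Re (w * c)%C) in H.
    rewrite H. unfold w at 1. revert E.
    set (s := sum_n _ n). destruct c as [p q], s as [x y], (Cexp z) as [x' y'].
    unfold Cmult, Cminus, Cplus, Copp, Re; simpl. lra. }
  assert (Hr : Rabs (Re (c * Cpow z (S n) * Cexp (RtoC t * z))%C) <= Cmod w * Cmod z ^ S n * exp (Cmod z)).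
  { eapply Rle_trans; [apply re_le_Cmod|].
    rewrite !Cmod_mult, Cmod_pow, Cmod_Cexp. unfold c; rewrite Cmod_conj.
    apply Rmult_le_compat_l.
    - apply Rmult_le_pos; [apply Cmod_ge_0 | apply pow_le, Cmod_ge_0].
    - apply exp_mono. eapply Rle_trans; [apply Rle_abs|].
      eapply Rle_trans; [apply re_le_Cmod|].
      rewrite Cmod_mult, Cmod_R, Rabs_pos_eq by lra.
      pose proof (Cmod_ge_0 z). nra. }
  assert (Hf : 0 < INR (Factorial.fact (S n))) by apply INR_fact_lt_0.
  destruct (Req_dec (Cmod w) 0) as [H0|H0].
  { rewrite H0. apply Rmult_le_pos; [left; apply exp_pos|].
    apply Rmult_le_pos; [apply pow_le, Cmod_ge_0 | left; now apply Rinv_0_lt_compat]. }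
  assert (H1 : 0 < Cmod w) by (pose proof (Cmod_ge_0 w); lra).
  apply Rmult_le_reg_l with (Cmod w); [exact H1|].
  replace (Cmod w * Cmod w) with (Cmod w ^ 2) by ring. rewrite Ew.
  apply Rle_trans with (/ INR (Factorial.fact (S n)) * (Cmod w * Cmod z ^ S n * exp (Cmod z))).
  - unfold Rdiv; rewrite Rmult_1_l, Ropp_mult_distr_r.
    apply Rmult_le_compat_l; [left; now apply Rinv_0_lt_compat|].
    eapply Rle_trans; [|exact Hr]. rewrite <- Rabs_Ropp. apply Rle_abs.
  - right. field. lra.
Qed.

Lemma is_Cseries_Cexp (z : C) :
  is_Cseries (fun k => RtoC (/ INR (Factorial.fact k)) * Cpow z k)%C (Cexp z).
Proof.
  apply Cseries_spec; intros eps.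
  pose proof (cv_speed_pow_fact (Cmod z)) as H.
  apply is_lim_seq_Reals in H.
  apply (is_lim_seq_scal_l _ (exp (Cmod z))) in H. simpl in H.
  rewrite Rmult_0_r in H.
  apply is_lim_seq_spec in H. destruct (H eps) as [N HN].
  exists N; intros n Hn. specialize (HN (S n) ltac:(lia)).
  eapply Rle_lt_trans; [apply Cexp_remainder_le|].
  rewrite Rminus_0_r in HN. eapply Rle_lt_trans; [apply Rle_abs | exact HN].
Qed.

Lemma is_series_exp (x : R) : is_series (fun k => / INR (Factorial.fact k) * x ^ k) (exp x).
Proof.
  pose proof (is_exp_Reals x) as H. apply is_pseries_R in H. exact H.
Qed.

Lemma Cmod_inv_fact k : Cmod (RtoC (/ INR (Factorial.fact k))) = / INR (Factorial.fact k).
Proof.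
  rewrite Cmod_R, Rabs_pos_eq; [reflexivity|].
  left; apply Rinv_0_lt_compat, INR_fact_lt_0.
Qed.

Lemma analytic_bound_Cexp g (z0 : C) (r rho : R) :
  0 < r -> analytic_bound g z0 r rho ->
  analytic_bound (fun z => Cexp (g z)) z0 r (exp rho).
Proof.
  intros Hr Hg.
  apply (analytic_bound_comp g Cexp (fun k => RtoC (/ INR (Factorial.fact k))) z0 r rho); auto.
  - apply (is_series_ext (fun k => / INR (Factorial.fact k) * rho ^ k)).
    + intros k. now rewrite Cmod_inv_fact.
    + apply is_series_exp.
  - intros w _. apply is_Cseries_Cexp.
Qed.

Lemma is_series_drop2 {K : AbsRing} {V : NormedModule K} (u : nat -> V) (l : V) :
  is_series u l ->
  is_series (fun k => match k with S (S _) => u k | _ => zero end)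
    (minus (minus l (u 0%nat)) (u 1%nat)).
Proof.
  intros H.
  assert (Z : forall x : V, plus x (opp zero) = x).
  { intros x. exact (minus_zero_r x). }
  assert (E : forall x y : V, plus (minus x y) y = x).
  { intros x y. unfold minus. rewrite <- plus_assoc, (plus_opp_l y). apply plus_zero_r. }
  apply is_series_decr_1, is_series_decr_1. cbv beta iota. rewrite !Z.
  apply (is_series_incr_1 (fun k => u (S k))), is_series_incr_1.
  rewrite !E.
  exact H.
Qed.

Lemma exp_sub1_sub_le (x : R) : 0 <= x -> exp x - 1 - x <= x ^ 2 * exp x.
Proof.
  intros Hx.
  assert (H : exp x - 1 <= x * exp x).
  { pose proof (exp_ineq1_le (- x)) as H.
    apply (Rmult_le_compat_r (exp x) _ _ (Rlt_le _ _ (exp_pos x))) in H.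
    rewrite <- exp_plus in H. replace (- x + x) with 0 in H by ring.
    rewrite exp_0 in H. lra. }
  pose proof (Rmult_le_compat_l x _ _ Hx H). lra.
Qed.

(** Dropping the constant and linear terms of the exponential series gains a factor [rho^2]. In
    [zeta_term_bound], where [rho] is of order [1/n], this gain makes the increments summable. *)
Lemma analytic_bound_Cexp_order2 g (z0 : C) (r rho : R) :
  0 < r -> analytic_bound g z0 r rho ->
  analytic_bound (fun z => Cexp (g z) - 1 - g z)%C z0 r (rho ^ 2 * exp rho).
Proof.
  intros Hr Hg.
  pose proof (analytic_bound_ge0 z0 r Hr g rho Hg) as Hrho.
  apply (analytic_bound_le z0 r _ (exp rho - 1 - rho)); [|now apply exp_sub1_sub_le].
  apply (analytic_bound_comp g (fun w => Cexp w - 1 - w)%C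
    (fun k => match k with S (S _) => RtoC (/ INR (Factorial.fact k)) | _ => RtoC 0 end) z0 r rho); auto.
  - pose proof (is_series_drop2 _ _ (is_series_exp rho)) as H.
    replace (exp rho - 1 - rho) with (minus (minus (exp rho) (/ INR (Factorial.fact 0) * rho ^ 0)) (/ INR (Factorial.fact 1) * rho ^ 1))
      by (unfold minus, plus, opp; simpl; field).
    refine (is_series_ext _ _ _ _ H).
    intros [|[|k]]; [| |now rewrite Cmod_inv_fact]; rewrite Cmod_0; unfold zero; simpl; ring.
  - intros w _.
    pose proof (is_series_drop2 (V := C_NormedModule) _ _ (is_Cseries_Cexp w)) as H.
    replace (Cexp w - 1 - w)%C with (minus (G := C_NormedModule) (minus (G := C_NormedModule) (Cexp w) (RtoC (/ INR (Factorial.fact 0)) * Cpow w 0)%C) (RtoC (/ INR (Factorial.fact 1)) * Cpow w 1)%C).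
    + refine (is_series_ext (V := C_NormedModule) _ _ _ _ H).
      intros [|[|k]]; [| |reflexivity]; unfold zero; simpl; eqC; ring.
    + change (Cexp w - RtoC (/ 1) * 1 - RtoC (/ 1) * (w * 1) = Cexp w - 1 - w)%C.
      rewrite Rinv_1. ring.
Qed.

(** A series convergent at radius [2 r] has bounded terms [|a_k| (2 r)^k], so at radius [r] it is
    dominated by [B 2^(-k)]. *)
Lemma analytic_at_bound (f : C -> C) (z0 : C) :
  analytic_at (K := C_AbsRing) f z0 ->
  exists r M, 0 < r /\ analytic_bound f z0 r M.
Proof.
  intros (a & e & He).
  assert (Hball : forall h, Cmod h < e -> is_Cseries (fun k => Cpow h k * a k)%C (f (z0 + h)%C)).
  { intros h Hh. apply is_pseries_C_series.
    assert (E : minus (G := C_AbsRing) (z0 + h)%C z0 = h).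
    { change (z0 + h - z0 = h)%C. ring. }
    rewrite <- E at 1. apply He. 
    change (Cmod (minus (G := C_AbsRing) (z0 + h)%C z0) < e). now rewrite E. }
  set (r := e / 4). assert (Hr : 0 < r) by (unfold r; destruct e; simpl; lra).
  assert (Hb : exists B, forall k, Cmod (a k) * (2 * r) ^ k <= B).
  { specialize (Hball (RtoC (2 * r))). rewrite Cmod_R, Rabs_pos_eq in Hball by lra.
    specialize (Hball ltac:(unfold r; destruct e; simpl; lra)).
    destruct (proj1 (Cseries_spec _ _) Hball (mkposreal 1 Rlt_0_1)) as [N HN]; simpl in HN.
    set (t := fun k => Cmod (a k) * (2 * r) ^ k).
    assert (Ht : forall k, Cmod (Cpow (RtoC (2 * r)) k * a k)%C = t k).
    { intros k. rewrite Cmod_mult, Cmod_pow, Cmod_R, Rabs_pos_eq by lra. unfold t; ring. }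
    assert (Ht0 : forall k, 0 <= t k) by (intros k; rewrite <- Ht; apply Cmod_ge_0).
    (* From [N] on the partial sums lie within [1] of the limit, so each later term is below [2];
       the earlier ones are bounded by their sum. *)
    exists (2 + sum_n t N). intros k. fold (t k).
    destruct (Nat.le_gt_cases k N) as [Hk|Hk].
    - assert (t k <= sum_n t N); [|lra].
      clear -Ht0 Hk. induction Hk as [|N Hk IH].
      + destruct k as [|k]; [rewrite sum_O; lra|]. rewrite sum_n_SnR.
        assert (0 <= sum_n t k); [|lra].
        clear -Ht0; induction k as [|k IH]; [rewrite sum_O; apply Ht0 | rewrite sum_n_SnR].
        specialize (Ht0 (S k)); lra.
      + rewrite sum_n_SnR. specialize (Ht0 (S N)). lra.
    - destruct k as [|k]; [lia|].
      pose proof (HN k ltac:(lia)) as H1. pose proof (HN (S k) ltac:(lia)) as H2.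
      rewrite sum_n_SnC in H2. rewrite <- Ht.
      set (l := f (z0 + RtoC (2 * r))%C) in *.
      set (u := sum_n (fun k => Cpow (RtoC (2 * r)) k * a k)%C k) in *.
      set (x := (Cpow (RtoC (2 * r)) (S k) * a (S k))%C) in *.
      replace x with (u + x - l + - (u - l))%C by ring.
      eapply Rle_trans; [apply Cmod_triangle|]. rewrite Cmod_opp.
      assert (0 <= sum_n t N); [|lra].
      clear -Ht0; induction N as [|k IH]; [rewrite sum_O; apply Ht0 | rewrite sum_n_SnR].
      specialize (Ht0 (S k)); lra. }
  destruct Hb as [B HB].
  exists r, (B * 2); split; [exact Hr|]. exists a; split.
  - intros n.
    assert (Hg : is_series (fun k => B * (/ 2) ^ k) (B * 2)).
    { replace (B * 2) with (B * / (1 - / 2)) by field.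
      apply (is_series_scal_l (V := R_NormedModule) B (fun k => (/ 2) ^ k)), is_series_geom.
      rewrite Rabs_pos_eq; lra. }
    assert (HB0 : 0 <= B).
    { specialize (HB 0%nat). pose proof (Cmod_ge_0 (a 0%nat)). simpl in HB. lra. }
    apply Rle_trans with (sum_n (fun k => B * (/ 2) ^ k) n).
    + rewrite !sum_n_Reals. apply sum_Rle. intros k _.
      replace (r ^ k) with ((2 * r) ^ k * (/ 2) ^ k).
      * rewrite <- Rmult_assoc. apply Rmult_le_compat_r; [apply pow_le; lra | apply HB].
      * rewrite <- Rpow_mult_distr. f_equal. field.
    + apply sum_n_le_series; [|exact Hg].
      intros k. apply Rmult_le_pos; [exact HB0 | apply pow_le; lra].
  - intros h Hh. apply Hball. unfold r in *; destruct e; simpl in *; lra.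
Qed.

(** * Restriction to real lines and the identity theorem *)

Lemma is_Cseries_Re (u : nat -> C) (l : C) :
  is_Cseries u l -> is_series (fun k => Re (u k)) (Re l).
Proof.
  intros H. apply (filterlim_locally (U := R_UniformSpace)). intros eps.
  destruct (proj1 (Cseries_spec u l) H eps) as [N HN]; exists N; intros n Hn.
  change (Rabs (sum_n (fun k => Re (u k)) n - Re l) < eps).
  rewrite <- Re_sum_n. eapply Rle_lt_trans; [apply (re_le_Cmod (sum_n u n - l)%C)|].
  now apply HN.
Qed.

Lemma Re_mult_Ci (z : C) : Re (- Ci * z)%C = Im z.
Proof. destruct z; unfold Ci, Cmult, Re, Im; simpl; ring. Qed.

(** Real increments stay on the horizontal line, so the real parts of the coefficients form a real
    power series. Imaginary parts are reached by applying this to [- Ci * f]. *)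
Lemma analytic_bound_real (f : C -> C) (x y r M : R) :
  0 < r -> analytic_bound f (x, y) r M ->
  analytic_at (K := R_AbsRing) (fun t => Re (f (t, y))) x.
Proof.
  intros Hr (a & _ & Hf).
  exists (fun k => Re (a k)). exists (mkposreal r Hr).
  enough (E : forall t : R, Rabs (t - x) < r ->
    is_pseries (fun k => Re (a k)) (t - x) (Re (f (t, y)))) by exact E.
  intros t Ht. apply is_pseries_R.
  assert (Hh : Cmod (RtoC (t - x)) <= r) by (rewrite Cmod_R; lra).
  pose proof (is_Cseries_Re _ _ (Hf (RtoC (t - x)) Hh)) as H.
  replace ((x, y) + RtoC (t - x))%C with ((t, y) : C) in H
    by (unfold RtoC, Cplus; simpl; f_equal; ring).
  refine (is_series_ext _ _ _ _ H).
  intros k. rewrite <- RtoC_pow.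
  destruct (a k) as [p q]; unfold Cmult, RtoC, Re; simpl; eqR; ring.
Qed.

Lemma pseries_continuous (a : nat -> R) (r : R) :
  0 < r -> ex_pseries a r ->
  filterlim (PSeries a) (locally 0) (locally (a 0%nat)).
Proof.
  intros Hr H.
  assert (HCV : Rbar_lt (Rabs 0) (CV_radius a)).
  { rewrite Rabs_R0. apply Rbar_lt_le_trans with r; [exact Hr|].
    apply Rbar_not_lt_le. intros Hlt. apply (CV_disk_outside a r).
    - now rewrite Rabs_pos_eq by lra.
    - apply ex_series_lim_0. destruct H as [l Hl]. exists l. now apply is_pseries_R. }
  pose proof (PSeries_continuity a 0 HCV) as H1.
  rewrite <- (PSeries_0 a). exact (proj1 (continuity_pt_filterlim _ _) H1).
Qed.

(** Continuity at [0] forces [a 0 = 0]; dividing by [h] and shifting the coefficients repeats the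
    argument. *)
Lemma pseries_right_zero (k : nat) : forall (a : nat -> R) (r : R),
  0 < r -> (forall h, 0 < h < r -> is_pseries a h 0) -> a k = 0.
Proof.
  assert (H0 : forall (a : nat -> R) (r : R),
    0 < r -> (forall h, 0 < h < r -> is_pseries a h 0) -> a 0%nat = 0).
  { intros a r Hr Ha.
    assert (Hex : ex_pseries a (r / 2)) by (exists 0; apply Ha; lra).
    pose proof (pseries_continuous a (r / 2) ltac:(lra) Hex) as Hc.
    apply (filterlim_locally_unique (F := at_right 0) (PSeries a)).
    - eapply filterlim_filter_le_1; [|exact Hc]. apply filter_le_within.
    - apply (filterlim_ext_loc (fun _ => 0)); [|apply filterlim_const].
      exists (mkposreal r Hr). intros h Hh Hh0. symmetry.
      apply is_pseries_unique, Ha.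
      change (Rabs (h - 0) < r) in Hh. apply Rabs_def2 in Hh. lra. }
  induction k as [|k IH]; intros a r Hr Ha; [now apply (H0 a r)|].
  apply (IH (PS_decr_1 a) r Hr). intros h Hh.
  pose proof (is_pseries_decr_1 a h (/ h) 0) as H.
  assert (E : scal (/ h) (plus 0 (opp (a 0%nat))) = 0).
  { rewrite (H0 a r Hr Ha). change (/ h * (0 + - 0) = 0). ring. }
  rewrite <- E. apply H; [|now apply Ha]. change (/ h * h = 1). field. lra.
Qed.

(** If [u a] were nonzero, the zeros would extend from infinity down to a last point [b - T]. The
    Taylor series there vanishes to the right, so its coefficients are zero and [u] also vanishes a
    little to the left, against the choice of [T]. *)
Lemma real_identity_theorem (u : R -> R) (a b : R) :
  (forall x, a <= x -> analytic_at (K := R_AbsRing) u x) ->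
  (forall x, b < x -> u x = 0) -> u a = 0.
Proof.
  intros Hu Hb.
  destruct (Req_dec (u a) 0) as [|Hne]; [assumption|exfalso].
  (* [t] measures how far to the left of [b] the zeros reach, so that the extremal point is a
     supremum; [u a <> 0] bounds it by [b - a]. *)
  set (E := fun t => forall x, a <= x -> b - t < x -> u x = 0).
  assert (HE : forall t, E t -> t <= b - a).
  { intros t Ht. apply Rnot_lt_le; intros H. apply Hne, Ht; lra. }
  destruct (completeness E) as [T [HT1 HT2]].
  - exists (b - a). exact HE.
  - exists 0. intros x _ Hx. apply Hb. lra.
  - assert (HTa : T <= b - a) by now apply HT2.
    assert (Hr : forall x, a <= x -> b - T < x -> u x = 0).
    { intros x Hx HxT. apply NNPP. intros Hn.
      assert (T <= b - x); [|lra].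
      apply HT2. intros t Ht. apply Rnot_lt_le; intros H. apply Hn, Ht; lra. }
    destruct (Hu (b - T) ltac:(lra)) as (c & e & He).
    assert (He' : forall h, Rabs h < e -> is_pseries c h (u (b - T + h))).
    { intros h Hh. 
      replace h with (minus (G := R_AbsRing) (b - T + h) (b - T)) at 1
        by (change (b - T + h - (b - T) = h); ring).
      apply He. change (Rabs (b - T + h - (b - T)) < e). 
      now replace (b - T + h - (b - T)) with h by ring. }
    assert (Hc : forall k, c k = 0).
    { intros k. apply (pseries_right_zero k c e); [apply cond_pos|].
      intros h Hh. rewrite <- (Hr (b - T + h)) by lra.
      apply He'. rewrite Rabs_pos_eq; lra. }
    assert (HT : T + e / 2 <= T).
    { apply HT1. intros x Hx HxT.
      destruct (Rlt_le_dec (b - T) x) as [H|H]; [now apply Hr|].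
      destruct e as [e e0]; simpl in *.
      specialize (He' (x - (b - T))).
      replace (b - T + (x - (b - T))) with x in He' by ring.
      rewrite <- (is_pseries_unique _ _ _ (He' ltac:(apply Rabs_def1; lra))).
      rewrite (PSeries_ext c (fun _ => 0)) by exact Hc. apply PSeries_const_0. }
    destruct e as [e e0]; simpl in *; lra.
Qed.

Lemma analytic_at_continuous (u : R -> R) (x : R) :
  analytic_at (K := R_AbsRing) u x -> filterlim u (locally x) (locally (u x)).
Proof.
  intros (c & e & He).
  assert (He' : forall h, Rabs h < e -> is_pseries c h (u (x + h))).
  { intros h Hh. 
    replace h with (minus (G := R_AbsRing) (x + h) x) at 1
      by (change (x + h - x = h); ring).
    apply He. change (Rabs (x + h - x) < e). 
    now replace (x + h - x) with h by ring. }
  assert (Hex : ex_pseries c (e / 2)).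
  { eexists. apply He'. destruct e as [e e0]; simpl; rewrite Rabs_pos_eq; lra. }
  pose proof (pseries_continuous c (e / 2) ltac:(destruct e; simpl; lra) Hex) as Hc.
  replace (u x) with (c 0%nat).
  2:{ rewrite <- (PSeries_0 c). rewrite <- (Rplus_0_r x) at 1. apply is_pseries_unique, He'.
      rewrite Rabs_R0; apply cond_pos. }
  apply (filterlim_ext_loc (fun y => PSeries c (y - x))).
  - exists e. intros y Hy. change (Rabs (y - x) < e) in Hy.
    replace y with (x + (y - x)) at 2 by ring. now apply is_pseries_unique, He'.
  - apply (filterlim_comp _ _ _ (fun y => y - x) _ _ (locally 0)); [|exact Hc].
    intros P [d Hd]; exists d; intros y Hy. apply Hd.
    change (Rabs (y - x) < d) in Hy. change (Rabs (y - x - 0) < d). now rewrite Rminus_0_r.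
Qed.

(** * The zeta function to the right of the critical line *)

Definition Cpowneg (x : R) (s : C) : C := Cexp (- s * RtoC (ln x))%C.

Lemma ln_le_sub1 (x : R) : 0 < x -> ln x <= x - 1.
Proof.
  intros Hx. pose proof (exp_ineq1_le (ln x)) as H. rewrite exp_ln in H; lra.
Qed.

Lemma Cmod_Cpowneg (x : R) (s : C) : Cmod (Cpowneg x s) = exp (- Re s * ln x).
Proof.
  unfold Cpowneg. rewrite Cmod_Cexp. f_equal.
  destruct s; unfold Cmult, Copp, RtoC, Re; simpl; ring.
Qed.

Lemma Cpowneg_1 (s : C) : Cpowneg 1 s = RtoC 1.
Proof.
  unfold Cpowneg. rewrite ln_1. replace (- s * 0)%C with (RtoC 0) by ring. apply Cexp_0.
Qed.

(* The Euler-Maclaurin increments of [(1-s) sum_(j <= N) j^(-s) - N^(1-s)], at [N = k+2]. *)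
Definition zeta_term (k : nat) (s : C) : C :=
  ((1 - s) * Cpowneg (INR (S (S k))) s - Cpowneg (INR (S (S k))) (s - 1)
    + Cpowneg (INR (S k)) (s - 1))%C.

Definition zeta_partial (N : nat) (s : C) : C :=
  ((1 - s) * sum_n (fun j => Cpowneg (INR (S j)) s) N - Cpowneg (INR (S N)) (s - 1))%C.

(** Telescoping; the offset [s] is [- zeta_partial 0 s]. *)
Lemma sum_zeta_term (K : nat) (s : C) :
  sum_n (fun k => zeta_term k s) K = (zeta_partial (S K) s + s)%C.
Proof.
  induction K as [|K IH].
  - rewrite sum_O. unfold zeta_term, zeta_partial. rewrite sum_n_SnC, sum_O.
    change (INR 1) with 1. rewrite !Cpowneg_1. eqC. ring.
  - rewrite sum_n_SnC, IH. unfold zeta_term, zeta_partial.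
    rewrite (sum_n_SnC _ (S K)). eqC. ring.
Qed.

(* The decrements of [4 x^(-1/4)] dominate the bounds [n^(-5/4)] on the increments. *)
Definition decay (x : R) : R := 4 * exp (- (/ 4 * ln x)).

Lemma decay_ge0 x : 0 <= decay x.
Proof. unfold decay. pose proof (exp_pos (- (/ 4 * ln x))). lra. Qed.

(** From [ln (1 - 1/x) <= -1/x] and [exp y >= 1 + y]; the factor [4] in [decay] compensates the
    exponent [1/4]. *)
Lemma decay_decrement (x : R) : 1 < x ->
  exp (- (/ 4 * ln x)) / x <= decay (x - 1) - decay x.
Proof.
  intros Hx. unfold decay.
  assert (H1 : ln (x - 1) - ln x <= - / x).
  { rewrite <- ln_div by lra. eapply Rle_trans; [apply ln_le_sub1|].
    - apply Rdiv_lt_0_compat; lra.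
    - right; field; lra. }
  replace (- (/ 4 * ln (x - 1))) with (- (/ 4 * ln x) + - (/ 4 * (ln (x - 1) - ln x))) by ring.
  rewrite exp_plus.
  pose proof (exp_ineq1_le (- (/ 4 * (ln (x - 1) - ln x)))) as H2.
  pose proof (exp_pos (- (/ 4 * ln x))) as H3.
  set (u := exp (- (/ 4 * ln x))) in *.
  set (w := exp (- (/ 4 * (ln (x - 1) - ln x)))) in *.
  assert (H4 : 1 + / 4 * / x <= w) by lra.
  apply Rle_trans with (4 * (u * (1 + / 4 * / x)) - 4 * u).
  - right; field; lra.
  - pose proof (Rmult_le_compat_l u _ _ (Rlt_le _ _ H3) H4). lra.
Qed.

Lemma is_lim_seq_ln_INR_S : is_lim_seq (fun n => ln (INR (S n))) p_infty.
Proof.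
  apply (is_lim_comp_seq ln (fun n => INR (S n)) p_infty p_infty).
  - apply is_lim_ln_p.
  - exists 0%nat; intros n _; discriminate.
  - apply (is_lim_seq_incr_1 INR), is_lim_seq_INR.
Qed.

Lemma is_lim_seq_exp_neg_ln (c : R) : 0 < c ->
  is_lim_seq (fun n => exp (- (c * ln (INR (S n))))) 0.
Proof.
  intros Hc.
  apply (is_lim_comp_seq exp (fun n => - (c * ln (INR (S n)))) m_infty 0).
  - apply is_lim_exp_m.
  - exists 0%nat; intros n _; discriminate.
  - pose proof (is_lim_seq_scal_l _ (- c) _ is_lim_seq_ln_INR_S) as H.
    simpl in H. destruct (Rle_dec 0 (- c)) as [H1|H1]; [lra|].
    apply (is_lim_seq_ext (fun n => - c * ln (INR (S n)))); [intros n; ring | exact H].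
Qed.

Lemma decay_lim : is_lim_seq (fun n => decay (INR (S n))) 0.
Proof.
  pose proof (is_lim_seq_scal_l _ 4 _ (is_lim_seq_exp_neg_ln (/ 4) ltac:(lra))) as H.
  simpl in H. now rewrite Rmult_0_r in H.
Qed.

Definition decay_term (k : nat) : R := decay (INR (S k)) - decay (INR (S (S k))).

Lemma sum_decay_term K : sum_n decay_term K = decay 1 - decay (INR (S (S K))).
Proof.
  induction K as [|K IH]; [now rewrite sum_O|].
  rewrite sum_n_SnR, IH. unfold decay_term. eqR. ring.
Qed.

Lemma INR_SS_ge2 k : 2 <= INR (S (S k)).
Proof. rewrite !S_INR. pose proof (pos_INR k). lra. Qed.

Lemma decay_term_ge k :
  exp (- (/ 4 * ln (INR (S (S k))))) / INR (S (S k)) <= decay_term k.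
Proof.
  unfold decay_term. pose proof (INR_SS_ge2 k) as H.
  replace (INR (S k)) with (INR (S (S k)) - 1) by (rewrite (S_INR (S k)); ring).
  apply decay_decrement. lra.
Qed.

Lemma decay_term_ge0 k : 0 <= decay_term k.
Proof.
  eapply Rle_trans; [|apply decay_term_ge]. pose proof (INR_SS_ge2 k).
  apply Rmult_le_pos; [left; apply exp_pos | left; apply Rinv_0_lt_compat; lra].
Qed.

Lemma decay_term_series : is_series decay_term (decay 1).
Proof.
  change (is_lim_seq (sum_n decay_term) (decay 1)).
  apply (is_lim_seq_ext (fun K => decay 1 - decay (INR (S (S K))))).
  - intros K. now rewrite sum_decay_term.
  - replace (Finite (decay 1)) with (Finite (decay 1 - 0)) by (f_equal; ring).
    apply is_lim_seq_minus'; [apply is_lim_seq_const|].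
    apply (is_lim_seq_incr_1 (fun n => decay (INR (S n)))), decay_lim.
Qed.

Lemma analytic_bound_sub (z0 : C) (r : R) :
  0 < r -> analytic_bound (fun z => z - z0)%C z0 r r.
Proof.
  intros Hr.
  apply (analytic_bound_ext z0 r (fun z => (z - z0) * 1)%C); [intros; ring|].
  apply (analytic_bound_le z0 r _ (r * Cmod 1)); [|rewrite Cmod_1; lra].
  apply analytic_bound_shift; [exact Hr | apply analytic_bound_const].
Qed.

(** With [w = ln ((n-1)/n)] the increment is [n^(-s) ((1 + n w)(1 - s) + n (exp (w (1-s)) - 1 - w
    (1-s)))]. Both summands in the bracket are [O(1/n)], the first because [w] is close to [-1/n].
    The factor [exp (2 rho / n)] keeps its dependence on [n]: [rho] grows with the height of [s0],
    and for large [n] this growth becomes arbitrarily slow. *)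
Lemma zeta_term_bound (s0 : C) (k : nat) : / 2 <= Re s0 ->
  let rho := Cmod (1 - s0)%C + / 4 in
  analytic_bound (zeta_term k) s0 (/ 4)
    (decay_term k * (rho * (2 + 4 * rho * exp (2 * rho / INR (S (S k)))))).
Proof.
  intros Hs0 rho.
  set (n := INR (S (S k))).
  assert (Hn : 2 <= n) by apply INR_SS_ge2.
  assert (Hn1 : INR (S k) = n - 1) by (unfold n; rewrite (S_INR (S k)); ring).
  set (w := ln (n - 1) - ln n).
  assert (Hw1 : w <= - / n).
  { unfold w. rewrite <- ln_div by lra. eapply Rle_trans; [apply ln_le_sub1|].
    - apply Rdiv_lt_0_compat; lra.
    - right; field; lra. }
  assert (Hw2 : - w <= / (n - 1)).
  { unfold w. replace (- (ln (n - 1) - ln n)) with (ln n - ln (n - 1)) by ring.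
    rewrite <- ln_div by lra. eapply Rle_trans; [apply ln_le_sub1|].
    - apply Rdiv_lt_0_compat; lra.
    - right; field; lra. }
  assert (Hn2 : / (n - 1) <= 2 / n).
  { apply Rmult_le_reg_r with (n * (n - 1)); [nra|].
    replace (/ (n - 1) * (n * (n - 1))) with n by (field; lra).
    replace (2 / n * (n * (n - 1))) with (2 * (n - 1)) by (field; lra). lra. }
  assert (Hin : 0 < / n) by (apply Rinv_0_lt_compat; lra).
  assert (Hwabs : Rabs w <= 2 / n) by (rewrite Rabs_left1; lra).
  assert (HA : Rabs (1 + n * w) <= 2 / n).
  { assert (n * w <= -1).
    { apply (Rmult_le_compat_l n) in Hw1; [|lra]. 
      replace (n * - / n) with (-1) in Hw1 by (field; lra). exact Hw1. }
    rewrite Rabs_left1 by lra.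
    apply (Rmult_le_compat_l n) in Hw2; [|lra].
    replace (n * / (n - 1)) with (1 + / (n - 1)) in Hw2 by (field; lra). lra. }
  assert (Hr : 0 < / 4) by lra.
  assert (Hrho : 0 <= rho) by (unfold rho; pose proof (Cmod_ge_0 (1 - s0)%C); lra).
  pose proof (analytic_bound_sub s0 (/ 4) Hr) as Hsub.
  assert (H1s : analytic_bound (fun z => 1 - z)%C s0 (/ 4) rho).
  { apply (analytic_bound_ext s0 (/ 4) (fun z => (1 - s0) + (- (1)) * (z - s0))%C); [intros; ring|].
    apply (analytic_bound_le s0 (/ 4) _ (Cmod (1 - s0)%C + Cmod (- (1))%C * / 4)).
    - apply analytic_bound_plus; [apply analytic_bound_const | | exact Hr].
      now apply analytic_bound_scal.
    - rewrite Cmod_opp, Cmod_1. unfold rho; lra. }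
  (* On the disc [Re s] may drop by the radius [1/4] below [1/2], which leaves the decay
     [n^(-1/4)]. *)
  assert (Hpow : analytic_bound (Cpowneg n) s0 (/ 4) (exp (- (/ 4 * ln n)))).
  { apply (analytic_bound_ext s0 (/ 4)
      (fun z => Cpowneg n s0 * Cexp (RtoC (- ln n) * (z - s0)))%C).
    - intros h _. unfold Cpowneg. rewrite <- Cexp_plus. f_equal. rewrite RtoC_opp. ring.
    - apply (analytic_bound_le s0 (/ 4) _ (Cmod (Cpowneg n s0) * exp (Cmod (RtoC (- ln n)) * / 4))).
      + apply analytic_bound_scal, analytic_bound_Cexp; [exact Hr|]. now apply analytic_bound_scal.
      + rewrite Cmod_Cpowneg, Cmod_R, Rabs_Ropp.
        assert (0 <= ln n) by (rewrite <- ln_1; apply ln_le; lra).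
        rewrite Rabs_pos_eq by assumption. rewrite <- exp_plus. apply exp_mono. nra. }
  assert (H1sw : analytic_bound (fun z => RtoC w * (1 - z))%C s0 (/ 4) (2 * rho / n)).
  { apply (analytic_bound_le s0 (/ 4) _ (Cmod (RtoC w) * rho)).
    - now apply analytic_bound_scal.
    - rewrite Cmod_R. replace (2 * rho / n) with (2 / n * rho) by (field; lra).
      now apply Rmult_le_compat_r. }
  apply (analytic_bound_ext s0 (/ 4) (fun s => Cpowneg n s *
    (RtoC (1 + n * w) * (1 - s) + RtoC n * (Cexp (RtoC w * (1 - s)) - 1 - RtoC w * (1 - s))))%C).
  { intros h _. set (s := (s0 + h)%C). unfold zeta_term. fold n. rewrite Hn1.
    assert (E1 : Cpowneg n (s - 1) = (RtoC n * Cpowneg n s)%C).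
    { unfold Cpowneg. replace (- (s - 1) * RtoC (ln n))%C with (RtoC (ln n) + - s * RtoC (ln n))%C by ring.
      rewrite Cexp_plus. f_equal. unfold Cexp, RtoC; simpl.
      rewrite cos_0, sin_0, exp_ln by lra. f_equal; ring. }
    assert (E2 : Cpowneg (n - 1) (s - 1) = (RtoC n * Cpowneg n s * Cexp (RtoC w * (1 - s)))%C).
    { rewrite <- E1. unfold Cpowneg. rewrite <- Cexp_plus. f_equal. unfold w. rewrite RtoC_minus. ring. }
    rewrite E1, E2, RtoC_plus, RtoC_mult. ring. }
  apply (analytic_bound_le s0 (/ 4) _ (exp (- (/ 4 * ln n)) *
    (Cmod (RtoC (1 + n * w)) * rho + Cmod (RtoC n) * ((2 * rho / n) ^ 2 * exp (2 * rho / n))))).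
  - apply analytic_bound_mult; [exact Hr | exact Hpow |].
    apply analytic_bound_plus; [| |exact Hr].
    + now apply analytic_bound_scal.
    + now apply analytic_bound_scal, analytic_bound_Cexp_order2.
  - rewrite !Cmod_R. rewrite (Rabs_pos_eq n) by lra.
    pose proof (exp_pos (2 * rho / n)) as He.
    set (e := exp (2 * rho / n)) in *.
    pose proof (decay_term_ge k) as Hd. fold n in Hd.
    set (u := exp (- (/ 4 * ln n))) in *.
    assert (Hu : 0 < u) by apply exp_pos.
    apply Rle_trans with (u / n * (rho * (2 + 4 * rho * e))).
    + replace (u / n * (rho * (2 + 4 * rho * e))) with
        (u * (2 / n * rho + n * ((2 * rho / n) ^ 2 * e))) by (field; lra).
      apply Rmult_le_compat_l; [lra|]. apply Rplus_le_compat_r.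
      now apply Rmult_le_compat_r.
    + apply Rmult_le_compat_r; [|exact Hd].
      apply Rmult_le_pos; [exact Hrho|]. nra.
Qed.

Lemma analytic_bound_radius f (z0 : C) (r r' M : R) :
  0 < r' -> r' <= r -> analytic_bound f z0 r M -> analytic_bound f z0 r' M.
Proof.
  intros Hr' Hr (a & Ha & Hf); exists a; split.
  - intros n. eapply Rle_trans; [|apply (Ha n)].
    rewrite !sum_n_Reals. apply sum_Rle. intros k _.
    apply Rmult_le_compat_l; [apply Cmod_ge_0 | apply pow_incr; lra].
  - intros h Hh. apply Hf; lra.
Qed.

Lemma Cseries_unique (u : nat -> C) (l l' : C) :
  is_Cseries u l -> is_Cseries u l' -> l = l'.
Proof.
  intros H H'.
  exact (filterlim_locally_unique (F := eventually) (V := C_NormedModule) (sum_n u) l l' H H').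
Qed.

Lemma is_Cseries_Im (u : nat -> C) (l : C) :
  is_Cseries u l -> is_series (fun k => Im (u k)) (Im l).
Proof.
  intros H.
  pose proof (is_Cseries_Re _ _ (is_series_scal_l (V := C_NormedModule) (- Ci)%C _ _ H)) as H1.
  change (is_series (fun k => Re (- Ci * u k)%C) (Re (- Ci * l)%C)) in H1.
  rewrite Re_mult_Ci in H1. refine (is_series_ext _ _ _ _ H1).
  intros n. apply Re_mult_Ci.
Qed.

Lemma zeta_term_bound_unif (s0 : C) (k : nat) : / 2 <= Re s0 ->
  let rho := Cmod (1 - s0)%C + / 4 in
  analytic_bound (zeta_term k) s0 (/ 4)
    (decay_term k * (rho * (2 + 4 * rho * exp (2 * rho)))).
Proof.
  intros Hs rho.
  assert (Hrho : 0 <= rho) by (unfold rho; pose proof (Cmod_ge_0 (1 - s0)%C); lra).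
  apply (analytic_bound_le s0 (/ 4) _ _ _ (zeta_term_bound s0 k Hs)). fold rho.
  apply Rmult_le_compat_l; [apply decay_term_ge0|].
  apply Rmult_le_compat_l; [exact Hrho|]. apply Rplus_le_compat_l.
  apply Rmult_le_compat_l; [lra|]. apply exp_mono.
  pose proof (INR_SS_ge2 k).
  apply Rmult_le_reg_r with (INR (S (S k))); [lra|].
  unfold Rdiv; rewrite Rmult_assoc, Rinv_l; nra.
Qed.

Definition zeta_series (s : C) : C :=
  (Series (fun k => Re (zeta_term k s)), Series (fun k => Im (zeta_term k s))).

Lemma zeta_series_correct (s0 h : C) : / 2 <= Re s0 -> Cmod h <= / 4 ->
  is_Cseries (fun k => zeta_term k (s0 + h)%C) (zeta_series (s0 + h)%C).
Proof.
  intros Hs Hh. set (rho := Cmod (1 - s0)%C + / 4).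
  destruct (ex_Cseries_le (fun k => zeta_term k (s0 + h)%C)
    (fun k => decay_term k * (rho * (2 + 4 * rho * exp (2 * rho))))
    (decay 1 * (rho * (2 + 4 * rho * exp (2 * rho))))) as [l Hl].
  - intros k.
    apply (analytic_bound_Cmod s0 (/ 4) ltac:(lra)); [|exact Hh].
    now apply zeta_term_bound_unif.
  - apply (is_series_scal_r _ _ _ decay_term_series).
  - replace (zeta_series (s0 + h)%C) with l; [exact Hl|].
    unfold zeta_series.
    rewrite (is_series_unique _ _ (is_Cseries_Re _ _ Hl)), (is_series_unique _ _ (is_Cseries_Im _ _ Hl)).
    now destruct l.
Qed.

Lemma zeta_series_bound (s0 : C) : / 2 <= Re s0 ->
  exists M, analytic_bound zeta_series s0 (/ 4) M.
Proof.
  intros Hs. set (rho := Cmod (1 - s0)%C + / 4).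
  exists (decay 1 * (rho * (2 + 4 * rho * exp (2 * rho)))).
  apply (analytic_bound_series s0 (/ 4) ltac:(lra) zeta_term zeta_series
    (fun k => decay_term k * (rho * (2 + 4 * rho * exp (2 * rho))))).
  - intros k. now apply zeta_term_bound_unif.
  - apply (is_series_scal_r _ _ _ decay_term_series).
  - intros h Hh. now apply zeta_series_correct.
Qed.

(** To the right of [1] the Dirichlet sums converge to [zeta s] and the correction [N^(1-s)] tends
    to [0]. *)
Lemma zeta_partial_lim (zeta : C -> C) (s : C) : is_riemann_zeta zeta -> 1 < Re s ->
  is_Cseries (fun k => zeta_term k s) ((1 - s) * zeta s + s)%C.
Proof.
  intros [Hz _] Hs.
  apply Cseries_spec. intros eps.
  assert (e2 : 0 < eps / 2) by (destruct eps; simpl; lra).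
  assert (Hc : 0 < Cmod (1 - s)%C + 1) by (pose proof (Cmod_ge_0 (1 - s)%C); lra).
  assert (e3 : 0 < eps / 2 / (Cmod (1 - s)%C + 1)) by (apply Rdiv_lt_0_compat; assumption).
  destruct (proj1 (Cseries_spec _ _) (Hz s Hs) (mkposreal _ e3)) as [N1 HN1].
  pose proof (is_lim_seq_exp_neg_ln (Re s - 1) ltac:(lra)) as Hl.
  apply is_lim_seq_spec in Hl. destruct (Hl (mkposreal _ e2)) as [N2 HN2].
  simpl pos in *.
  exists (N1 + N2)%nat; intros n Hn.
  specialize (HN1 (S n) ltac:(lia)). specialize (HN2 (S n) ltac:(lia)).
  rewrite sum_zeta_term. unfold zeta_partial.
  fold (Cpowneg (INR 1) s) in HN1.
  set (u := sum_n (fun j => Cpowneg (INR (S j)) s) (S n)).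
  change (Cmod (u - zeta s)%C < eps / 2 / (Cmod (1 - s)%C + 1)) in HN1.
  replace ((1 - s) * u - Cpowneg (INR (S (S n))) (s - 1) + s - ((1 - s) * zeta s + s))%C with
    ((1 - s) * (u - zeta s) + - Cpowneg (INR (S (S n))) (s - 1))%C by ring.
  eapply Rle_lt_trans; [apply Cmod_triangle|].
  rewrite Cmod_opp, Cmod_mult, Cmod_Cpowneg.
  rewrite Rminus_0_r, Rabs_pos_eq in HN2 by (left; apply exp_pos).
  replace (- Re (s - 1)%C * ln (INR (S (S n)))) with (- ((Re s - 1) * ln (INR (S (S n)))))
    by (destruct s; unfold Cminus, Cplus, Copp, RtoC, Re; simpl; ring).
  assert (Cmod (1 - s)%C * Cmod (u - zeta s)%C <= eps / 2); [|lra].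
  apply Rle_trans with ((Cmod (1 - s)%C + 1) * Cmod (u - zeta s)%C).
  - apply Rmult_le_compat_r; [apply Cmod_ge_0 | lra].
  - left. apply (Rmult_lt_compat_l _ _ _ Hc) in HN1.
    eapply Rlt_le_trans; [exact HN1|]. right. field. lra.
Qed.

(** The line at height [v <> 0] misses the pole, so the difference [D] of the two sides is analytic
    along it, and [D] vanishes for [Re s > 1]. The real identity theorem, applied to the real and
    imaginary parts of [D], carries this left to [sigma]. *)
Lemma zeta_continuation (zeta : C -> C) (sigma v : R) :
  is_riemann_zeta zeta -> / 2 <= sigma -> v <> 0 ->
  is_Cseries (fun k => zeta_term k (sigma, v)) ((1 - (sigma, v)) * zeta (sigma, v) + (sigma, v))%C.
Proof.
  intros Hzeta Hsigma Hv.
  set (D := fun s => ((1 - s) * zeta s + s + - (1) * zeta_series s)%C).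
  assert (HD : forall t, / 2 <= t -> exists r M, 0 < r /\ analytic_bound D (t, v) r M).
  { intros t Ht.
    assert (Hne : (t, v) <> RtoC 1) by (intros E; apply Hv; now injection E).
    destruct (analytic_at_bound zeta (t, v) (proj2 Hzeta _ Hne)) as (r1 & M1 & Hr1 & Hz).
    destruct (zeta_series_bound (t, v) Ht) as [M2 HW].
    set (r := Rmin r1 (/ 4)).
    assert (Hr : 0 < r) by (apply Rmin_glb_lt; lra).
    apply (analytic_bound_radius _ _ _ r) in Hz; [|exact Hr | apply Rmin_l].
    apply (analytic_bound_radius _ _ _ r) in HW; [|exact Hr | apply Rmin_r].
    pose proof (analytic_bound_sub (t, v) r Hr) as Hsub.
    exists r. eexists; split; [exact Hr|].
    unfold D.
    apply analytic_bound_plus; [|apply analytic_bound_scal; exact HW | exact Hr].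
    apply analytic_bound_plus; [| |exact Hr].
    - apply analytic_bound_mult; [exact Hr | | exact Hz].
      apply (analytic_bound_ext (t, v) r (fun z => (1 - (t, v)) + (- (1)) * (z - (t, v)))%C); [intros; ring|].
      apply analytic_bound_plus; [apply analytic_bound_const | | exact Hr].
      apply analytic_bound_scal; exact Hsub.
    - apply (analytic_bound_ext (t, v) r (fun z => (t, v) + (z - (t, v)))%C); [intros; ring|].
      apply analytic_bound_plus; [apply analytic_bound_const | exact Hsub | exact Hr]. }
  assert (HD1 : forall t, 1 < t -> D (t, v) = RtoC 0).
  { intros t Ht.
    pose proof (zeta_partial_lim zeta (t, v) Hzeta Ht) as H1.
    pose proof (zeta_series_correct (t, v) 0) as H2.
    rewrite Cplus_0_r in H2.
    assert (H3 := Cseries_unique _ _ _ H1 (H2 ltac:(simpl; lra) ltac:(rewrite Cmod_0; lra))).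
    unfold D. rewrite H3. ring. }
  assert (HRe : Re (D (sigma, v)) = 0).
  { apply (real_identity_theorem (fun t => Re (D (t, v))) sigma 1).
    - intros t Ht. destruct (HD t ltac:(lra)) as (r & M & Hr & HM).
      now apply (analytic_bound_real D t v r M).
    - intros t Ht. now rewrite HD1. }
  assert (HIm : Im (D (sigma, v)) = 0).
  { rewrite <- Re_mult_Ci.
    apply (real_identity_theorem (fun t => Re (- Ci * D (t, v))%C) sigma 1).
    - intros t Ht. destruct (HD t ltac:(lra)) as (r & M & Hr & HM).
      apply (analytic_bound_real (fun z => - Ci * D z)%C t v r (Cmod (- Ci)%C * M) Hr).
      apply analytic_bound_scal. exact HM.
    - intros t Ht. rewrite HD1 by exact Ht. now rewrite Cmult_0_r. }
  assert (E : D (sigma, v) = RtoC 0).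
  { destruct (D (sigma, v)) as [x y]; simpl in HRe, HIm. now rewrite HRe, HIm. }
  replace ((1 - (sigma, v)) * zeta (sigma, v) + (sigma, v))%C with (zeta_series (sigma, v)).
  - pose proof (zeta_series_correct (sigma, v) 0) as H2.
    rewrite Cplus_0_r in H2. apply H2; [exact Hsigma | rewrite Cmod_0; lra].
  - unfold D in E. 
    replace (zeta_series (sigma, v)) with
      ((1 - (sigma, v)) * zeta (sigma, v) + (sigma, v) - ((1 - (sigma, v)) * zeta (sigma, v) + (sigma, v) + - (1) * zeta_series (sigma, v)))%C by ring.
    rewrite E. ring.
Qed.

(** The tail of the increment series is majorised by that of [decay_term], which telescopes to
    [decay (N + 1)]. The factor [|1 - s|] is pulled out because it is later divided away from
    [(1 - s) zeta s]. *)
Lemma zeta_partial_error (zeta : C -> C) (v : R) (N : nat) :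
  is_riemann_zeta zeta -> 0 < v -> (0 < N)%nat ->
  let s := (/ 2, v) : C in
  Cmod ((1 - s) * zeta s - zeta_partial N s)%C <=
    Cmod (1 - s)%C * (decay (INR (S N)) * (3 / 2 * (2 + 4 * (1 + v) * exp (2 * (1 + v) / INR (S N))))).
Proof.
  intros Hz Hv HN s. destruct N as [|N]; [lia|].
  set (rho := Cmod (1 - s)%C + / 4).
  assert (Hs : / 2 <= Re s) by (simpl; lra).
  (* This absorbs the extra [1/4] in [rho]: [rho <= 3/2 |1 - s|], the origin of the factor [3/2]. *)
  assert (H1s : / 2 <= Cmod (1 - s)%C).
  { eapply Rle_trans; [|apply re_le_Cmod]. unfold s; simpl. rewrite Rabs_pos_eq; lra. }
  assert (H1s' : Cmod (1 - s)%C <= / 2 + v).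
  { replace (1 - s)%C with (RtoC (/ 2) + - (Ci * RtoC v))%C
      by (unfold s, RtoC, Ci, Cminus, Cplus, Copp, Cmult; simpl; f_equal; field).
    eapply Rle_trans; [apply Cmod_triangle|].
    rewrite Cmod_opp, Cmod_mult, Cmod_Ci, !Cmod_R, !Rabs_pos_eq; lra. }
  assert (Hp : 2 <= INR (S (S N))) by apply INR_SS_ge2.
  assert (Hi : 0 < / INR (S (S N))) by (apply Rinv_0_lt_compat; lra).
  set (X := exp (2 * (1 + v) / INR (S (S N)))).
  assert (HX : 0 < X) by apply exp_pos.
  set (C0 := rho * (2 + 4 * (1 + v) * X)).
  assert (HC0 : 0 <= C0) by (apply Rmult_le_pos; unfold rho; nra).
  replace ((1 - s) * zeta s - zeta_partial (S N) s)%C with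
    ((1 - s) * zeta s + s - sum_n (fun k => zeta_term k s) N)%C
    by (rewrite sum_zeta_term; ring).
  eapply Rle_trans.
  { apply (Cseries_tail_le (fun k => zeta_term k s) _ (fun k => decay_term k * C0) (decay 1 * C0) N).
    - apply zeta_continuation; [exact Hz | simpl; lra | lra].
    - intros k. apply Rmult_le_pos; [apply decay_term_ge0 | exact HC0].
    - intros k Hk. replace s with (s + 0)%C at 1 by ring.
      apply (analytic_bound_Cmod s (/ 4) ltac:(lra)); [|rewrite Cmod_0; lra].
      apply (analytic_bound_le s (/ 4) _ _ _ (zeta_term_bound s k Hs)). fold rho.
      apply Rmult_le_compat_l; [apply decay_term_ge0|].
      apply Rmult_le_compat_l; [unfold rho; lra|]. apply Rplus_le_compat_l.
      assert (Hr : rho <= 1 + v) by (unfold rho; lra).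
      apply Rmult_le_compat; [unfold rho; lra | left; apply exp_pos | lra |].
      apply exp_mono. unfold Rdiv.
      assert (INR (S (S N)) <= INR (S (S k))) by (apply le_INR; lia).
      assert (/ INR (S (S k)) <= / INR (S (S N))) by (apply Rinv_le_contravar; lra).
      apply Rmult_le_compat; [unfold rho; lra | left; apply Rinv_0_lt_compat; lra | lra | assumption].
    - apply (is_series_scal_r _ _ _ decay_term_series). }
  rewrite (sum_n_ext _ (fun k => mult (decay_term k) C0)) by reflexivity.
  rewrite (sum_n_mult_r (K := R_Ring)).
  change (mult (sum_n decay_term N) C0) with (sum_n decay_term N * C0).
  rewrite sum_decay_term.
  replace (decay 1 * C0 - (decay 1 - decay (INR (S (S N)))) * C0) with (decay (INR (S (S N))) * C0) by ring.
  pose proof (decay_ge0 (INR (S (S N)))) as Hd. unfold C0.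
  replace (Cmod (1 - s)%C * (decay (INR (S (S N))) * (3 / 2 * (2 + 4 * (1 + v) * X)))) with
    (decay (INR (S (S N))) * (3 / 2 * Cmod (1 - s)%C * (2 + 4 * (1 + v) * X))) by field.
  apply Rmult_le_compat_l; [exact Hd|].
  apply Rmult_le_compat_r; [nra | unfold rho; lra].
Qed.

(** * Approximation of zeta on the critical line, with arbitrarily slow exponential growth in [v] *)

Lemma x_exp_le (d x : R) : 0 < d -> 0 <= x -> x * exp (d / 2 * x) <= 2 / d * exp (d * x).
Proof.
  intros Hd Hx.
  replace (exp (d * x)) with (exp (d / 2 * x) * exp (d / 2 * x)) by (rewrite <- exp_plus; f_equal; field).
  pose proof (exp_ineq1_le (d / 2 * x)) as H. pose proof (exp_pos (d / 2 * x)) as He.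
  set (X := exp (d / 2 * x)) in *.
  rewrite <- Rmult_assoc. apply Rmult_le_compat_r; [lra|].
  apply Rle_trans with (2 / d * (d / 2 * x)); [right; field; lra|].
  apply Rmult_le_compat_l; [left; apply Rdiv_lt_0_compat; lra | lra].
Qed.

(** Once [N + 1 >= 4/d], the exponential in [v] costs half of the rate [d], and the linear factor
    the other half. The constant is [9 * 2/d], from [3 + 6 (1+v) X <= 9 (1+v) Y] followed by
    [x_exp_le]. *)
Lemma zeta_partial_error_exp (zeta : C -> C) (d v : R) (N : nat) :
  is_riemann_zeta zeta -> 0 < d -> 0 < v -> (0 < N)%nat -> 4 / d <= INR (S N) ->
  let s := (/ 2, v) : C in
  Cmod ((1 - s) * zeta s - zeta_partial N s)%C <=
    Cmod (1 - s)%C * (decay (INR (S N)) * (18 / d * exp d * exp (d * v))).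
Proof.
  intros Hz Hd Hv HN HdN s.
  eapply Rle_trans; [now apply zeta_partial_error|]. fold s.
  apply Rmult_le_compat_l; [apply Cmod_ge_0|].
  apply Rmult_le_compat_l; [apply decay_ge0|].
  assert (Hp : 0 < INR (S N)) by (apply lt_0_INR; lia).
  assert (H1 : exp (2 * (1 + v) / INR (S N)) <= exp (d / 2 * (1 + v))).
  { apply exp_mono. unfold Rdiv.
    apply Rmult_le_reg_r with (INR (S N)); [exact Hp|].
    rewrite Rmult_assoc, Rinv_l, Rmult_1_r by lra.
    apply (Rmult_le_compat_l d) in HdN; [|lra].
    replace (d * (4 / d)) with 4 in HdN by (field; lra). nra. }
  pose proof (x_exp_le d (1 + v) Hd ltac:(lra)) as H2.
  replace (18 / d * exp d * exp (d * v)) with (18 / d * exp (d * (1 + v)))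
    by (rewrite Rmult_assoc, <- exp_plus; do 2 f_equal; ring).
  set (X := exp (2 * (1 + v) / INR (S N))) in *. 
  set (Y := exp (d / 2 * (1 + v))) in *. set (Z := exp (d * (1 + v))) in *.
  assert (HY : 1 <= Y) by (rewrite <- exp_0; apply exp_mono; nra).
  replace (18 / d * Z) with (9 * (2 / d * Z)) by (field; lra).
  nra.
Qed.

(** Minus the imaginary part of [x^(-s)] at [s = 1/2 + i v]. *)
Definition osc (x v : R) : R := exp (- (/ 2 * ln x)) * sin (v * ln x).

(* The second sum is the Riemann sum of mesh [1/P^2] of the integral of [osc x v] in [x]
   over [0, P], which stands in for the pole term. *)
Definition zeta_approx (P : nat) (v : R) : R :=
  - sum_n (fun j => osc (INR (S j)) v) (pred P)
  + sum_n (fun j => / INR P ^ 2 * osc (INR (S j) / INR P ^ 2) v) (pred (P ^ 3)).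

Lemma Im_Cpowneg (x v : R) : Im (Cpowneg x (/ 2, v)) = - osc x v.
Proof.
  unfold Cpowneg, osc, Cexp, Cmult, Copp, RtoC, Re, Im; simpl.
  replace (- / 2 * ln x - - v * 0) with (- (/ 2 * ln x)) by ring.
  replace (- / 2 * 0 + - v * ln x) with (- (v * ln x)) by ring.
  rewrite sin_neg. ring.
Qed.

(** This rescaling turns the second copy of the Dirichlet sum into a Riemann sum of mesh [1/m]. *)
Lemma Cpowneg_div (m x : R) (s : C) : 0 < m -> 0 < x ->
  (Cpowneg m (1 - s) * Cpowneg x s)%C = (RtoC (/ m) * Cpowneg (x / m) s)%C.
Proof.
  intros Hm Hx.
  replace (RtoC (/ m)) with (Cexp (- RtoC (ln m))).
  2:{ unfold Cexp, RtoC, Copp; simpl. rewrite Ropp_0, cos_0, sin_0, exp_Ropp, exp_ln by exact Hm.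
      f_equal; ring. }
  unfold Cpowneg. rewrite <- !Cexp_plus. f_equal.
  rewrite ln_div by assumption. rewrite RtoC_minus. ring.
Qed.

(* The pole terms [P^(1-s)/(1-s)] and [m^(s-1) (P^3)^(1-s)/(1-s)], [m = P^2], cancel. *)
Lemma zeta_approx_split (zeta : C -> C) (P : nat) (v : R) : (0 < P)%nat ->
  let s := (/ 2, v) : C in
  let m := INR P ^ 2 in
  let A := (sum_n (fun j => Cpowneg (INR (S j)) s) (pred P)
     - Cpowneg m (1 - s) * sum_n (fun j => Cpowneg (INR (S j)) s) (pred (P ^ 3)))%C in
  Im A = zeta_approx P v /\
  ((1 - s) * (zeta s - A) =
    ((1 - s) * zeta s - zeta_partial (pred P) s)
    - Cpowneg m (1 - s) * ((1 - s) * zeta s - zeta_partial (pred (P ^ 3)) s)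
    + Cpowneg m (1 - s) * ((1 - s) * zeta s))%C.
Proof.
  intros HP s m A.
  assert (HPR : 0 < INR P) by now apply lt_0_INR.
  assert (Hm : 0 < m) by (apply pow_lt; exact HPR).
  split.
  - unfold A, zeta_approx. fold m.
    rewrite <- sum_n_Cmult_l.
    rewrite (sum_n_ext (fun k => (Cpowneg m (1 - s) * Cpowneg (INR (S k)) s)%C)
      (fun j => RtoC (/ m) * Cpowneg (INR (S j) / m) s)%C).
    2:{ intros j. apply Cpowneg_div; [exact Hm | apply lt_0_INR; lia]. }
    change (Im (?a - ?b)%C) with (Im a - Im b). rewrite !Im_sum_n.
    rewrite (sum_n_ext _ (fun j => mult (-1) (osc (INR (S j)) v))).
    2:{ intros j. unfold s. rewrite Im_Cpowneg. unfold mult; simpl; ring. }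
    rewrite (sum_n_mult_l (K := R_Ring)).
    rewrite (sum_n_ext (fun k => Im (RtoC (/ m) * Cpowneg (INR (S k) / m) s)%C)
      (fun j => mult (-1) (/ m * osc (INR (S j) / m) v))).
    2:{ intros j. pose proof (Im_Cpowneg (INR (S j) / m) v) as E. fold s in E.
        destruct (Cpowneg (INR (S j) / m) s) as [x y]. 
        unfold Cmult, RtoC, Im, mult in *; simpl in *. rewrite E. ring. }
    rewrite (sum_n_mult_l (K := R_Ring)).
    set (X := sum_n (fun j => osc (INR (S j)) v) (pred P)).
    set (Y := sum_n (fun j => / m * osc (INR (S j) / m) v) (pred (P ^ 3))).
    change (-1 * X - -1 * Y = - X + Y). ring.
  - assert (HP3 : S (pred (P ^ 3)) = (P ^ 3)%nat) by (apply Nat.succ_pred; apply Nat.pow_nonzero; lia).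
    assert (HP1 : S (pred P) = P) by (apply Nat.succ_pred; lia).
    assert (E : (Cpowneg m (1 - s) * Cpowneg (INR (P ^ 3)) (s - 1))%C = Cpowneg (INR P) (s - 1)).
    { unfold Cpowneg. rewrite <- Cexp_plus. f_equal. unfold m. rewrite pow_INR.
      rewrite !ln_pow by exact HPR. rewrite !RtoC_mult. simpl INR. rewrite !RtoC_plus. ring. }
    unfold zeta_partial. rewrite HP1, HP3, <- E. unfold A. ring.
Qed.

Lemma decay_le4 (x : R) : 1 <= x -> decay x <= 4.
Proof.
  intros Hx. unfold decay.
  assert (0 <= ln x) by (rewrite <- ln_1; apply ln_le; lra).
  pose proof (exp_mono (- (/ 4 * ln x)) 0 ltac:(lra)) as H1. rewrite exp_0 in H1. lra.
Qed.

(** Each [j^(-s)] has modulus at most [1]. The crude bound serves at one fixed index, to bound zeta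
    itself by a multiple of [exp (d v)]. *)
Lemma zeta_partial_le (N : nat) (v : R) : 0 < v ->
  let s := (/ 2, v) : C in
  Cmod (zeta_partial N s) <= Cmod (1 - s)%C * (3 * INR (S N)).
Proof.
  intros Hv s.
  assert (H1s : / 2 <= Cmod (1 - s)%C).
  { eapply Rle_trans; [|apply re_le_Cmod]. unfold s; simpl. rewrite Rabs_pos_eq; lra. }
  assert (HP : 1 <= INR (S N)) by (rewrite S_INR; pose proof (pos_INR N); lra).
  assert (Hl : forall j, 0 <= ln (INR (S j))).
  { intros j. rewrite <- ln_1. apply ln_le; [lra|]. rewrite S_INR; pose proof (pos_INR j); lra. }
  unfold zeta_partial, Cminus at 1.
  eapply Rle_trans; [apply Cmod_triangle|]. rewrite Cmod_opp, Cmod_mult.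
  assert (Ha : Cmod (sum_n (fun j => Cpowneg (INR (S j)) s) N) <= INR (S N)).
  { clear HP. induction N as [|N IH].
    - rewrite sum_O, Cmod_Cpowneg. change (INR 1) with 1. rewrite ln_1, Rmult_0_r, exp_0. lra.
    - rewrite sum_n_SnC. eapply Rle_trans; [apply Cmod_triangle|].
      rewrite Cmod_Cpowneg. rewrite (S_INR (S N)).
      apply Rplus_le_compat; [exact IH|]. rewrite <- (S_INR (S N)), <- exp_0.
      apply exp_mono. specialize (Hl (S N)). unfold s; simpl Re. lra. }
  assert (Hb : Cmod (Cpowneg (INR (S N)) (s - 1)) <= INR (S N)).
  { rewrite Cmod_Cpowneg. rewrite <- (exp_ln (INR (S N))) at 2 by lra. apply exp_mono.
    specialize (Hl N). unfold s, Cminus, Cplus, Copp, RtoC, Re; simpl fst. lra. }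
  apply Rle_trans with (Cmod (1 - s)%C * INR (S N) + INR (S N)).
  - apply Rplus_le_compat; [|exact Hb]. apply Rmult_le_compat_l; [lra | exact Ha].
  - nra.
Qed.

Lemma is_lim_seq_inv_INR_S : is_lim_seq (fun n => / INR (S n)) 0.
Proof.
  apply (is_lim_seq_ext (fun n => exp (- (1 * ln (INR (S n)))))).
  - intros n. rewrite Rmult_1_l, exp_Ropp, exp_ln; [reflexivity | apply lt_0_INR; lia].
  - apply is_lim_seq_exp_neg_ln. lra.
Qed.

(** By [zeta_approx_split] the error has three parts: the truncation at [P], of order [P^(-1/4)],
    and the truncation at [P^3] and zeta itself, both damped by [|m^(s-1)| = 1/P]. Since [d] is
    arbitrary, the error can be integrated against any exponentially decaying weight. *)
Lemma zeta_approx_error (zeta : C -> C) (d : R) : is_riemann_zeta zeta -> 0 < d ->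
  exists eps : nat -> R, is_lim_seq eps 0 /\ exists n0, forall n v, (n0 <= n)%nat -> 0 < v ->
    Rabs (Im (zeta (/ 2, v)) - zeta_approx (S n) v) <= eps n * exp (d * v).
Proof.
  intros Hz Hd.
  destruct (nfloor_ex (4 / d)) as [q [_ Hq]]; [left; apply Rdiv_lt_0_compat; lra|].
  set (n0 := S q).
  assert (Hn0 : forall n, (n0 <= n)%nat -> 4 / d <= INR (S n)).
  { intros n Hn. apply Rle_trans with (INR (S q)); [rewrite S_INR; lra|].
    apply le_INR. unfold n0 in Hn; lia. }
  set (C1 := 18 / d * exp d).
  assert (HC1 : 0 < C1) by (apply Rmult_lt_0_compat; [apply Rdiv_lt_0_compat; lra | apply exp_pos]).
  (* [B exp (d v)] bounds [|zeta s|] by way of the truncation at the fixed index [n0]: [4 C1] for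
     its error, [3 (n0 + 1)] for the truncation. *)
  set (B := 4 * C1 + 3 * INR (S n0)).
  exists (fun n => C1 * decay (INR (S n)) + (4 * C1 + B) * / INR (S n)); split.
  { replace (Finite 0) with (Finite (C1 * 0 + (4 * C1 + B) * 0)) by (f_equal; ring).
    apply is_lim_seq_plus'.
    - apply (is_lim_seq_scal_l _ C1 0), decay_lim.
    - apply (is_lim_seq_scal_l _ (4 * C1 + B) 0), is_lim_seq_inv_INR_S. }
  exists n0. intros n v Hn Hv.
  set (s := (/ 2, v) : C).
  assert (H1s : / 2 <= Cmod (1 - s)%C).
  { eapply Rle_trans; [|apply re_le_Cmod]. unfold s; simpl. rewrite Rabs_pos_eq; lra. }
  destruct (zeta_approx_split zeta (S n) v ltac:(lia)) as [EI ES]. fold s in EI, ES.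
  set (m := INR (S n) ^ 2) in *.
  set (A := (_ - _)%C) in EI at 1.
  change (sum_n (fun j => Cpowneg (INR (S j)) s) (pred (S n)) -
      Cpowneg m (1 - s) * sum_n (fun j => Cpowneg (INR (S j)) s) (pred (S n ^ 3)))%C with A in ES.
  rewrite <- EI. 
  change (Im (zeta s) - Im A) with (Im (zeta s - A)%C).
  apply Rle_trans with (Cmod (zeta s - A)%C).
  { eapply Rle_trans; [|apply Rmax_Cmod]. apply Rmax_r. }
  apply Rmult_le_reg_l with (Cmod (1 - s)%C); [lra|].
  rewrite <- Cmod_mult, ES.
  set (E := exp (d * v)).
  assert (HE : 1 <= E) by (rewrite <- exp_0; apply exp_mono; nra).
  assert (HPp : 1 <= INR (S n)) by (rewrite S_INR; pose proof (pos_INR n); lra).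
  assert (Hm : Cmod (Cpowneg m (1 - s)) = / INR (S n)).
  { rewrite Cmod_Cpowneg. unfold m. rewrite ln_pow by lra.
    rewrite <- (exp_ln (INR (S n))) at 2 by lra. rewrite <- exp_Ropp. f_equal.
    unfold s; simpl. field. }
  assert (HZ : Cmod ((1 - s) * zeta s)%C <= Cmod (1 - s)%C * (B * E)).
  { replace ((1 - s) * zeta s)%C with
      (((1 - s) * zeta s - zeta_partial n0 s) + zeta_partial n0 s)%C by ring.
    eapply Rle_trans; [apply Cmod_triangle|].
    apply Rle_trans with (Cmod (1 - s)%C * (decay (INR (S n0)) * (C1 * E)) + Cmod (1 - s)%C * (3 * INR (S n0))).
    - apply Rplus_le_compat.
      + apply zeta_partial_error_exp; auto. unfold n0; lia.
      + now apply zeta_partial_le.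
    - rewrite <- Rmult_plus_distr_l. apply Rmult_le_compat_l; [lra|]. unfold B.
      assert (0 <= INR (S n0)) by apply pos_INR.
      pose proof (decay_le4 (INR (S n0)) ltac:(rewrite S_INR; pose proof (pos_INR n0); lra)).
      assert (0 < C1 * E) by nra. nra. }
  assert (H1 : Cmod ((1 - s) * zeta s - zeta_partial (pred (S n)) s)%C <= 
     Cmod (1 - s)%C * (decay (INR (S n)) * (C1 * E))).
  { apply zeta_partial_error_exp; auto. unfold n0 in Hn; simpl; lia. }
  assert (H2 : Cmod ((1 - s) * zeta s - zeta_partial (pred (S n ^ 3)) s)%C <= 
     Cmod (1 - s)%C * (4 * (C1 * E))).
  (* So the second truncation index passes the threshold [4/d] as well. *)
  { assert (Hk : (S n <= pred (S n ^ 3))%nat).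
    { assert (2 <= S n)%nat by (unfold n0 in Hn; lia).
      assert (S n * 4 <= S n ^ 3)%nat by (simpl; nia). lia. }
    eapply Rle_trans.
    { apply (zeta_partial_error_exp zeta d v (pred (S n ^ 3))); auto; [lia|].
      apply Hn0. lia. }
    apply Rmult_le_compat_l; [lra|]. fold C1 E.
    apply Rmult_le_compat_r; [nra|]. apply decay_le4.
    rewrite S_INR; pose proof (pos_INR (pred (S n ^ 3))); lra. }
  unfold Cminus at 1.
  eapply Rle_trans; [apply Cmod_triangle|].
  eapply Rle_trans; [apply Rplus_le_compat_r, Cmod_triangle|].
  rewrite Cmod_opp, !(Cmod_mult (Cpowneg _ _)), Hm.
  assert (Hi : 0 < / INR (S n)) by (apply Rinv_0_lt_compat; lra).
  apply (Rmult_le_compat_l (/ INR (S n))) in H2; [|lra].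
  apply (Rmult_le_compat_l (/ INR (S n))) in HZ; [|lra].
  set (i := / INR (S n)) in *. set (u := Cmod (1 - s)%C) in *.
  replace (u * ((C1 * decay (INR (S n)) + (4 * C1 + B) * i) * E)) with
    (u * (decay (INR (S n)) * (C1 * E)) + i * (u * (4 * (C1 * E))) + i * (u * (B * E))) by ring.
  lra.
Qed.

(** * The sine transform of sinh (phi v) / cosh (pi v) *)

Lemma is_RInt_antiderivative (f F : R -> R) (a b : R) :
  (forall x, is_derive F x (f x)) -> (forall x, continuous f x) ->
  is_RInt f a b (F b - F a).
Proof.
  intros HF Hf. apply (is_RInt_derive F f); intros; auto.
Qed.

Lemma is_RInt_sum_n (u : nat -> R -> R) (l : nat -> R) (a b : R) (n : nat) :
  (forall k, is_RInt (u k) a b (l k)) ->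
  is_RInt (fun t => sum_n (fun k => u k t) n) a b (sum_n l n).
Proof.
  intros H; induction n as [|n IH].
  - rewrite sum_O. apply (is_RInt_ext (u 0%nat)); [|apply H].
    intros x _; now rewrite sum_O.
  - rewrite sum_n_SnR.
    apply (is_RInt_ext (fun t => plus (sum_n (fun k => u k t) n) (u (S n) t))).
    + intros x _; now rewrite sum_n_SnR.
    + apply (is_RInt_plus (V := R_NormedModule)); [exact IH | apply H].
Qed.

(** The exponents in [1/cosh (pi v) = 2 sum (-1)^k exp (- freq k v)]; also the frequencies for which
    [cos (freq k t)] vanishes at [t = 1/2]. *)
Definition freq (k : nat) : R := (2 * INR k + 1) * PI.

Lemma freq_half (k : nat) : cos (freq k / 2) = 0 /\ sin (freq k / 2) = (-1) ^ k.
Proof.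
  unfold freq; induction k as [|k [IHc IHs]].
  - simpl INR. replace ((2 * 0 + 1) * PI / 2) with (PI / 2) by field.
    rewrite cos_PI2, sin_PI2. simpl; lra.
  - rewrite S_INR.
    replace ((2 * (INR k + 1) + 1) * PI / 2) with ((2 * INR k + 1) * PI / 2 + PI) by field.
    rewrite neg_cos, neg_sin, IHc, IHs. simpl; lra.
Qed.

Lemma freq_ge (k : nat) : PI <= freq k.
Proof. unfold freq. pose proof (pos_INR k). pose proof PI_RGT_0. nra. Qed.

Lemma cos_neq_sum (phi a : R) : Rabs phi < PI -> 0 < cos phi + cosh a.
Proof.
  intros Hphi.
  assert (H1 : 1 <= cosh a).
  { unfold cosh. pose proof (exp_ineq1_le (a)); pose proof (exp_ineq1_le (- a)). lra. }
  assert (H2 : cos phi > -1); [|lra].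
  assert (Hc : 0 < cos (phi / 2)).
  { apply Rabs_def2 in Hphi. apply cos_gt_0; lra. }
  replace phi with (2 * (phi / 2)) by field. rewrite cos_2a_cos. nra.
Qed.

Lemma cosh2_sinh2 (x : R) : cosh x ^ 2 = 1 + sinh x ^ 2.
Proof.
  unfold cosh, sinh.
  assert (H : exp x * exp (- x) = 1) by (rewrite <- exp_plus, Rplus_opp_r; apply exp_0).
  nra.
Qed.

Lemma cosh_double_half (a : R) : cosh a = 1 + 2 * sinh (a / 2) ^ 2.
Proof.
  unfold cosh, sinh. 
  replace (exp a) with (exp (a / 2) * exp (a / 2)) by (rewrite <- exp_plus; f_equal; field).
  replace (exp (- a)) with (exp (- (a / 2)) * exp (- (a / 2))) by (rewrite <- exp_plus; f_equal; field).
  assert (H : exp (a / 2) * exp (- (a / 2)) = 1) by (rewrite <- exp_plus, Rplus_opp_r; apply exp_0).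
  nra.
Qed.

Lemma Rabs_sin_le (x : R) : Rabs (sin x) <= Rabs x.
Proof.
  destruct (Rle_lt_dec 0 x) as [Hx|Hx].
  - destruct (Req_dec x 0) as [->|Hx0]; [rewrite sin_0; lra|].
    rewrite (Rabs_pos_eq x) by lra. apply Rabs_le.
    pose proof (sin_lt_x x ltac:(lra)). split; [|lra].
    destruct (Rle_lt_dec x 1) as [H1|H1].
    + pose proof PI2_3_2. pose proof (sin_gt_0 x ltac:(lra) ltac:(lra)). lra.
    + pose proof (SIN_bound x). lra.
  - replace (sin x) with (- sin (- x)) by (rewrite sin_neg; ring).
    rewrite Rabs_Ropp, (Rabs_left x) by exact Hx. apply Rabs_le.
    pose proof (sin_lt_x (- x) ltac:(lra)). split; [|lra].
    destruct (Rle_lt_dec (- x) 1) as [H1|H1].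
    + pose proof PI2_3_2. pose proof (sin_gt_0 (- x) ltac:(lra) ltac:(lra)). lra.
    + pose proof (SIN_bound (- x)). lra.
Qed.

(* For [b = phi + i a] one has [cos (b / 2) = kernel_p - i kernel_q], and [kernel_f]
   is the imaginary part of [cos (b t)] times the conjugate of [cos (b / 2)]. *)
Definition kernel_p (phi a : R) : R := cos (phi / 2) * cosh (a / 2).
Definition kernel_q (phi a : R) : R := sin (phi / 2) * sinh (a / 2).

Definition kernel_f (phi a t : R) : R :=
  kernel_q phi a * (cos (phi * t) * cosh (a * t))
  - kernel_p phi a * (sin (phi * t) * sinh (a * t)).

(** The Laplace transform of [sin (a v) sinh (phi v)] at [freq k]. *)
Definition kernel_coef (phi a : R) (k : nat) : R :=
  / 2 * (a / (a ^ 2 + (freq k - phi) ^ 2) - a / (a ^ 2 + (freq k + phi) ^ 2)).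

(** The Dirichlet kernel of the odd frequencies, [sin (2 (n+1) x) / sin x]. *)
Definition dirichlet (x : R) (n : nat) : R := sum_n (fun k => 2 * cos ((2 * INR k + 1) * x)) n.

Section Kernel.
Variables (phi a : R).
Hypothesis Hphi : Rabs phi < PI.

Local Notation p := (kernel_p phi a).
Local Notation q := (kernel_q phi a).
Local Notation f := (kernel_f phi a).
Local Notation coef := (kernel_coef phi a).

(** Both sides are [|cos (b/2)|^2] for [b = phi + i a]. *)
Lemma pq_sum : p ^ 2 + q ^ 2 = (cos phi + cosh a) / 2.
Proof.
  unfold kernel_p, kernel_q. rewrite (cosh_double_half a).
  replace phi with (2 * (phi / 2)) at 3 by field. rewrite cos_2a_cos.
  pose proof (sin2_cos2 (phi / 2)) as H. unfold Rsqr in H.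
  pose proof (cosh2_sinh2 (a / 2)) as H'.
  set (c := cos (phi / 2)) in *. set (s := sin (phi / 2)) in *.
  set (ch := cosh (a / 2)) in *. set (sh := sinh (a / 2)) in *.
  assert (s ^ 2 = 1 - c ^ 2) by (simpl; lra).
  rewrite !Rpow_mult_distr, H', H0. simpl; field.
Qed.

Lemma den_pos (k : nat) : 0 < a ^ 2 + (freq k - phi) ^ 2 /\ 0 < a ^ 2 + (freq k + phi) ^ 2.
Proof.
  pose proof (freq_ge k) as H. apply Rabs_def2 in Hphi.
  assert (0 <= a ^ 2) by apply pow2_ge_0. split; nra.
Qed.

(** Product-to-sum formulas reduce this to integrals of [cosh (a t) cos (m t)] and
    [sinh (a t) sin (m t)] with [m = c - phi] or [c + phi]. The primitive vanishes at [0], and at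
    [1/2] only terms with [sin (c/2) = (-1)^k] survive; [f] is the combination for which they
    assemble to [|cos (b/2)|^2] times the coefficient. *)
Lemma fourier_coef (k : nat) :
  is_RInt (fun t => f t * cos (freq k * t)) 0 (/ 2) ((-1) ^ k * ((p ^ 2 + q ^ 2) * coef k)).
Proof.
  destruct (den_pos k) as [Hd1 Hd2].
  set (c := freq k) in *.
  set (A := fun m t => (a * sinh (a * t) * cos (m * t) + m * cosh (a * t) * sin (m * t)) / (a ^ 2 + m ^ 2)).
  set (B := fun m t => (a * cosh (a * t) * sin (m * t) - m * sinh (a * t) * cos (m * t)) / (a ^ 2 + m ^ 2)).
  set (F := fun t => q / 2 * (A (c - phi) t + A (c + phi) t) - p / 2 * (B (c + phi) t - B (c - phi) t)).
  replace ((-1) ^ k * ((p ^ 2 + q ^ 2) * coef k)) with (F (/ 2) - F 0).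
  - apply is_RInt_antiderivative.
    + intros t. unfold F, A, B. unfold cosh, sinh.
      auto_derive; [repeat split; lra|].
      unfold kernel_f, cosh, sinh. 
      replace ((c - phi) * t) with (c * t - phi * t) by ring.
      replace ((c + phi) * t) with (c * t + phi * t) by ring.
      rewrite cos_plus, cos_minus, sin_plus, sin_minus.
      field. split; lra.
    + intros t. apply (ex_derive_continuous (V := R_NormedModule)). unfold kernel_f, cosh, sinh. auto_derive. trivial.
  - destruct (freq_half k) as [Hc Hs]. fold c in Hc, Hs.
    unfold F, A, B. rewrite !Rmult_0_r, sinh_0, sin_0, cos_0.
    replace ((c - phi) * / 2) with (c / 2 - phi / 2) by field.
    replace ((c + phi) * / 2) with (c / 2 + phi / 2) by field.
    rewrite cos_plus, cos_minus, sin_plus, sin_minus, Hc, Hs.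
    change (a * / 2) with (a / 2).
    unfold kernel_coef; fold c. unfold kernel_p, kernel_q. field. split; lra.
Qed.

Lemma exp_abs_bounds (y : R) : 1 <= cosh y <= exp (Rabs y) /\ Rabs (sinh y) <= Rabs y * exp (Rabs y).
Proof.
  assert (Hpos : forall x, 0 <= x -> 1 <= cosh x <= exp x /\ 0 <= sinh x <= x * exp x).
  { intros x Hx. unfold cosh, sinh.
    pose proof (exp_ineq1_le x). pose proof (exp_ineq1_le (- x)).
    pose proof (exp_mono (- x) x ltac:(lra)).
    pose proof (exp_ineq1_le (- (2 * x))) as H2.
    apply (Rmult_le_compat_l (exp x) _ _ (Rlt_le _ _ (exp_pos x))) in H2.
    rewrite <- exp_plus in H2. replace (x + - (2 * x)) with (- x) in H2 by ring. lra. }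
  destruct (Rle_lt_dec 0 y) as [Hy|Hy].
  - destruct (Hpos y Hy) as [H1 H2]. rewrite (Rabs_pos_eq y) by exact Hy.
    rewrite Rabs_pos_eq; tauto.
  - destruct (Hpos (- y) ltac:(lra)) as [H1 H2].
    rewrite (Rabs_left y) by exact Hy.
    unfold cosh, sinh in *. rewrite Ropp_involutive in *.
    rewrite Rabs_left1; lra.
Qed.

(** [f 0 = q], and [f] is even in [t]: [1 - cos], [cosh - 1] and the product of [sin] and [sinh] are
    each of order [t^2]. *)
Lemma f_quadratic : exists M, 0 <= M /\ forall t, 0 <= t <= / 2 -> Rabs (f t - q) <= M * t ^ 2.
Proof.
  set (H := exp (Rabs a)).
  assert (HH : 0 < H) by apply exp_pos.
  exists (Rabs q * (phi ^ 2 / 2 * H + a ^ 2 * H ^ 2 / 2) + Rabs p * (Rabs phi * (Rabs a * H))).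
  assert (H0 : 0 <= phi ^ 2) by apply pow2_ge_0. assert (H1 : 0 <= a ^ 2) by apply pow2_ge_0.
  assert (H2 : 0 <= H ^ 2) by apply pow2_ge_0.
  pose proof (Rabs_pos q); pose proof (Rabs_pos p); pose proof (Rabs_pos phi); pose proof (Rabs_pos a).
  split.
  { apply Rplus_le_le_0_compat; apply Rmult_le_pos; auto; [nra|].
    apply Rmult_le_pos; nra. }
  intros t Ht.
  assert (Hexp : forall y, Rabs y <= Rabs a -> 1 <= cosh y <= H /\ Rabs (sinh y) <= Rabs y * H).
  { intros y Hy. destruct (exp_abs_bounds y) as [[E0 E1] E2].
    assert (exp (Rabs y) <= H) by now apply exp_mono.
    split; [lra|]. eapply Rle_trans; [exact E2|]. apply Rmult_le_compat_l; [apply Rabs_pos | lra]. }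
  destruct (Hexp (a * t)) as [Ec Es].
  { rewrite Rabs_mult, (Rabs_pos_eq t) by lra. nra. }
  destruct (Hexp (a * t / 2)) as [_ Es2].
  { unfold Rdiv. rewrite !Rabs_mult, (Rabs_pos_eq t), (Rabs_pos_eq (/ 2)) by lra. nra. }
  assert (Ech : cosh (a * t) - 1 <= a ^ 2 * H ^ 2 / 2 * t ^ 2).
  { rewrite cosh_double_half.
    assert (sinh (a * t / 2) ^ 2 <= (a * t / 2 * H) ^ 2).
    { rewrite <- (pow2_abs (sinh _)), <- (pow2_abs (a * t / 2 * H)).
      apply pow_incr; split; [apply Rabs_pos|]. rewrite Rabs_mult, (Rabs_pos_eq H) by lra. exact Es2. }
    lra. }
  assert (Ecos : 0 <= 1 - cos (phi * t) <= phi ^ 2 / 2 * t ^ 2).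
  { replace (phi * t) with (2 * (phi * t / 2)) by field. rewrite cos_2a_sin.
    assert (sin (phi * t / 2) ^ 2 <= (phi * t / 2) ^ 2).
    { rewrite <- (pow2_abs (sin _)), <- (pow2_abs (phi * t / 2)).
      apply pow_incr; split; [apply Rabs_pos | apply Rabs_sin_le]. }
    pose proof (pow2_ge_0 (sin (phi * t / 2))). lra. }
  assert (Esin : Rabs (sin (phi * t) * sinh (a * t)) <= Rabs phi * (Rabs a * H) * t ^ 2).
  { rewrite Rabs_mult. pose proof (Rabs_sin_le (phi * t)) as E.
    rewrite Rabs_mult, (Rabs_pos_eq t) in E by lra.
    rewrite (Rabs_mult a t), (Rabs_pos_eq t) in Es by lra.
    replace (Rabs phi * (Rabs a * H) * t ^ 2) with ((Rabs phi * t) * (Rabs a * t * H)) by ring.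
    apply Rmult_le_compat; auto using Rabs_pos. }
  assert (Ecc : Rabs (cos (phi * t) * cosh (a * t) - 1) <= (phi ^ 2 / 2 * H + a ^ 2 * H ^ 2 / 2) * t ^ 2).
  { replace (cos (phi * t) * cosh (a * t) - 1) with
      (- ((1 - cos (phi * t)) * cosh (a * t)) + (cosh (a * t) - 1)) by ring.
    eapply Rle_trans; [apply Rabs_triang|]. rewrite Rabs_Ropp, !Rabs_pos_eq; try nra. }
  unfold kernel_f.
  replace (q * (cos (phi * t) * cosh (a * t)) - p * (sin (phi * t) * sinh (a * t)) - q) with
    (q * (cos (phi * t) * cosh (a * t) - 1) + - (p * (sin (phi * t) * sinh (a * t)))) by ring.
  eapply Rle_trans; [apply Rabs_triang|]. rewrite Rabs_Ropp, !(Rabs_mult q), !(Rabs_mult p).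
  apply (Rmult_le_compat_l _ _ _ H3) in Ecc. apply (Rmult_le_compat_l _ _ _ H4) in Esin. lra.
Qed.

Lemma dirichlet_sin (x : R) (n : nat) : sin x * dirichlet x n = sin (2 * (INR n + 1) * x).
Proof.
  unfold dirichlet. induction n as [|n IH].
  - rewrite sum_O. simpl INR.
    replace (2 * (0 + 1) * x) with (2 * x) by ring. rewrite sin_2a.
    replace ((2 * 0 + 1) * x) with x by ring. ring.
  - rewrite sum_n_SnR, Rmult_plus_distr_l, IH, S_INR.
    replace (2 * (INR n + 1) * x) with ((2 * (INR n + 1) + 1) * x - x) by ring.
    replace (2 * (INR n + 1 + 1) * x) with ((2 * (INR n + 1) + 1) * x + x) by ring.
    rewrite sin_plus, sin_minus. ring.
Qed.

(** The Fejer kernel of the odd frequencies: after the factor [sin^2] the summed Dirichlet kernels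
    are bounded by [1] for every [N]. *)
Lemma fejer_sin2 (x : R) (N : nat) :
  sin x ^ 2 * sum_n (dirichlet x) N = sin ((INR N + 1) * x) * sin ((INR N + 2) * x).
Proof.
  induction N as [|N IH].
  - rewrite sum_O. replace (sin x ^ 2 * dirichlet x 0) with (sin x * (sin x * dirichlet x 0)) by ring.
    rewrite dirichlet_sin. simpl INR.
    replace (2 * (0 + 1) * x) with (2 * x) by ring.
    replace ((0 + 1) * x) with x by ring. replace ((0 + 2) * x) with (2 * x) by ring. ring.
  - rewrite sum_n_SnR, Rmult_plus_distr_l, IH.
    replace (sin x ^ 2 * dirichlet x (S N)) with (sin x * (sin x * dirichlet x (S N))) by ring.
    rewrite dirichlet_sin, S_INR.
    set (y := (INR N + 2) * x).
    replace ((INR N + 1) * x) with (y - x) by (unfold y; ring).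
    replace ((INR N + 1 + 1) * x) with y by (unfold y; ring).
    replace ((INR N + 1 + 2) * x) with (y + x) by (unfold y; ring).
    replace (2 * (INR N + 1 + 1) * x) with (2 * y) by (unfold y; ring).
    rewrite sin_2a, sin_plus, sin_minus. ring.
Qed.

(** The cubic bound [sin x >= x (1 - x^2/6)] at [x = pi t <= 2] gives [sin x >= x/3 >= t]. *)
Lemma sin_PI_ge (t : R) : 0 <= t <= / 2 -> t <= sin (PI * t).
Proof.
  intros Ht. pose proof PI2_3_2 as H3. pose proof PI_4 as H4.
  assert (H0 : 0 <= PI * t) by nra.
  assert (Hle : PI * t <= 2) by nra.
  destruct (sin_bound (PI * t) 0 H0 ltac:(nra)) as [H _].
  unfold sin_approx, sin_term in H; simpl in H.
  set (x := PI * t) in *.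
  assert (Hx : x * (1 - x ^ 2 / 6) <= sin x) by lra.
  assert (x * / 3 <= x * (1 - x ^ 2 / 6)) by (apply Rmult_le_compat_l; nra).
  assert (3 * t <= x) by (unfold x; nra). lra.
Qed.

(* [f - f 0] vanishes to second order at [0], which cancels the factor [sin^2] of
   [fejer_sin2]: the Cesaro means converge without any Riemann-Lebesgue argument. *)
Lemma fejer_error : exists M, forall N,
  Rabs ((p ^ 2 + q ^ 2) * sum_n (fun n => sum_n (fun k => 2 * ((-1) ^ k * coef k)) n) N
    - q * sum_n (fun n => sum_n (fun k => 2 * ((-1) ^ k / freq k)) n) N) <= M.
Proof.
  destruct f_quadratic as (M & HM & Hf).
  exists ((/ 2 - 0) * M). intros N.
  assert (H1 : is_RInt (fun t => f t * sum_n (dirichlet (PI * t)) N) 0 (/ 2)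
    ((p ^ 2 + q ^ 2) * sum_n (fun n => sum_n (fun k => 2 * ((-1) ^ k * coef k)) n) N)).
  { rewrite <- sum_n_Rmult_l.
    apply (is_RInt_ext (fun t => sum_n (fun n => sum_n (fun k => 2 * (f t * cos (freq k * t))) n) N)).
    - intros t _. rewrite <- sum_n_Rmult_l. apply sum_n_ext; intros n.
      unfold dirichlet. rewrite <- sum_n_Rmult_l. apply sum_n_ext; intros k.
      unfold freq. replace ((2 * INR k + 1) * PI * t) with ((2 * INR k + 1) * (PI * t)) by ring.
      eqR. ring.
    - apply is_RInt_sum_n; intros n. rewrite <- sum_n_Rmult_l.
      apply is_RInt_sum_n; intros k.
      replace ((p ^ 2 + q ^ 2) * (2 * ((-1) ^ k * coef k))) with (2 * ((-1) ^ k * ((p ^ 2 + q ^ 2) * coef k))) by ring.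
      apply (is_RInt_scal (V := R_NormedModule) _ _ _ 2), fourier_coef. }
  (* The constant [q] has coefficients [q (-1)^k / freq k]; subtracting its means leaves the kernel
     sums integrated against [f - q]. *)
  assert (H2 : is_RInt (fun t => q * sum_n (dirichlet (PI * t)) N) 0 (/ 2)
    (q * sum_n (fun n => sum_n (fun k => 2 * ((-1) ^ k / freq k)) n) N)).
  { apply (is_RInt_scal (V := R_NormedModule) _ _ _ q).
    apply is_RInt_sum_n; intros n. unfold dirichlet. apply is_RInt_sum_n; intros k.
    apply (is_RInt_scal (V := R_NormedModule) _ _ _ 2).
    pose proof (freq_ge k) as Hk. pose proof PI_RGT_0 as HPI.
    replace ((-1) ^ k / freq k) with (sin (freq k * / 2) / freq k - sin (freq k * 0) / freq k).
    - apply (is_RInt_antiderivative _ (fun t => sin (freq k * t) / freq k)).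
      + intros t. auto_derive; [trivial|]. unfold freq.
        replace ((2 * INR k + 1) * (PI * t)) with ((2 * INR k + 1) * PI * t) by ring.
        pose proof (pos_INR k). field. lra.
      + intros t. apply (ex_derive_continuous (V := R_NormedModule)). auto_derive. trivial.
    - change (freq k * / 2) with (freq k / 2).
      rewrite (proj2 (freq_half k)), Rmult_0_r, sin_0. field. lra. }
  pose proof (is_RInt_minus (V := R_NormedModule) _ _ _ _ _ _ H1 H2) as H3.
  refine (norm_RInt_le_const (V := R_NormedModule) _ 0 (/ 2) _ M ltac:(lra) _ H3).
  intros t Ht.
  change (Rabs (f t * sum_n (dirichlet (PI * t)) N - q * sum_n (dirichlet (PI * t)) N) <= M).
  rewrite <- Rmult_minus_distr_r, Rabs_mult.
  specialize (Hf t Ht).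
  destruct (Req_dec t 0) as [->|Ht0].
  { rewrite pow_i, Rmult_0_r in Hf by lia.
    assert (Rabs (f 0 - q) = 0) as -> by (pose proof (Rabs_pos (f 0 - q)); lra). lra. }
  pose proof (sin_PI_ge t Ht) as Hs.
  set (Q := sum_n (dirichlet (PI * t)) N).
  assert (HQ : t ^ 2 * Rabs Q <= 1).
  { apply Rle_trans with (sin (PI * t) ^ 2 * Rabs Q).
    - apply Rmult_le_compat_r; [apply Rabs_pos|]. apply pow_incr; lra.
    - rewrite <- (Rabs_pos_eq (sin (PI * t) ^ 2)) by apply pow2_ge_0.
      rewrite <- Rabs_mult. unfold Q. rewrite fejer_sin2, Rabs_mult.
      rewrite <- (Rmult_1_r 1). apply Rmult_le_compat; try apply Rabs_pos;
      apply Rabs_le; apply SIN_bound. }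
  apply Rle_trans with (M * t ^ 2 * Rabs Q).
  - apply Rmult_le_compat_r; [apply Rabs_pos | exact Hf].
  - rewrite Rmult_assoc. nra.
Qed.

Lemma leibniz_series : is_lim_seq (sum_n (fun k => 2 * ((-1) ^ k / freq k))) (/ 2).
Proof.
  assert (H : is_lim_seq (sum_n (tg_alt PI_tg)) (PI / 4)).
  { apply (is_lim_seq_ext (sum_f_R0 (tg_alt PI_tg))); [intros n; now rewrite sum_n_Reals|].
    apply is_lim_seq_Reals. rewrite <- Alt_PI_eq. unfold Alt_PI.
    destruct exist_PI as [l Hl]. now replace (4 * l / 4) with l by field. }
  pose proof PI_RGT_0 as HPI.
  apply (is_lim_seq_scal_l _ (2 / PI)) in H. simpl in H.
  replace (/ 2) with (2 / PI * (PI / 4)) by (field; lra).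
  refine (is_lim_seq_ext _ _ _ _ H).
  intros n. rewrite <- sum_n_Rmult_l. apply sum_n_ext; intros k.
  unfold tg_alt, PI_tg, freq. rewrite plus_INR, mult_INR. simpl INR.
  pose proof (pos_INR k). eqR. field. lra.
Qed.

Lemma is_lim_seq_cesaro (u : nat -> R) (l : R) :
  is_lim_seq u l -> is_lim_seq (fun n => sum_n u n / INR (S n)) l.
Proof.
  intros H. apply is_lim_seq_Reals, Cesaro_1, is_lim_seq_Reals in H.
  apply (is_lim_seq_incr_1 _ l) in H.
  refine (is_lim_seq_ext _ _ _ _ H). intros n. now rewrite sum_n_Reals.
Qed.

(** The bounded difference in [fejer_error] disappears after division by [N + 1]. The means of the
    Leibniz sums tend to [1/2], which leaves [q / (2 (p^2 + q^2))]. *)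
Lemma cesaro_coef :
  is_lim_seq (fun N => sum_n (fun n => sum_n (fun k => 2 * ((-1) ^ k * coef k)) n) N / INR (S N))
    (q / (cos phi + cosh a)).
Proof.
  pose proof (cos_neq_sum phi a Hphi) as Hpos.
  destruct fejer_error as [M HM].
  set (X := fun N => sum_n (fun n => sum_n (fun k => 2 * ((-1) ^ k * coef k)) n) N) in *.
  set (Y := fun N => sum_n (fun n => sum_n (fun k => 2 * ((-1) ^ k / freq k)) n) N) in *.
  rewrite pq_sum in HM.
  set (s := (cos phi + cosh a) / 2) in *.
  assert (HY : is_lim_seq (fun N => Y N / INR (S N)) (/ 2)).
  { apply (is_lim_seq_cesaro _ _ leibniz_series). }
  assert (HD : is_lim_seq (fun N => (s * X N - q * Y N) / INR (S N)) 0).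
  { apply (is_lim_seq_le_le (fun N => - M * / INR (S N)) _ (fun N => M * / INR (S N))).
    - intros N. specialize (HM N). change (Rabs (s * X N - q * Y N) <= M) in HM.
      apply Rabs_le_between in HM.
      assert (0 < / INR (S N)) by (apply Rinv_0_lt_compat, lt_0_INR; lia).
      unfold Rdiv. split; apply Rmult_le_compat_r; lra.
    - replace (Finite 0) with (Rbar_mult (- M) 0) by (simpl; f_equal; ring).
      apply is_lim_seq_scal_l, is_lim_seq_inv_INR_S.
    - replace (Finite 0) with (Rbar_mult M 0) by (simpl; f_equal; ring).
      apply is_lim_seq_scal_l, is_lim_seq_inv_INR_S. }
  replace (q / (cos phi + cosh a)) with (/ s * (0 + q * / 2)) by (unfold s; field; lra).
  apply (is_lim_seq_ext (fun N => / s * ((s * X N - q * Y N) / INR (S N) + q * (Y N / INR (S N))))).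
  - intros N. assert (0 < INR (S N)) by (apply lt_0_INR; lia). 
    change (/ s * ((s * X N - q * Y N) / INR (S N) + q * (Y N / INR (S N))) = X N / INR (S N)).
    assert (0 < s) by (unfold s; lra). field. lra.
  - apply (is_lim_seq_scal_l _ (/ s) (0 + q * / 2)).
    apply is_lim_seq_plus'; [exact HD|]. apply (is_lim_seq_scal_l _ q (/ 2)), HY.
Qed.
End Kernel.

(** * Laplace integrals and the integral of the kernel over the half-line *)

Notation lim_infty f l := (filterlim f (Rbar_locally p_infty) (locally l)).

Lemma filterlim_sum_n {T : Type} (F : (T -> Prop) -> Prop) (FF : Filter F)
    (u : nat -> T -> R) (l : nat -> R) (n : nat) :
  (forall k, filterlim (u k) F (locally (l k))) ->
  filterlim (fun x => sum_n (fun k => u k x) n) F (locally (sum_n l n)).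
Proof.
  intros H; induction n as [|n IH].
  - rewrite sum_O. apply (filterlim_ext (u 0%nat)); [|apply H].
    intros x. now rewrite sum_O.
  - rewrite sum_n_SnR.
    apply (filterlim_ext (fun x => plus (sum_n (fun k => u k x) n) (u (S n) x))).
    + intros x. now rewrite sum_n_SnR.
    + exact (filterlim_comp_2 _ _ _ IH (H (S n)) (filterlim_plus (V := R_NormedModule) _ _)).
Qed.

Lemma filterlim_Rmult_l {T : Type} (F : (T -> Prop) -> Prop) (c : R) (u : T -> R) (l : R) :
  filterlim u F (locally l) -> filterlim (fun x => c * u x) F (locally (c * l)).
Proof.
  intros H. exact (filterlim_comp _ _ _ _ _ _ _ _ H (filterlim_scal_r (V := R_NormedModule) c l)).
Qed.

Lemma lim_infty_exp_neg (m : R) : 0 < m -> lim_infty (fun V => exp (- (m * V))) 0.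
Proof.
  intros Hm.
  apply filterlim_locally. intros [e He]; simpl.
  exists (/ (m * e)). intros V HV.
  change (Rabs (exp (- (m * V)) - 0) < e).
  rewrite Rminus_0_r, Rabs_pos_eq by (left; apply exp_pos).
  rewrite exp_Ropp.
  assert (Hme : 0 < m * e) by nra.
  assert (H1 : / e < exp (m * V)).
  { apply Rlt_le_trans with (1 + m * V); [|apply exp_ineq1_le].
    apply (Rmult_lt_compat_l m _ _ Hm) in HV.
    replace (m * / (m * e)) with (/ e) in HV by (field; lra). lra. }
  rewrite <- (Rinv_inv e). apply Rinv_0_lt_contravar; [|exact H1].
  now apply Rinv_0_lt_compat.
Qed.

Definition laplace_sin (a m V : R) : R :=
  (a - exp (- (m * V)) * (m * sin (V * a) + a * cos (V * a))) / (a ^ 2 + m ^ 2).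

Lemma is_RInt_laplace_sin (a m V : R) : 0 < m ->
  is_RInt (fun v => sin (v * a) * exp (- (m * v))) 0 V (laplace_sin a m V).
Proof.
  intros Hm.
  assert (Hd : 0 < a ^ 2 + m ^ 2) by (pose proof (pow2_ge_0 a); nra).
  replace (laplace_sin a m V) with (laplace_sin a m V - laplace_sin a m 0).
  - apply is_RInt_antiderivative.
    + intros v. unfold laplace_sin. auto_derive; [lra|]. field. lra.
    + intros v. apply (ex_derive_continuous (V := R_NormedModule)). auto_derive. trivial.
  - unfold laplace_sin at 2. rewrite Rmult_0_r, Rmult_0_l, Ropp_0, exp_0, sin_0, cos_0. field. lra.
Qed.

Lemma laplace_sin_lim (a m : R) : 0 < m -> lim_infty (laplace_sin a m) (a / (a ^ 2 + m ^ 2)).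
Proof.
  intros Hm.
  assert (Hd : 0 < a ^ 2 + m ^ 2) by (pose proof (pow2_ge_0 a); nra).
  assert (Hi : 0 < / (a ^ 2 + m ^ 2)) by now apply Rinv_0_lt_compat.
  set (K := (m + Rabs a) * / (a ^ 2 + m ^ 2)).
  assert (HK : 0 < K).
  { apply Rmult_lt_0_compat; [|exact Hi]. pose proof (Rabs_pos a). lra. }
  pose proof (filterlim_Rmult_l _ K _ _ (lim_infty_exp_neg m Hm)) as H.
  rewrite Rmult_0_r in H.
  apply filterlim_locally. intros e.
  generalize (proj1 (filterlim_locally _ _) H e). apply filter_imp.
  intros V HV. change (Rabs (K * exp (- (m * V)) - 0) < e) in HV.
  change (Rabs (laplace_sin a m V - a / (a ^ 2 + m ^ 2)) < e).
  eapply Rle_lt_trans; [|exact HV].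
  pose proof (exp_pos (- (m * V))) as He.
  rewrite Rminus_0_r, (Rabs_pos_eq (K * _)) by (apply Rmult_le_pos; lra).
  unfold laplace_sin.
  replace (_ - a / (a ^ 2 + m ^ 2)) with
    (- ((m * sin (V * a) + a * cos (V * a)) * (exp (- (m * V)) * / (a ^ 2 + m ^ 2)))) by (field; lra).
  rewrite Rabs_Ropp, Rabs_mult, (Rabs_pos_eq (exp _ * _)) by (apply Rmult_le_pos; lra).
  unfold K. rewrite Rmult_assoc, (Rmult_comm (/ _)).
  apply Rmult_le_compat_r; [apply Rmult_le_pos; lra|].
  eapply Rle_trans; [apply Rabs_triang|]. rewrite !Rabs_mult, (Rabs_pos_eq m) by lra.
  pose proof (Rabs_pos a).
  assert (Rabs (sin (V * a)) <= 1) by (apply Rabs_le, SIN_bound).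
  assert (Rabs (cos (V * a)) <= 1) by (apply Rabs_le, COS_bound).
  nra.
Qed.

Lemma sinh_exp_split (phi c v : R) :
  sinh (phi * v) * exp (- (c * v)) = / 2 * (exp (- ((c - phi) * v)) - exp (- ((c + phi) * v))).
Proof.
  unfold sinh.
  replace (- ((c - phi) * v)) with (phi * v + - (c * v)) by ring.
  replace (- ((c + phi) * v)) with (- (phi * v) + - (c * v)) by ring.
  rewrite !exp_plus. field.
Qed.

Definition kernel (phi a v : R) : R := sin (v * a) * (sinh (phi * v) / cosh (PI * v)).

Lemma cosh_gt0 (x : R) : 0 < cosh x.
Proof. unfold cosh. pose proof (exp_pos x). pose proof (exp_pos (- x)). lra. Qed.

Lemma weight_le (phi v : R) : 0 <= v ->
  Rabs (sinh (phi * v) / cosh (PI * v)) <= exp (- ((PI - Rabs phi) * v)).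
Proof.
  intros Hv. pose proof (cosh_gt0 (PI * v)) as Hc.
  unfold Rdiv. rewrite Rabs_mult, (Rabs_pos_eq (/ _)) by (left; now apply Rinv_0_lt_compat).
  apply Rmult_le_reg_r with (cosh (PI * v)); [exact Hc|].
  rewrite Rmult_assoc, Rinv_l, Rmult_1_r by lra.
  assert (H1 : exp (PI * v) / 2 <= cosh (PI * v)).
  { unfold cosh. pose proof (exp_pos (- (PI * v))). lra. }
  apply Rle_trans with (exp (- ((PI - Rabs phi) * v)) * (exp (PI * v) / 2)).
  - replace (exp (- ((PI - Rabs phi) * v)) * (exp (PI * v) / 2)) with (exp (Rabs phi * v) / 2).
    2:{ unfold Rdiv. rewrite <- Rmult_assoc, <- exp_plus. do 2 f_equal. ring. }
    unfold sinh. pose proof (Rabs_pos phi).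
    pose proof (exp_pos (phi * v)); pose proof (exp_pos (- (phi * v))).
    assert (exp (phi * v) <= exp (Rabs phi * v)).
    { apply exp_mono, Rmult_le_compat_r; [exact Hv | apply Rle_abs]. }
    assert (exp (- (phi * v)) <= exp (Rabs phi * v)).
    { apply exp_mono. rewrite Ropp_mult_distr_l. apply Rmult_le_compat_r; [exact Hv|].
      rewrite <- Rabs_Ropp. apply Rle_abs. }
    apply Rabs_le. lra.
  - apply Rmult_le_compat_l; [left; apply exp_pos | exact H1].
Qed.

(** A finite geometric sum of ratio [- exp (-2 pi v)]. At [v = 0] the remainder has modulus [1] for
    every [n], so the expansion is usable only after integration. *)
Lemma inv_cosh_expansion (v : R) (n : nat) :
  / cosh (PI * v) - sum_n (fun k => 2 * ((-1) ^ k * exp (- (freq k * v)))) n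
    = (-1) ^ S n * (exp (- (2 * INR (S n) * PI * v)) / cosh (PI * v)).
Proof.
  set (E := exp (- (PI * v))).
  assert (HE : 0 < E) by apply exp_pos.
  assert (Hc : cosh (PI * v) = (/ E + E) / 2).
  { unfold cosh, E. rewrite exp_Ropp, Rinv_inv. reflexivity. }
  assert (HE1 : 1 + E * E <> 0) by nra.
  induction n as [|n IH].
  - rewrite sum_O, Hc. unfold freq. simpl INR. simpl pow.
    replace (- ((2 * 0 + 1) * PI * v)) with (- (PI * v)) by ring.
    replace (- (2 * 1 * PI * v)) with (- (PI * v) + - (PI * v)) by ring.
    rewrite exp_plus. fold E. field. split; nra.
  - rewrite sum_n_SnR.
    replace (/ cosh (PI * v) - (sum_n (fun k => 2 * ((-1) ^ k * exp (- (freq k * v)))) n + 2 * ((-1) ^ S n * exp (- (freq (S n) * v)))))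
      with (/ cosh (PI * v) - sum_n (fun k => 2 * ((-1) ^ k * exp (- (freq k * v)))) n - 2 * ((-1) ^ S n * exp (- (freq (S n) * v)))) by ring.
    rewrite IH, Hc. unfold freq.
    replace (- ((2 * INR (S n) + 1) * PI * v)) with (- (2 * INR (S n) * PI * v) + - (PI * v)) by ring.
    replace (- (2 * INR (S (S n)) * PI * v)) with (- (2 * INR (S n) * PI * v) + (- (PI * v) + - (PI * v)))
      by (rewrite (S_INR (S n)); ring).
    rewrite !exp_plus. fold E. set (u := exp (- (2 * INR (S n) * PI * v))).
    change ((-1) ^ S (S n)) with (-1 * (-1) ^ S n). field. split; nra.
Qed.

Lemma ex_derive_weight (phi a v : R) : ex_derive (kernel phi a) v.
Proof.
  unfold kernel, sinh. pose proof (cosh_gt0 (PI * v)) as H. unfold cosh in *. auto_derive. lra.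
Qed.

Lemma ex_RInt_kernel (phi a x y : R) : ex_RInt (kernel phi a) x y.
Proof.
  apply (ex_RInt_continuous (V := R_CompleteNormedModule)). intros z _.
  apply (ex_derive_continuous (V := R_NormedModule)), ex_derive_weight.
Qed.

(** Cesaro means of the partial expansions, to match the means whose limit [cesaro_coef]
    provides. *)
Definition kernel_trunc (phi a : R) (N : nat) (v : R) : R :=
  / INR (S N) * sum_n (fun n => sum_n (fun k =>
    2 * ((-1) ^ k * (sin (v * a) * (sinh (phi * v) * exp (- (freq k * v)))))) n) N.

(** An average of the exact remainders, whose factor [1/cosh] is absorbed in a kernel bounded by
    [1]. Lowering the rate [2 pi] to [1] keeps their integrals over the half-line at most
    [1/(n+1)]. *)
Lemma kernel_trunc_error (phi a v : R) (N : nat) : Rabs phi < PI -> 0 <= v ->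
  Rabs (kernel phi a v - kernel_trunc phi a N v)
    <= / INR (S N) * sum_n (fun n => exp (- (INR (S n) * v))) N.
Proof.
  intros Hphi Hv.
  assert (HN : 0 < INR (S N)) by (apply lt_0_INR; lia).
  assert (HNi : 0 < / INR (S N)) by now apply Rinv_0_lt_compat.
  assert (E : kernel phi a v - kernel_trunc phi a N v =
    / INR (S N) * sum_n (fun n => kernel phi a v * ((-1) ^ S n * exp (- (2 * INR (S n) * PI * v)))) N).
  { unfold kernel_trunc.
    replace (kernel phi a v) with (/ INR (S N) * (sum_n (fun _ => kernel phi a v) N)) at 1
      by (rewrite sum_n_const; field; lra).
    rewrite <- Rmult_minus_distr_l. f_equal.
    induction N as [|M IH].
    - rewrite !sum_O. pose proof (inv_cosh_expansion v 0) as H. rewrite sum_O in H.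
      unfold kernel, Rdiv in *.
      replace (sin (v * a) * (sinh (phi * v) * / cosh (PI * v)) - 2 * ((-1) ^ 0 * (sin (v * a) * (sinh (phi * v) * exp (- (freq 0 * v))))))
       with (sin (v * a) * sinh (phi * v) * (/ cosh (PI * v) - 2 * ((-1) ^ 0 * exp (- (freq 0 * v))))) by ring.
      rewrite H. ring.
    - rewrite !(sum_n_SnR _ M).
      assert (IH' := IH ltac:(apply lt_0_INR; lia) ltac:(apply Rinv_0_lt_compat, lt_0_INR; lia)).
      rewrite (sum_n_ext (fun k => 2 * ((-1) ^ k * (sin (v * a) * (sinh (phi * v) * exp (- (freq k * v))))))
        (fun k => (sin (v * a) * sinh (phi * v)) * (2 * ((-1) ^ k * exp (- (freq k * v)))))) by (intros; eqR; ring).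
      rewrite sum_n_Rmult_l.
      pose proof (inv_cosh_expansion v (S M)) as H.
      set (X := sum_n (fun k => 2 * ((-1) ^ k * exp (- (freq k * v)))) (S M)) in *.
      replace (kernel phi a v * ((-1) ^ S (S M) * exp (- (2 * INR (S (S M)) * PI * v)))) with
        (sin (v * a) * sinh (phi * v) * (/ cosh (PI * v) - X))
        by (rewrite H; generalize ((-1) ^ S (S M)) (exp (- (2 * INR (S (S M)) * PI * v)));
            intros y z; unfold kernel, Rdiv; ring).
      rewrite <- IH'. unfold X, kernel, Rdiv. rewrite (sum_n_SnR _ M).
      generalize ((-1) ^ S M) (exp (- (freq (S M) * v))). intros y z. ring. }
  rewrite E, Rabs_mult, Rabs_pos_eq by lra.
  apply Rmult_le_compat_l; [lra|].
  clear HN HNi E. 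
  assert (Hk : Rabs (kernel phi a v) <= 1).
  { unfold kernel. rewrite Rabs_mult. rewrite <- (Rmult_1_r 1).
    apply Rmult_le_compat; try apply Rabs_pos; [apply Rabs_le, SIN_bound|].
    eapply Rle_trans; [now apply weight_le|]. rewrite <- exp_0. apply exp_mono. nra. }
  assert (Ht : forall n, Rabs (kernel phi a v * ((-1) ^ S n * exp (- (2 * INR (S n) * PI * v)))) <= exp (- (INR (S n) * v))).
  { intros n. rewrite !Rabs_mult, pow_1_abs, Rmult_1_l, (Rabs_pos_eq (exp _)) by (left; apply exp_pos).
    apply Rle_trans with (1 * exp (- (INR (S n) * v))); [|lra].
    apply Rmult_le_compat; [apply Rabs_pos | left; apply exp_pos | exact Hk |].
    apply exp_mono. pose proof PI2_3_2. pose proof (pos_INR (S n)).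
    assert (0 <= INR (S n) * v) by (apply Rmult_le_pos; lra). nra. }
  induction N as [|N IH].
  - rewrite !sum_O. apply Ht.
  - rewrite !sum_n_SnR. eapply Rle_trans; [apply Rabs_triang|].
    apply Rplus_le_compat; [exact IH | apply Ht].
Qed.

(** Exchange of [V -> oo] with [N -> oo]: the error of [kernel_trunc] integrates to at most the mean
    of [1/(n+1)] over [n <= N], which tends to [0] uniformly in [V]. For fixed [N] the integral is a
    finite combination of Laplace integrals. *)
Lemma kernel_integral (phi a : R) : Rabs phi < PI ->
  lim_infty (fun V => RInt (kernel phi a) 0 V) (kernel_q phi a / (cos phi + cosh a)).
Proof.
  intros Hphi.
  assert (Hpm : forall k, 0 < freq k - phi /\ 0 < freq k + phi).
  { intros k. pose proof (freq_ge k). apply Rabs_def2 in Hphi. lra. }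
  set (L := fun k V => / 2 * (laplace_sin a (freq k - phi) V - laplace_sin a (freq k + phi) V)).
  assert (HL : forall k V, is_RInt (fun v => sin (v * a) * (sinh (phi * v) * exp (- (freq k * v)))) 0 V (L k V)).
  { intros k V. destruct (Hpm k) as [H1 H2].
    pose proof (is_RInt_laplace_sin a _ V H1) as I1.
    pose proof (is_RInt_laplace_sin a _ V H2) as I2.
    refine (is_RInt_ext _ _ _ _ _ _ (is_RInt_scal (V := R_NormedModule) _ _ _ (/ 2) _ (is_RInt_minus (V := R_NormedModule) _ _ _ _ _ _ I1 I2))).
    intros v _. rewrite sinh_exp_split.
    change (/ 2 * (sin (v * a) * exp (- ((freq k - phi) * v)) - sin (v * a) * exp (- ((freq k + phi) * v))) =
      sin (v * a) * (/ 2 * (exp (- ((freq k - phi) * v)) - exp (- ((freq k + phi) * v))))). ring. }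
  set (BV := fun N V => / INR (S N) * sum_n (fun n => sum_n (fun k => 2 * ((-1) ^ k * L k V)) n) N).
  assert (HB : forall N V, is_RInt (kernel_trunc phi a N) 0 V (BV N V)).
  { intros N V. apply (is_RInt_scal (V := R_NormedModule) _ _ _ (/ INR (S N))).
    apply is_RInt_sum_n; intros n. apply is_RInt_sum_n; intros k.
    apply (is_RInt_scal (V := R_NormedModule) _ _ _ 2).
    apply (is_RInt_scal (V := R_NormedModule) _ _ _ ((-1) ^ k)), HL. }
  apply (filterlim_uniform_approx (K := R_AbsRing) (V := R_NormedModule) (Rbar_locally p_infty) _ _ BV
    (fun N => / INR (S N) * sum_n (fun n => sum_n (fun k => 2 * ((-1) ^ k * kernel_coef phi a k)) n) N)
    _ (fun N => sum_n (fun n => / INR (S n)) N / INR (S N))).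
  - exists 0%nat; intros N _. exists 0; intros V HV.
    change (Rabs (RInt (kernel phi a) 0 V - BV N V) <= sum_n (fun n => / INR (S n)) N / INR (S N)).
    pose proof (RInt_correct (V := R_CompleteNormedModule) _ _ _ (ex_RInt_kernel phi a 0 V)) as H1.
    pose proof (is_RInt_minus (V := R_NormedModule) _ _ _ _ _ _ H1 (HB N V)) as H2.
    assert (H3 : is_RInt (fun v => / INR (S N) * sum_n (fun n => exp (- (INR (S n) * v))) N) 0 V
      (/ INR (S N) * sum_n (fun n => / INR (S n) * (1 - exp (- (INR (S n) * V)))) N)).
    { apply (is_RInt_scal (V := R_NormedModule) _ _ _ (/ INR (S N))).
      apply is_RInt_sum_n; intros n. assert (0 < INR (S n)) by (apply lt_0_INR; lia).
      set (m := INR (S n)) in *.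
      replace (/ m * (1 - exp (- (m * V)))) with (- exp (- (m * V)) / m - (- exp (- (m * 0)) / m))
        by (rewrite Rmult_0_r, Ropp_0, exp_0; field; lra).
      apply (is_RInt_antiderivative _ (fun v => - exp (- (m * v)) / m)).
      - intros v. auto_derive; [trivial|]. field. lra.
      - intros v. apply (ex_derive_continuous (V := R_NormedModule)). auto_derive. trivial. }
    apply Rle_trans with (/ INR (S N) * sum_n (fun n => / INR (S n) * (1 - exp (- (INR (S n) * V)))) N).
    + refine (norm_RInt_le (V := R_NormedModule) _ _ 0 V _ _ ltac:(lra) _ H2 H3).
      intros v Hv. apply kernel_trunc_error; [exact Hphi | lra].
    + unfold Rdiv. rewrite Rmult_comm.
      assert (0 < INR (S N)) by (apply lt_0_INR; lia).
      apply Rmult_le_compat_r; [left; now apply Rinv_0_lt_compat|].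
      rewrite !sum_n_Reals. apply sum_Rle. intros n _.
      assert (0 < / INR (S n)) by (apply Rinv_0_lt_compat, lt_0_INR; lia).
      pose proof (exp_pos (- (INR (S n) * V))). nra.
  - apply is_lim_seq_cesaro, is_lim_seq_inv_INR_S.
  - intros N. apply filterlim_Rmult_l.
    apply filterlim_sum_n; [typeclasses eauto|]; intros n.
    apply filterlim_sum_n; [typeclasses eauto|]; intros k.
    apply filterlim_Rmult_l, filterlim_Rmult_l, filterlim_Rmult_l.
    destruct (Hpm k) as [H1 H2].
    exact (filterlim_comp_2 _ _ _ (laplace_sin_lim a _ H1)
      (filterlim_comp _ _ _ _ _ _ _ _ (laplace_sin_lim a _ H2) (filterlim_opp (V := R_NormedModule) _)) (filterlim_plus (V := R_NormedModule) _ _)).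
  - change (is_lim_seq (fun N => / INR (S N) * sum_n (fun n => sum_n (fun k => 2 * ((-1) ^ k * kernel_coef phi a k)) n) N)
      (kernel_q phi a / (cos phi + cosh a))).
    apply (is_lim_seq_ext (fun N => sum_n (fun n => sum_n (fun k => 2 * ((-1) ^ k * kernel_coef phi a k)) n) N / INR (S N))).
    + intros N. unfold Rdiv. apply Rmult_comm.
    + now apply cesaro_coef.
Qed.

(** * The continued function of phi *)

(** [1/(n+1) <= ln (n+1) - ln n <= 1/n] makes the sequence decreasing and nonnegative, so the total
    [Lim_seq] in [euler_gamma] is a genuine finite limit. *)
Lemma euler_gamma_lim :
  is_lim_seq (fun n => sum_n (fun k => / INR (S k)) n - ln (INR (S n))) euler_gamma.
Proof.
  assert (Hp : forall n, 0 < INR (S n)) by (intros n; apply lt_0_INR; lia).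
  assert (Hstep : forall n, / INR (S (S n)) <= ln (INR (S (S n))) - ln (INR (S n)) <= / INR (S n)).
  { intros n. pose proof (Hp n) as H1. pose proof (Hp (S n)) as H2. split.
    - assert (ln (INR (S n)) - ln (INR (S (S n))) <= - / INR (S (S n))); [|lra].
      rewrite <- ln_div by assumption. eapply Rle_trans; [apply ln_le_sub1; now apply Rdiv_lt_0_compat|].
      right. rewrite (S_INR (S n)) in *. field. lra.
    - rewrite <- ln_div by assumption. eapply Rle_trans; [apply ln_le_sub1; now apply Rdiv_lt_0_compat|].
      right. rewrite (S_INR (S n)) in *. field. lra. }
  destruct (ex_finite_lim_seq_decr (fun n => sum_n (fun k => / INR (S k)) n - ln (INR (S n))) 0) as [l Hl].
  - intros n. rewrite sum_n_SnR. specialize (Hstep n). lra.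
  - intros n.
    assert (H : ln (INR (S (S n))) <= sum_n (fun k => / INR (S k)) n).
    { induction n as [|n IH].
      - rewrite sum_O. specialize (Hstep 0%nat). change (INR 1) with 1 in *. rewrite ln_1 in Hstep. lra.
      - rewrite sum_n_SnR. specialize (Hstep (S n)). lra. }
    specialize (Hstep n). assert (0 < / INR (S (S n))) by (apply Rinv_0_lt_compat, Hp). lra.
  - unfold euler_gamma. rewrite (is_lim_seq_unique _ _ Hl). exact Hl.
Qed.

(** * Analyticity in [phi] and the value at [pi] *)

Definition Ccos (z : C) : C := (/ 2 * (Cexp (Ci * z) + Cexp (- Ci * z)))%C.
Definition Csin (z : C) : C := (- Ci / 2 * (Cexp (Ci * z) - Cexp (- Ci * z)))%C.

Lemma Ccos_R (x : R) : Ccos (RtoC x) = RtoC (cos x).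
Proof.
  unfold Ccos, Cexp, Ci, Cmult, Cplus, Copp, Cinv, RtoC; simpl.
  replace (0 * x - 1 * 0) with 0 by ring. replace (0 * 0 + 1 * x) with x by ring.
  replace (-0 * x - - (1) * 0) with 0 by ring. replace (-0 * 0 + - (1) * x) with (- x) by ring.
  rewrite exp_0, cos_neg, sin_neg. f_equal; field.
Qed.

Lemma Csin_R (x : R) : Csin (RtoC x) = RtoC (sin x).
Proof.
  unfold Csin, Cdiv, Cexp, Ci, Cmult, Cminus, Cplus, Copp, Cinv, RtoC; simpl.
  replace (0 * x - 1 * 0) with 0 by ring. replace (0 * 0 + 1 * x) with x by ring.
  replace (-0 * x - - (1) * 0) with 0 by ring. replace (-0 * 0 + - (1) * x) with (- x) by ring.
  rewrite exp_0, cos_neg, sin_neg. f_equal; field.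
Qed.

Lemma analytic_bound_Cexp_linear (c z0 : C) (r : R) : 0 < r ->
  analytic_bound (fun z => Cexp (c * z))%C z0 r (Cmod (Cexp (c * z0)%C) * exp (Cmod c * r)).
Proof.
  intros Hr.
  apply (analytic_bound_ext z0 r (fun z => Cexp (c * z0) * Cexp (c * (z - z0)))%C).
  - intros h _. rewrite <- Cexp_plus. f_equal. ring.
  - now apply analytic_bound_scal, analytic_bound_Cexp, analytic_bound_scal, analytic_bound_sub.
Qed.

Lemma analytic_bound_Ccos_half (z0 : C) (r : R) : 0 < r ->
  exists M, analytic_bound (fun z => Ccos (z / 2))%C z0 r M /\ analytic_bound (fun z => Csin (z / 2))%C z0 r M.
Proof.
  intros Hr.
  pose proof (analytic_bound_Cexp_linear (Ci / 2)%C z0 r Hr) as H1.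
  pose proof (analytic_bound_Cexp_linear (- Ci / 2)%C z0 r Hr) as H2.
  set (M1 := _ * _) in H1. set (M2 := _ * _) in H2.
  exists (Rmax (Cmod (/ 2)%C * (M1 + M2)) (Cmod (- Ci / 2)%C * (M1 + Cmod (- (1))%C * M2))). split.
  - eapply analytic_bound_le; [|apply Rmax_l].
    apply (analytic_bound_ext z0 r (fun z => / 2 * (Cexp (Ci / 2 * z) + Cexp (- Ci / 2 * z)))%C).
    + intros h _. unfold Ccos. do 3 f_equal; unfold Cdiv; ring.
    + now apply analytic_bound_scal, analytic_bound_plus.
  - eapply analytic_bound_le; [|apply Rmax_r].
    apply (analytic_bound_ext z0 r (fun z => - Ci / 2 * (Cexp (Ci / 2 * z) + - (1) * Cexp (- Ci / 2 * z)))%C).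
    + intros h _. unfold Csin.
      replace (Ci * ((z0 + h) / 2))%C with (Ci / 2 * (z0 + h))%C by (unfold Cdiv; ring).
      replace (- Ci * ((z0 + h) / 2))%C with (- Ci / 2 * (z0 + h))%C by (unfold Cdiv; ring).
      ring.
    + apply analytic_bound_scal, analytic_bound_plus; [exact H1 | | exact Hr].
      now apply analytic_bound_scal.
Qed.

Lemma Cmod_Cexp_imag (x : R) (c : C) : Re c = 0 -> Cmod (Cexp (c * RtoC x)%C) = 1.
Proof.
  intros Hc. rewrite Cmod_Cexp. destruct c as [u w]; simpl in *; subst u.
  replace (0 * x - w * 0) with 0 by ring. apply exp_0.
Qed.

(** For real [x] both [exp (i x)] and [exp (-i x)] have modulus [1], so the same radius works at
    every centre. The size [1/8] is what the smallest denominator in [Cpsi_term_bound] can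
    absorb. *)
Lemma analytic_bound_Ccos_diff (x : R) : exists r, 0 < r /\
  analytic_bound (fun z => Ccos z - RtoC (cos x))%C (RtoC x) r (/ 8).
Proof.
  (* Chosen so that [exp r - 1 = 1/8], which bounds the norm of [exp (c (z - x)) - 1] when
     [|c| = 1]. *)
  set (r := ln (1 + / 8)).
  assert (Hr : 0 < r) by (unfold r; rewrite <- ln_1; apply ln_increasing; lra).
  assert (He : exp r = 1 + / 8) by (unfold r; apply exp_ln; lra).
  exists r; split; [exact Hr|].
  assert (H : forall c : C, Re c = 0 -> Cmod c = 1 ->
    analytic_bound (fun z => Cexp (c * z) - Cexp (c * RtoC x))%C (RtoC x) r (/ 8)).
  { intros c Hc Hc1.
    apply (analytic_bound_ext (RtoC x) r (fun z => Cexp (c * RtoC x) * (Cexp (c * (z - RtoC x)) - 1))%C).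
    - intros h _. replace (c * (RtoC x + h))%C with (c * RtoC x + c * (RtoC x + h - RtoC x))%C by ring.
      rewrite Cexp_plus. ring.
    - apply (analytic_bound_le _ _ _ (Cmod (Cexp (c * RtoC x)%C) * / 8)); [|rewrite Cmod_Cexp_imag by exact Hc; lra].
      apply analytic_bound_scal.
      apply (analytic_bound_comp (fun z => c * (z - RtoC x))%C (fun w => Cexp w - 1)%C
        (fun k => match k with O => RtoC 0 | S _ => RtoC (/ INR (Factorial.fact k)) end) _ _ r); [exact Hr | | |].
      + apply (analytic_bound_le _ _ _ (Cmod c * r)); [|rewrite Hc1; lra].
        now apply analytic_bound_scal, analytic_bound_sub.
      + replace (/ 8) with (exp r - 1) by lra.
        apply is_series_decr_1. rewrite Cmod_0.
        apply (is_series_ext (fun k => / INR (Factorial.fact (S k)) * r ^ S k)).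
        { intros k. now rewrite Cmod_inv_fact. }
        apply (is_series_incr_1 (fun k => / INR (Factorial.fact k) * r ^ k)).
        assert (E : exp r = plus (plus (exp r - 1) (opp (0 * r ^ 0))) (/ INR (Factorial.fact 0) * r ^ 0)).
        { change (exp r = exp r - 1 + - (0 * 1) + / 1 * 1). field. }
        exact (eq_ind _ (fun l => is_series _ l) (is_series_exp r) _ E).
      + intros w _.
        apply (is_series_decr_1 (V := C_NormedModule)).
        pose proof (is_Cseries_Cexp w) as Hw.
        apply (is_series_incr_1 (V := C_NormedModule) (fun k => RtoC (/ INR (Factorial.fact k)) * Cpow w k)%C).
        assert (E : Cexp w = plus (G := C_NormedModule) (plus (G := C_NormedModule) (Cexp w - 1)%C (opp (G := C_NormedModule) (RtoC 0 * Cpow w 0)%C))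
          (RtoC (/ INR (Factorial.fact 0)) * Cpow w 0)%C).
        { change (Cexp w = Cexp w - 1 + - (0 * 1) + RtoC (/ 1) * 1)%C. rewrite Rinv_1. ring. }
        exact (eq_ind _ (fun l => is_Cseries _ l) Hw _ E). }
  apply (analytic_bound_ext (RtoC x) r (fun z => / 2 * ((Cexp (Ci * z) - Cexp (Ci * RtoC x)) + (Cexp (- Ci * z) - Cexp (- Ci * RtoC x))))%C).
  - intros h _. rewrite <- Ccos_R. unfold Ccos. ring.
  - apply (analytic_bound_le _ _ _ (Cmod (/ 2)%C * (/ 8 + / 8))).
    + apply analytic_bound_scal, analytic_bound_plus; [| |exact Hr]; apply H.
      * reflexivity.
      * apply Cmod_Ci.
      * simpl; ring.
      * rewrite Cmod_opp. apply Cmod_Ci.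
    + rewrite Cmod_inv, Cmod_R, Rabs_pos_eq; [lra | lra |]. intros E; injection E; lra.
Qed.

Definition quad (c : R) (j : nat) : R := INR (S j) ^ 2 + 1 + 2 * INR (S j) * c.

(* [j / quad c j - 1 / (j+1)], in a form that is also right at [j = 0], [c = -1]. *)
Definition psi_term (x : R) (j : nat) : R :=
  match j with
  | O => -1
  | S _ => - ((INR (S j) * (1 + 2 * cos x) + 1) / (INR (S j) * quad (cos x) j))
  end.

Definition continuation (x : R) : R :=
  - (x * cos (x / 2)) - sin (x / 2) * (euler_gamma + Series (psi_term x)).

Definition Cpsi_term (j : nat) (z : C) : C :=
  match j with
  | O => - (1)
  | S _ => - RtoC (/ INR (S j)) * ((RtoC (INR (S j)) * (1 + 2 * Ccos z) + 1)
      * / (RtoC (INR (S j) ^ 2 + 1) + RtoC (2 * INR (S j)) * Ccos z))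
  end%C.

(** A multiple of [1/(j (j+1))] in telescoping form, so that the total [1 + 20] is explicit. *)
Definition psi_majorant (j : nat) : R :=
  match j with O => 1 | S i => 20 * (/ INR (S i) - / INR (S (S i))) end.

Lemma psi_majorant_series : is_series psi_majorant 21.
Proof.
  change (is_lim_seq (sum_n psi_majorant) 21).
  apply (is_lim_seq_ext (fun n => 21 + - 20 * / INR (S n))).
  - induction n as [|n IH]; [rewrite sum_O; simpl; field|].
    rewrite sum_n_SnR, <- IH. unfold psi_majorant. eqR. ring.
  - replace (Finite 21) with (Finite (21 + - 20 * 0)) by (f_equal; ring).
    apply is_lim_seq_plus'; [apply is_lim_seq_const|].
    apply (is_lim_seq_scal_l _ (- 20) 0), is_lim_seq_inv_INR_S.
Qed.

(** The worst case is [c = -1], where [quad] is the square of [(j + 1) - 1]. At [j = 0] it vanishes,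
    hence the separate first term of [psi_term]. *)
Lemma quad_ge (c : R) (j : nat) : -1 <= c -> INR j ^ 2 <= quad c j.
Proof.
  intros Hc. unfold quad. rewrite S_INR. pose proof (pos_INR j). nra.
Qed.

Lemma Cpsi_term_R (x : R) (j : nat) : Cpsi_term j (RtoC x) = RtoC (psi_term x j).
Proof.
  destruct j as [|i]; [unfold Cpsi_term, psi_term, Copp, RtoC; simpl; f_equal; ring|].
  unfold Cpsi_term, psi_term. rewrite Ccos_R.
  assert (Hq : 0 < quad (cos x) (S i)).
  { eapply Rlt_le_trans; [|apply quad_ge, COS_bound]. apply pow_lt, lt_0_INR. lia. }
  set (n := INR (S (S i))) in *.
  assert (Hn : 0 < n) by (apply lt_0_INR; lia).
  assert (E : (RtoC (n ^ 2 + 1) + RtoC (2 * n) * RtoC (cos x))%C = RtoC (quad (cos x) (S i))).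
  { unfold quad. fold n. rewrite <- RtoC_mult, <- RtoC_plus. reflexivity. }
  rewrite E, <- RtoC_inv by lra.
  replace (RtoC n * (1 + 2 * RtoC (cos x)) + 1)%C with (RtoC (n * (1 + 2 * cos x) + 1))
    by (rewrite !RtoC_plus, !RtoC_mult, !RtoC_plus, !RtoC_mult; ring).
  rewrite <- RtoC_opp, <- !RtoC_mult. f_equal. field. lra.
Qed.

(** For [j >= 1] and [n = j + 1 <= 2 j], the denominator is [D >= j^2] at the centre and varies by
    at most [2 n / 8 <= j^2 / 2], so [analytic_bound_inv] applies. The numerator is at most [5 n],
    and [5 * 2/j^2 <= 20/(j n)]. *)
Lemma Cpsi_term_bound (x r : R) (j : nat) : 0 < r ->
  analytic_bound (fun z => Ccos z - RtoC (cos x))%C (RtoC x) r (/ 8) ->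
  analytic_bound (Cpsi_term j) (RtoC x) r (psi_majorant j).
Proof.
  intros Hr Hcos. destruct j as [|i].
  { unfold Cpsi_term, psi_majorant.
    pose proof (analytic_bound_const (RtoC x) r (- (1))%C) as H. now rewrite Cmod_opp, Cmod_1 in H. }
  assert (Hi : 1 <= INR (S i)) by (rewrite S_INR; pose proof (pos_INR i); lra).
  set (n := INR (S (S i))).
  assert (Hn : n = INR (S i) + 1) by (unfold n; now rewrite (S_INR (S i))).
  set (D := quad (cos x) (S i)).
  assert (HD : INR (S i) ^ 2 <= D) by (apply quad_ge, COS_bound).
  assert (Hg : analytic_bound (fun z => RtoC (2 * n) * (Ccos z - RtoC (cos x)))%C (RtoC x) r (2 * n * / 8)).
  { apply (analytic_bound_le _ _ _ (Cmod (RtoC (2 * n)) * / 8)); [now apply analytic_bound_scal|].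
    rewrite Cmod_R, Rabs_pos_eq by lra. lra. }
  (* Equality at [i = 0], which fixes the constant [1/8]. *)
  assert (HDg : 2 * n * / 8 <= INR (S i) ^ 2 / 2) by nra.
  assert (HcD : Cmod (RtoC D) = D) by (rewrite Cmod_R; apply Rabs_pos_eq; nra).
  assert (Hinv := analytic_bound_inv _ (RtoC D) (RtoC x) r _ Hr Hg ltac:(rewrite HcD; nra)).
  rewrite HcD in Hinv.
  assert (Hnum : analytic_bound (fun z => RtoC n * (1 + 2 * Ccos z) + 1)%C (RtoC x) r (5 * n)).
  { apply (analytic_bound_ext (RtoC x) r (fun z => RtoC (n * (1 + 2 * cos x) + 1) + RtoC (2 * n) * (Ccos z - RtoC (cos x)))%C).
    - intros h _. rewrite !RtoC_plus, !RtoC_mult, !RtoC_plus, !RtoC_mult. ring.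
    - apply (analytic_bound_le _ _ _ (Cmod (RtoC (n * (1 + 2 * cos x) + 1)) + 2 * n * / 8)).
      + apply analytic_bound_plus; [apply analytic_bound_const | exact Hg | exact Hr].
      + rewrite Cmod_R. pose proof (COS_bound x).
        assert (Rabs (n * (1 + 2 * cos x) + 1) <= n * 3 + 1) by (apply Rabs_le; nra). lra. }
  apply (analytic_bound_ext (RtoC x) r (fun z => - RtoC (/ n) * ((RtoC n * (1 + 2 * Ccos z) + 1)
    * / (RtoC D + RtoC (2 * n) * (Ccos z - RtoC (cos x)))))%C).
  { intros h _. unfold Cpsi_term. fold n. unfold D, quad. fold n.
    do 3 f_equal. rewrite RtoC_plus, !RtoC_mult. ring. }
  apply (analytic_bound_le _ _ _ (Cmod (- RtoC (/ n))%C * (5 * n * / (D - 2 * n * / 8)))).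
  - now apply analytic_bound_scal, analytic_bound_mult.
  - rewrite Cmod_opp, Cmod_R, Rabs_pos_eq by (left; apply Rinv_0_lt_compat; lra).
    unfold psi_majorant. fold n.
    set (t := INR (S i)) in *.
    replace (/ n * (5 * n * / (D - 2 * n * / 8))) with (5 * / (D - 2 * n * / 8)) by (field; nra).
    apply Rle_trans with (5 * / (t ^ 2 / 2)).
    + apply Rmult_le_compat_l; [lra|]. apply Rinv_le_contravar; nra.
    + replace (20 * (/ t - / n)) with (5 * (4 / (t * n))) by (rewrite Hn; field; lra).
      apply Rmult_le_compat_l; [lra|].
      apply Rmult_le_reg_r with (t ^ 2 * n); [nra|].
      replace (/ (t ^ 2 / 2) * (t ^ 2 * n)) with (2 * n) by (field; lra).
      replace (4 / (t * n) * (t ^ 2 * n)) with (4 * t) by (field; lra). lra.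
Qed.

Lemma psi_series (x : R) : is_series (psi_term x) (Series (psi_term x)).
Proof.
  apply Series_correct.
  destruct (analytic_bound_Ccos_diff x) as (r & Hr & Hcos).
  apply (ex_series_le (V := R_CompleteNormedModule) _ psi_majorant); [|exists 21; apply psi_majorant_series].
  intros j. change (Rabs (psi_term x j) <= psi_majorant j).
  rewrite <- Cmod_R, <- Cpsi_term_R.
  replace (RtoC x) with (RtoC x + 0)%C by ring.
  apply (analytic_bound_Cmod (RtoC x) r Hr); [|rewrite Cmod_0; lra].
  now apply Cpsi_term_bound.
Qed.

Definition Cpsi_series (z : C) : C :=
  (Series (fun j => Re (Cpsi_term j z)), Series (fun j => Im (Cpsi_term j z))).

(** The majorant [psi_majorant] controls the series on a complex disc about [x]; restriction to the
    real axis gives the real power series, at [pi] as at any other point. *)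
Lemma continuation_analytic (x : R) : analytic_at (K := R_AbsRing) continuation x.
Proof.
  destruct (analytic_bound_Ccos_diff x) as (r & Hr & Hcos).
  assert (HB : analytic_bound Cpsi_series (RtoC x) r 21).
  { apply (analytic_bound_series (RtoC x) r Hr Cpsi_term _ psi_majorant).
    - intros j. now apply Cpsi_term_bound.
    - apply psi_majorant_series.
    - intros h Hh.
      destruct (ex_Cseries_le (fun j => Cpsi_term j (RtoC x + h)%C) psi_majorant 21) as [l Hl].
      + intros j. apply (analytic_bound_Cmod (RtoC x) r Hr); [now apply Cpsi_term_bound | exact Hh].
      + apply psi_majorant_series.
      + replace (Cpsi_series (RtoC x + h)%C) with l; [exact Hl|].
        unfold Cpsi_series.
        rewrite (is_series_unique _ _ (is_Cseries_Re _ _ Hl)), (is_series_unique _ _ (is_Cseries_Im _ _ Hl)).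
        now destruct l. }
  destruct (analytic_bound_Ccos_half (RtoC x) r Hr) as (M & Hc & Hs).
  set (Fc := fun z => (- (1) * ((RtoC x + (z - RtoC x)) * Ccos (z / 2)) + - (1) * (Csin (z / 2) * (RtoC euler_gamma + Cpsi_series z)))%C).
  assert (HF : exists M', analytic_bound Fc (RtoC x) r M').
  { eexists. unfold Fc. apply analytic_bound_plus; [| |exact Hr]; apply analytic_bound_scal.
    - apply analytic_bound_mult; [exact Hr | | exact Hc].
      apply analytic_bound_plus; [apply analytic_bound_const | now apply analytic_bound_sub | exact Hr].
    - apply analytic_bound_mult; [exact Hr | exact Hs |].
      apply analytic_bound_plus; [apply analytic_bound_const | exact HB | exact Hr]. }
  destruct HF as [M' HF].
  assert (E : forall t, Re (Fc (t, 0)) = continuation t).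
  { intros t. change (t, 0) with (RtoC t). unfold Fc.
    replace (RtoC t / 2)%C with (RtoC (t / 2)) by (rewrite RtoC_div; reflexivity || lra).
    rewrite Ccos_R, Csin_R.
    assert (EB : Cpsi_series (RtoC t) = RtoC (Series (psi_term t))).
    { unfold Cpsi_series, RtoC at 3. f_equal.
      - apply Series_ext. intros j. now rewrite Cpsi_term_R.
      - rewrite (Series_ext _ (fun _ => 0)) by (intros j; now rewrite Cpsi_term_R).
        apply is_series_unique. apply (filterlim_ext (fun _ => 0)); [|apply filterlim_const].
        intros n. rewrite sum_n_const. ring. }
    rewrite EB. unfold continuation.
    replace (RtoC x + (RtoC t - RtoC x))%C with (RtoC t) by ring.
    unfold Cmult, Cplus, Copp, RtoC, Re; simpl. ring. }
  destruct (analytic_bound_real Fc x 0 r M' Hr HF) as (a & e & He).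
  exists a, e. intros t Ht. rewrite <- E. now apply He.
Qed.

Lemma continuation_PI : continuation PI = - euler_gamma.
Proof.
  unfold continuation. rewrite cos_PI2, sin_PI2.
  assert (H : Series (psi_term PI) = 0); [|rewrite H; ring].
  apply is_series_unique. change (is_lim_seq (sum_n (psi_term PI)) 0).
  (* Closed form of the partial sums [-1 + sum (1/j - 1/(j+1))]. *)
  apply (is_lim_seq_ext (fun n => - 1 * / INR (S n))).
  - induction n as [|n IH]; [rewrite sum_O; simpl; field|].
    rewrite sum_n_SnR, <- IH. unfold psi_term, quad. rewrite cos_PI, (S_INR (S n)).
    assert (0 < INR (S n)) by (apply lt_0_INR; lia). eqR. field. nra.
  - replace (Finite 0) with (Finite (- 1 * 0)) by (f_equal; ring).
    apply (is_lim_seq_scal_l _ (- 1) 0), is_lim_seq_inv_INR_S.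
Qed.

(** * Evaluation of the integral *)

Definition kappa (phi x : R) : R :=
  sin (phi / 2) * (x - 1) / (x ^ 2 + 2 * x * cos phi + 1).

(** The arctangent is written in [(x-1)/(x+1)], which maps [[0, oo)] to [[-1, 1)]: the primitive
    stays regular at [phi = 0], and the arctangent runs from [- phi/2] to the limit [phi/2]. *)
Definition kappa_primitive (phi x : R) : R :=
  sin (phi / 2) * (/ 2 * ln (x ^ 2 + 2 * x * cos phi + 1))
  - cos (phi / 2) * atan (tan (phi / 2) * ((x - 1) / (x + 1))).

Lemma cos_half_pos (phi : R) : Rabs phi < PI -> 0 < cos (phi / 2).
Proof. intros H. apply Rabs_def2 in H. apply cos_gt_0; lra. Qed.

(** The quadratic is [|x + exp (i phi)|^2]; factoring out [exp (i phi/2)] exhibits it as a sum of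
    two squares. *)
Lemma quad_half_angle (phi x : R) :
  x ^ 2 + 2 * x * cos phi + 1 = cos (phi / 2) ^ 2 * (x + 1) ^ 2 + sin (phi / 2) ^ 2 * (x - 1) ^ 2.
Proof.
  replace phi with (2 * (phi / 2)) at 1 by field. rewrite cos_2a.
  pose proof (sin2_cos2 (phi / 2)) as H. unfold Rsqr in H.
  assert (E : sin (phi / 2) ^ 2 = 1 - cos (phi / 2) ^ 2) by (simpl; lra).
  rewrite E. replace (sin (phi / 2) * sin (phi / 2)) with (1 - cos (phi / 2) ^ 2) by (rewrite <- E; ring).
  ring.
Qed.

Lemma quad_lower (phi x : R) : cos (phi / 2) ^ 2 * (x + 1) ^ 2 <= x ^ 2 + 2 * x * cos phi + 1.
Proof.
  rewrite quad_half_angle.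
  pose proof (Rmult_le_pos _ _ (pow2_ge_0 (sin (phi / 2))) (pow2_ge_0 (x - 1))). lra.
Qed.

Lemma quad_pos (phi x : R) : Rabs phi < PI -> 0 <= x -> 0 < x ^ 2 + 2 * x * cos phi + 1.
Proof.
  intros Hphi Hx. pose proof (cos_half_pos phi Hphi) as Hc.
  eapply Rlt_le_trans; [|apply quad_lower].
  apply Rmult_lt_0_compat; apply pow_lt; lra.
Qed.

Lemma kappa_primitive_derive (phi x : R) : Rabs phi < PI -> 0 <= x ->
  is_derive (kappa_primitive phi) x (kappa phi x).
Proof.
  intros Hphi Hx. pose proof (quad_pos phi x Hphi Hx) as Hq.
  pose proof (cos_half_pos phi Hphi) as Hc.
  pose proof (quad_half_angle phi x) as Eq.
  unfold kappa_primitive, kappa.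
  auto_derive; [repeat split; simpl in *; lra|].
  unfold tan.
  assert (Ec : cos phi = 2 * cos (phi / 2) ^ 2 - 1).
  { replace phi with (2 * (phi / 2)) at 1 by field. rewrite cos_2a_cos. ring. }
  pose proof (sin2_cos2 (phi / 2)) as H. unfold Rsqr in H.
  set (c := cos (phi / 2)) in *. set (s := sin (phi / 2)) in *.
  rewrite Ec in *.
  assert (EI : 1 + s / c * ((x + - (1)) * / (x + 1)) * (s / c * ((x + - (1)) * / (x + 1)) * 1)
     = (x ^ 2 + 2 * x * (2 * c ^ 2 - 1) + 1) / (c ^ 2 * (x + 1) ^ 2)).
  { rewrite Eq. field. lra. }
  rewrite EI. field. simpl in *. repeat split; lra.
Qed.

(** The difference of the fractions has numerator [x - y] times a factor of size at most
    [3 (x+1)(y+1)], while [quad_lower] bounds both denominators below. The constant blows up as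
    [|phi|] tends to [pi], which is harmless for a limit at fixed [phi]. *)
Lemma kappa_lipschitz (phi x y : R) : Rabs phi < PI -> 0 <= x -> 0 <= y ->
  Rabs (kappa phi x - kappa phi y) <= 3 / cos (phi / 2) ^ 4 * Rabs (x - y).
Proof.
  intros Hphi Hx Hy.
  pose proof (cos_half_pos phi Hphi) as Hc.
  pose proof (quad_lower phi x) as Lx. pose proof (quad_lower phi y) as Ly.
  pose proof (quad_pos phi x Hphi Hx) as Px. pose proof (quad_pos phi y Hphi Hy) as Py.
  unfold kappa.
  set (A := x ^ 2 + 2 * x * cos phi + 1) in *. set (B := y ^ 2 + 2 * y * cos phi + 1) in *.
  replace (sin (phi / 2) * (x - 1) / A - sin (phi / 2) * (y - 1) / B) with
    (sin (phi / 2) * ((x - y) * (- (x * y) + 1 + x + y + 2 * cos phi)) * / (A * B))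
    by (unfold A, B in *; field; lra).
  rewrite !Rabs_mult, Rabs_inv.
  assert (HAB : cos (phi / 2) ^ 4 * ((x + 1) * (y + 1)) <= A * B).
  { apply Rle_trans with ((cos (phi / 2) ^ 2 * (x + 1) ^ 2) * (cos (phi / 2) ^ 2 * (y + 1) ^ 2)).
    - replace (cos (phi / 2) ^ 2 * (x + 1) ^ 2 * (cos (phi / 2) ^ 2 * (y + 1) ^ 2)) with
        (cos (phi / 2) ^ 4 * ((x + 1) * (y + 1) * ((x + 1) * (y + 1)))) by ring.
      apply Rmult_le_compat_l; [apply pow_le; lra|]. assert (1 <= (x + 1) * (y + 1)) by nra. nra.
    - apply Rmult_le_compat; try assumption; apply Rmult_le_pos; apply pow2_ge_0. }
  assert (HABp : 0 < A * B) by nra.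
  rewrite (Rabs_pos_eq (A * B)) by lra.
  assert (Hs : Rabs (sin (phi / 2)) <= 1) by (apply Rabs_le, SIN_bound).
  assert (Hn : Rabs (- (x * y) + 1 + x + y + 2 * cos phi) <= 3 * ((x + 1) * (y + 1))).
  { pose proof (COS_bound phi). apply Rabs_le. nra. }
  assert (Hc4 : 0 < cos (phi / 2) ^ 4) by (apply pow_lt; exact Hc).
  assert (Hxy : 0 < (x + 1) * (y + 1)) by nra.
  pose proof (Rabs_pos (x - y)) as Hd.
  apply Rle_trans with (1 * (Rabs (x - y) * (3 * ((x + 1) * (y + 1)))) * / (cos (phi / 2) ^ 4 * ((x + 1) * (y + 1)))).
  - apply Rmult_le_compat.
    + apply Rmult_le_pos; [apply Rabs_pos|]. apply Rmult_le_pos; apply Rabs_pos.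
    + left; now apply Rinv_0_lt_compat.
    + apply Rmult_le_compat; try assumption; try apply Rabs_pos.
      * apply Rmult_le_pos; apply Rabs_pos.
      * now apply Rmult_le_compat_l.
    + apply Rinv_le_contravar; [nra | exact HAB].
  - right. field. lra.
Qed.

(** Mean value theorem on each cell: [G] increases by [h g(c)], and [g] varies by at most [L h]
    between [c] and the right end point. *)
Lemma riemann_sum_error (g G : R -> R) (L h : R) (n : nat) : 0 < h ->
  (forall x, 0 <= x -> is_derive G x (g x)) ->
  (forall x y, 0 <= x -> 0 <= y -> Rabs (g x - g y) <= L * Rabs (x - y)) ->
  Rabs (sum_n (fun j => h * g (INR (S j) * h)) n - (G (INR (S n) * h) - G 0)) <= INR (S n) * (L * h ^ 2).
Proof.
  intros Hh HG Hg.
  assert (HL : 0 <= L).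
  { specialize (Hg 1 0 ltac:(lra) ltac:(lra)). rewrite Rminus_0_r, Rabs_R1 in Hg.
    pose proof (Rabs_pos (g 1 - g 0)). lra. }
  assert (Hstep : forall x, 0 <= x -> Rabs (h * g (x + h) - (G (x + h) - G x)) <= L * h ^ 2).
  { intros x Hx.
    destruct (MVT_gen G x (x + h) g) as (c & Hc & E).
    - intros y Hy. apply HG. rewrite Rmin_left in Hy by lra. lra.
    - intros y Hy. apply continuity_pt_filterlim.
      apply (ex_derive_continuous (V := R_NormedModule)). exists (g y). apply HG.
      rewrite Rmin_left in Hy by lra. lra.
    - rewrite Rmin_left, Rmax_right in Hc by lra.
      rewrite E. replace (h * g (x + h) - g c * (x + h - x)) with (h * (g (x + h) - g c)) by ring.
      rewrite Rabs_mult, Rabs_pos_eq by lra.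
      replace (L * h ^ 2) with (h * (L * h)) by ring.
      apply Rmult_le_compat_l; [lra|].
      eapply Rle_trans; [apply Hg; lra|]. apply Rmult_le_compat_l; [exact HL|].
      apply Rabs_le; lra. }
  induction n as [|n IH].
  - rewrite sum_O. specialize (Hstep 0 ltac:(lra)). change (INR 1) with 1.
    rewrite Rplus_0_l in Hstep. rewrite !Rmult_1_l. exact Hstep.
  - rewrite sum_n_SnR.
    specialize (Hstep (INR (S n) * h) ltac:(apply Rmult_le_pos; [apply pos_INR | lra])).
    replace (INR (S n) * h + h) with (INR (S (S n)) * h) in Hstep by (rewrite (S_INR (S n)); ring).
    set (S0 := sum_n _ n) in *.
    replace (S0 + h * g (INR (S (S n)) * h) - (G (INR (S (S n)) * h) - G 0)) with
      ((S0 - (G (INR (S n) * h) - G 0)) + (h * g (INR (S (S n)) * h) - (G (INR (S (S n)) * h) - G (INR (S n) * h)))) by ring.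
    eapply Rle_trans; [apply Rabs_triang|].
    replace (INR (S (S n)) * (L * h ^ 2)) with (INR (S n) * (L * h ^ 2) + L * h ^ 2)
      by (rewrite (S_INR (S n)); ring).
    lra.
Qed.

Definition approx_value (phi : R) (n : nat) : R :=
  - sum_n (fun j => kappa phi (INR (S j))) (pred (S n))
  + sum_n (fun j => / INR (S n) ^ 2 * kappa phi (INR (S j) / INR (S n) ^ 2)) (pred (S n ^ 3)).

(** Separates the harmonic part, which yields [gamma] against the logarithm of the primitive. At
    [j = 0] both sides vanish. *)
Lemma kappa_psi (phi : R) (j : nat) : Rabs phi < PI ->
  kappa phi (INR (S j)) = sin (phi / 2) * (psi_term phi j + / INR (S j)).
Proof.
  intros Hphi. destruct j as [|i].
  - unfold kappa, psi_term. change (INR 1) with 1. rewrite Rinv_1. 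
    pose proof (quad_pos phi 1 Hphi ltac:(lra)). field. lra.
  - unfold kappa, psi_term, quad. set (n := INR (S (S i))).
    assert (0 < n) by (apply lt_0_INR; lia).
    pose proof (quad_pos phi n Hphi ltac:(lra)). field. split; lra.
Qed.

Lemma is_lim_seq_ln_quad (c : R) :
  is_lim_seq (fun n => / 2 * ln (INR (S n) ^ 2 + 2 * INR (S n) * c + 1) - ln (INR (S n))) 0.
Proof.
  assert (H1 : is_lim_seq (fun n => 1 + 2 * c * / INR (S n) + / INR (S n) * / INR (S n)) 1).
  { replace (Finite 1) with (Finite (1 + 2 * c * 0 + 0 * 0)) by (f_equal; ring).
    apply is_lim_seq_plus'; [apply is_lim_seq_plus'|].
    - apply is_lim_seq_const.
    - apply (is_lim_seq_scal_l _ (2 * c) 0), is_lim_seq_inv_INR_S.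
    - apply is_lim_seq_mult'; apply is_lim_seq_inv_INR_S. }
  assert (H2 : is_lim_seq (fun n => ln (1 + 2 * c * / INR (S n) + / INR (S n) * / INR (S n))) (ln 1)).
  { apply (is_lim_seq_continuous ln); [|exact H1].
    apply continuity_pt_filterlim, (ex_derive_continuous (V := R_NormedModule)).
    auto_derive. lra. }
  rewrite ln_1 in H2. apply (is_lim_seq_scal_l _ (/ 2) 0) in H2.
  replace (Rbar_mult (/ 2) 0) with (Finite 0) in H2 by (simpl; f_equal; ring).
  assert (Hev : eventually (fun n => 0 < 1 + 2 * c * / INR (S n) + / INR (S n) * / INR (S n))).
  { apply is_lim_seq_spec in H1. destruct (H1 (mkposreal 1 Rlt_0_1)) as [N HN].
    exists N. intros n Hn. specialize (HN n Hn). simpl pos in HN. apply Rabs_def2 in HN. lra. }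
  refine (is_lim_seq_ext_loc _ _ _ _ H2).
  revert Hev. apply filter_imp. intros n Hn.
  set (P := INR (S n)) in *. assert (HP : 0 < P) by (apply lt_0_INR; lia).
  replace (P ^ 2 + 2 * P * c + 1) with (P * P * (1 + 2 * c * / P + / P * / P)) by (field; lra).
  rewrite ln_mult; [|nra|exact Hn]. rewrite ln_mult by lra. clearbody P.
  generalize (ln (1 + 2 * c * / P + / P * / P)). intros u. field.
Qed.

(** The logarithm in the primitive turns the harmonic sum into [gamma]. The arctangent tends to
    [phi/2] at [P] and equals [- phi/2] at [0], which together give [- phi cos (phi/2)]. *)
Lemma approx_value_lim (phi : R) : Rabs phi < PI ->
  is_lim_seq (approx_value phi) (continuation phi).
Proof.
  intros Hphi. pose proof (cos_half_pos phi Hphi) as Hc.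
  set (s := sin (phi / 2)). set (c := cos (phi / 2)). set (t := tan (phi / 2)).
  set (L := 3 / cos (phi / 2) ^ 4).
  (* With [P^3] cells of width [1/P^2] the Riemann sum errs by at most [P^3 L P^(-4) = L / P]. *)
  set (err := fun n => sum_n (fun j => / INR (S n) ^ 2 * kappa phi (INR (S j) / INR (S n) ^ 2)) (pred (S n ^ 3))
     - (kappa_primitive phi (INR (S n)) - kappa_primitive phi 0)).
  assert (Herr : is_lim_seq err 0).
  { apply (is_lim_seq_le_le (fun n => - L * / INR (S n)) _ (fun n => L * / INR (S n))).
    - intros n. set (P := INR (S n)). assert (HP : 0 < P) by (apply lt_0_INR; lia).
      assert (HP3 : S (pred (S n ^ 3)) = (S n ^ 3)%nat) by (apply Nat.succ_pred; apply Nat.pow_nonzero; lia).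
      assert (HPi : 0 < / P ^ 2) by (apply Rinv_0_lt_compat, pow_lt; exact HP).
      pose proof (riemann_sum_error (kappa phi) (kappa_primitive phi) L (/ P ^ 2) (pred (S n ^ 3)) HPi
        (fun x Hx => kappa_primitive_derive phi x Hphi Hx) (fun x y Hx Hy => kappa_lipschitz phi x y Hphi Hx Hy)) as H.
      rewrite HP3, pow_INR in H. fold P in H.
      replace (P ^ 3 * / P ^ 2) with P in H by (field; lra).
      replace (P ^ 3 * (L * (/ P ^ 2) ^ 2)) with (L * / P) in H by (field; lra).
      apply Rabs_le_between in H. unfold err. fold P. unfold Rdiv. lra.
    - replace (Finite 0) with (Finite (- L * 0)) by (f_equal; ring).
      apply (is_lim_seq_scal_l _ (- L) 0), is_lim_seq_inv_INR_S.
    - replace (Finite 0) with (Finite (L * 0)) by (f_equal; ring).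
      apply (is_lim_seq_scal_l _ L 0), is_lim_seq_inv_INR_S. }
  assert (Hatan : is_lim_seq (fun n => atan (t * (1 + - 2 * / (INR (S n) + 1)))) (phi / 2)).
  { replace (phi / 2) with (atan (t * (1 + - 2 * 0))).
    2:{ replace (t * (1 + - 2 * 0)) with t by ring. apply atan_tan. apply Rabs_def2 in Hphi. lra. }
    apply (is_lim_seq_continuous atan).
    - apply continuity_pt_filterlim, (ex_derive_continuous (V := R_NormedModule)). auto_derive. trivial.
    - apply (is_lim_seq_scal_l _ t (1 + - 2 * 0)).
      apply is_lim_seq_plus'; [apply is_lim_seq_const|].
      apply (is_lim_seq_scal_l _ (- 2) 0).
      apply (is_lim_seq_ext (fun n => / INR (S (S n)))); [intros n; now rewrite (S_INR (S n))|].
      apply (is_lim_seq_incr_1 (fun n => / INR (S n))), is_lim_seq_inv_INR_S. }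
  pose proof (psi_series phi) as Hpsi. change (is_lim_seq (sum_n (psi_term phi)) (Series (psi_term phi))) in Hpsi.
  apply (is_lim_seq_ext (fun n =>
    - s * sum_n (psi_term phi) n
    + - s * (sum_n (fun k => / INR (S k)) n - ln (INR (S n)))
    + s * (/ 2 * ln (INR (S n) ^ 2 + 2 * INR (S n) * cos phi + 1) - ln (INR (S n)))
    + - c * atan (t * (1 + - 2 * / (INR (S n) + 1)))
    + - c * (phi / 2) + err n)).
  - intros n. unfold err, approx_value. rewrite Nat.pred_succ.
    rewrite (sum_n_ext (fun j => kappa phi (INR (S j))) (fun j => s * (psi_term phi j + / INR (S j))))
      by (intros j; now apply kappa_psi).
    rewrite (sum_n_Rmult_l s).
    replace (sum_n (fun k => psi_term phi k + / INR (S k)) n) with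
      (sum_n (psi_term phi) n + sum_n (fun k => / INR (S k)) n)
      by (symmetry; apply (sum_n_plus (G := R_AbelianMonoid))).
    unfold kappa_primitive. fold s c t.
    assert (HP : 0 < INR (S n)) by (apply lt_0_INR; lia).
    replace ((INR (S n) - 1) / (INR (S n) + 1)) with (1 + - 2 * / (INR (S n) + 1)) by (field; lra).
    replace (0 ^ 2 + 2 * 0 * cos phi + 1) with 1 by ring. rewrite ln_1.
    replace (t * ((0 - 1) / (0 + 1))) with (- t) by field.
    rewrite atan_opp. unfold t at 3. rewrite atan_tan by (apply Rabs_def2 in Hphi; lra).
    ring.
  - replace (continuation phi) with
      (- s * Series (psi_term phi) + - s * euler_gamma + s * 0 + - c * (phi / 2) + - c * (phi / 2) + 0)
      by (unfold continuation; fold s c; field).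
    repeat apply is_lim_seq_plus'.
    + apply (is_lim_seq_scal_l _ (- s) (Series (psi_term phi))), Hpsi.
    + apply (is_lim_seq_scal_l _ (- s) euler_gamma), euler_gamma_lim.
    + apply (is_lim_seq_scal_l _ s 0), is_lim_seq_ln_quad.
    + apply (is_lim_seq_scal_l _ (- c) (phi / 2)), Hatan.
    + apply is_lim_seq_const.
    + exact Herr.
Qed.

(** * From the termwise integrals to the integral of zeta *)

Lemma osc_kernel (phi x v : R) :
  osc x v * (sinh (phi * v) / cosh (PI * v)) = exp (- (/ 2 * ln x)) * kernel phi (ln x) v.
Proof. unfold osc, kernel. ring. Qed.

(** In terms of [y = sqrt x], both [sinh (ln x / 2)] and [cosh (ln x)] are rational. *)
Lemma kernel_value_kappa (phi x : R) : Rabs phi < PI -> 0 < x ->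
  exp (- (/ 2 * ln x)) * (kernel_q phi (ln x) / (cos phi + cosh (ln x))) = kappa phi x.
Proof.
  intros Hphi Hx. unfold kernel_q, kappa, sinh, cosh.
  pose proof (quad_pos phi x Hphi ltac:(lra)) as Hq.
  set (y := exp (/ 2 * ln x)).
  assert (Hy : 0 < y) by apply exp_pos.
  assert (Ex : x = y * y).
  { unfold y. rewrite <- exp_plus. replace (/ 2 * ln x + / 2 * ln x) with (ln x) by field. now rewrite exp_ln. }
  replace (ln x / 2) with (/ 2 * ln x) by field.
  rewrite !exp_Ropp, exp_ln by exact Hx. fold y. clearbody y. subst x.
  field. repeat split; nra.
Qed.

Lemma zeta_approx_integral (phi : R) (n : nat) : Rabs phi < PI ->
  exists I : R -> R,
    (forall V, is_RInt (fun v => zeta_approx (S n) v * (sinh (phi * v) / cosh (PI * v))) 0 V (I V)) /\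
    lim_infty I (approx_value phi n).
Proof.
  intros Hphi.
  set (O := fun x V => exp (- (/ 2 * ln x)) * RInt (kernel phi (ln x)) 0 V).
  assert (HO : forall x V, is_RInt (fun v => osc x v * (sinh (phi * v) / cosh (PI * v))) 0 V (O x V)).
  { intros x V. apply (is_RInt_ext (fun v => exp (- (/ 2 * ln x)) * kernel phi (ln x) v)).
    - intros v _. now rewrite osc_kernel.
    - apply (is_RInt_scal (V := R_NormedModule) _ _ _ (exp (- (/ 2 * ln x)))).
      apply (RInt_correct (V := R_CompleteNormedModule)), ex_RInt_kernel. }
  assert (HOl : forall x, 0 < x -> lim_infty (O x) (kappa phi x)).
  { intros x Hx. rewrite <- kernel_value_kappa by assumption.
    now apply filterlim_Rmult_l, kernel_integral. }
  assert (HP : 0 < INR (S n) ^ 2) by (apply pow_lt, lt_0_INR; lia).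
  exists (fun V => - sum_n (fun j => O (INR (S j)) V) (pred (S n))
     + sum_n (fun j => / INR (S n) ^ 2 * O (INR (S j) / INR (S n) ^ 2) V) (pred (S n ^ 3))).
  set (w := fun v => sinh (phi * v) / cosh (PI * v)) in *.
  split.
  - intros V.
    apply (is_RInt_ext (fun v => plus (opp (sum_n (fun j => osc (INR (S j)) v * w v) (pred (S n))))
      (sum_n (fun j => / INR (S n) ^ 2 * (osc (INR (S j) / INR (S n) ^ 2) v * w v)) (pred (S n ^ 3))))).
    + intros v _. unfold zeta_approx. fold (w v).
      rewrite (sum_n_ext (fun j => / INR (S n) ^ 2 * (osc (INR (S j) / INR (S n) ^ 2) v * w v))
        (fun j => (/ INR (S n) ^ 2 * osc (INR (S j) / INR (S n) ^ 2) v) * w v))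
        by (intros j; eqR; symmetry; apply Rmult_assoc).
      rewrite !sum_n_Rmult_r.
      set (X := sum_n (fun j => osc (INR (S j)) v) (pred (S n))).
      set (Y := sum_n _ (pred (S n ^ 3))).
      change (- (X * w v) + Y * w v = (- X + Y) * w v). ring.
    + apply (is_RInt_plus (V := R_NormedModule)).
      * apply (is_RInt_opp (V := R_NormedModule)), is_RInt_sum_n. intros j. apply HO.
      * apply is_RInt_sum_n. intros j.
        apply (is_RInt_scal (V := R_NormedModule) _ _ _ (/ INR (S n) ^ 2)), HO.
  - assert (Hx : forall j, 0 < INR (S j)) by (intros j; apply lt_0_INR; lia).
    refine (filterlim_comp_2 _ _ _ _ _ (filterlim_plus (V := R_NormedModule) _ _)).
    + refine (filterlim_comp _ _ _ _ _ _ _ _ _ (filterlim_opp (V := R_NormedModule) _)).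
      apply filterlim_sum_n; [typeclasses eauto|]. intros j. now apply HOl.
    + apply filterlim_sum_n; [typeclasses eauto|]. intros j.
      apply filterlim_Rmult_l, HOl. now apply Rdiv_lt_0_compat.
Qed.

(** Multiplication by [i] carries a horizontal line onto the vertical critical line, so that
    [analytic_bound_real] becomes available there. *)
Lemma analytic_bound_rotate (f : C -> C) (z0 : C) (r M : R) :
  analytic_bound f (Ci * z0)%C r M -> analytic_bound (fun z => f (Ci * z)%C) z0 r M.
Proof.
  intros (a & Ha & Hf). exists (fun k => Cpow Ci k * a k)%C. split.
  - intros n. rewrite (sum_n_ext _ (fun k => Cmod (a k) * r ^ k)); [apply Ha|].
    intros k. rewrite Cmod_mult, Cmod_pow, Cmod_Ci, pow1. eqR. ring.
  - intros h Hh. replace (Ci * (z0 + h))%C with (Ci * z0 + Ci * h)%C by ring.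
    refine (is_series_ext (V := C_NormedModule) _ _ _ _ (Hf (Ci * h)%C _)).
    + intros k. rewrite Cpow_mult_l. eqC. ring.
    + rewrite Cmod_mult, Cmod_Ci. lra.
Qed.

Lemma zeta_critical_continuous (zeta : C -> C) (v : R) : is_riemann_zeta zeta ->
  continuous (fun t => Im (zeta (/ 2, t))) v.
Proof.
  intros [_ Hz].
  assert (Hrot : forall t : R, (Ci * (t, (- / 2)%R))%C = (/ 2, t)).
  { intros t. unfold Ci, Cmult; simpl. f_equal; ring. }
  destruct (analytic_at_bound zeta (/ 2, v)) as (r & M & Hr & HM).
  { apply Hz. intros E. injection E. lra. }
  rewrite <- Hrot in HM. apply analytic_bound_rotate in HM.
  apply (analytic_bound_scal (- Ci)%C) in HM.
  apply analytic_bound_real in HM; [|exact Hr].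
  apply analytic_at_continuous in HM.
  rewrite Re_mult_Ci, Hrot in HM.
  apply (filterlim_ext (fun t : R => Re (- Ci * zeta (Ci * (t, (- / 2)%R)))%C)); [|exact HM].
  intros t. now rewrite Re_mult_Ci, Hrot.
Qed.

Lemma integrand_half (zeta : C -> C) (phi v : R) :
  integrand zeta phi v = Im (zeta (/ 2, v)) * (sinh (phi * v) / cosh (PI * v)).
Proof. unfold integrand. now replace (1 / 2) with (/ 2) by field. Qed.

Lemma ex_RInt_integrand (zeta : C -> C) (phi x y : R) : is_riemann_zeta zeta ->
  ex_RInt (integrand zeta phi) x y.
Proof.
  intros Hz. apply (ex_RInt_continuous (V := R_CompleteNormedModule)). intros v _.
  apply (continuous_ext (fun v => mult (Im (zeta (/ 2, v))) (sinh (phi * v) / cosh (PI * v)))).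
  - intros t. symmetry. apply integrand_half.
  - apply (continuous_mult (K := R_AbsRing)); [now apply zeta_critical_continuous|].
    apply (ex_derive_continuous (V := R_NormedModule)).
    unfold sinh. pose proof (cosh_gt0 (PI * v)) as H. unfold cosh in *. auto_derive. lra.
Qed.

(** Half of the gap [pi - |phi|] is spent on the growth [exp (d v)] of the approximation error. The
    other half leaves [eps n exp (-d v)], whose integral is at most [eps n / d] whatever [V], so the
    limits in [n] and [V] may be exchanged. *)
Lemma integrand_lim (zeta : C -> C) (phi : R) : is_riemann_zeta zeta -> Rabs phi < PI ->
  lim_infty (fun V => RInt (integrand zeta phi) 0 V) (continuation phi).
Proof.
  intros Hz Hphi.
  set (d := (PI - Rabs phi) / 2). assert (Hd : 0 < d) by (unfold d; lra).
  destruct (zeta_approx_error zeta d Hz Hd) as (eps & Heps & n0 & Herr).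
  assert (HI : exists I : nat -> R -> R, forall n,
    (forall V, is_RInt (fun v => zeta_approx (S n) v * (sinh (phi * v) / cosh (PI * v))) 0 V (I n V)) /\
    lim_infty (I n) (approx_value phi n)).
  { exists (fun n => proj1_sig (constructive_indefinite_description _ (zeta_approx_integral phi n Hphi))).
    intros n. exact (proj2_sig (constructive_indefinite_description _ (zeta_approx_integral phi n Hphi))). }
  destruct HI as [I HI].
  apply (filterlim_uniform_approx (K := R_AbsRing) (V := R_NormedModule) (Rbar_locally p_infty) _ _ I
    (approx_value phi) _ (fun n => eps n * / d)).
  - exists n0. intros n Hn. exists 0. intros V HV.
    (* Read off from the error bound at the single point [v = 1]. *)
    assert (He : 0 <= eps n).
    { pose proof (Herr n 1 Hn Rlt_0_1) as H. pose proof (exp_pos (d * 1)).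
      pose proof (Rabs_pos (Im (zeta (/ 2, 1)) - zeta_approx (S n) 1)).
      destruct (Rle_lt_dec 0 (eps n)) as [|Hneg]; [assumption|nra]. }
    pose proof (RInt_correct (V := R_CompleteNormedModule) _ _ _ (ex_RInt_integrand zeta phi 0 V Hz)) as H1.
    pose proof (is_RInt_minus (V := R_NormedModule) _ _ _ _ _ _ H1 (proj1 (HI n) V)) as H2.
    assert (H3 : is_RInt (fun v => eps n * exp (- (d * v))) 0 V (eps n * (/ d * (1 - exp (- (d * V)))))).
    { apply (is_RInt_scal (V := R_NormedModule) _ _ _ (eps n)).
      replace (/ d * (1 - exp (- (d * V)))) with (- exp (- (d * V)) / d - (- exp (- (d * 0)) / d))
        by (rewrite Rmult_0_r, Ropp_0, exp_0; field; lra).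
      apply (is_RInt_antiderivative _ (fun v => - exp (- (d * v)) / d)).
      - intros v. auto_derive; [trivial|]. field. lra.
      - intros v. apply (ex_derive_continuous (V := R_NormedModule)). auto_derive. trivial. }
    apply Rle_trans with (eps n * (/ d * (1 - exp (- (d * V))))).
    + refine (norm_RInt_le (V := R_NormedModule) _ _ 0 V _ _ ltac:(lra) _ H2 H3).
      intros v Hv. change (Rabs (integrand zeta phi v - zeta_approx (S n) v * (sinh (phi * v) / cosh (PI * v))) <= eps n * exp (- (d * v))).
      rewrite integrand_half, <- Rmult_minus_distr_r, Rabs_mult.
      (* The error bound is available for [v > 0] only; at [v = 0] the weight vanishes with
         [sinh]. *)
      destruct (Req_dec v 0) as [->|Hv0].
      { rewrite Rmult_0_r, sinh_0. unfold Rdiv. rewrite Rmult_0_l, Rabs_R0, Rmult_0_r.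
        apply Rmult_le_pos; [exact He | left; apply exp_pos]. }
      apply Rle_trans with (eps n * exp (d * v) * exp (- ((PI - Rabs phi) * v))).
      * apply Rmult_le_compat; try apply Rabs_pos; [apply Herr; [exact Hn | lra] | apply weight_le; lra].
      * rewrite Rmult_assoc, <- exp_plus. right. do 2 f_equal. unfold d. field.
    + apply Rmult_le_compat_l; [exact He|].
      assert (0 < / d) by now apply Rinv_0_lt_compat. pose proof (exp_pos (- (d * V))). nra.
  - replace (Finite 0) with (Finite (0 * / d)) by (f_equal; ring).
    apply (is_lim_seq_scal_r _ (/ d) 0), Heps.
  - intros n. apply HI.
  - now apply approx_value_lim.
Qed.

Lemma integrand_is_RInt_gen (zeta : C -> C) (phi : R) : is_riemann_zeta zeta -> Rabs phi < PI ->
  is_RInt_gen (integrand zeta phi) (at_point 0) (Rbar_locally p_infty) (continuation phi).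
Proof.
  intros Hz Hphi P HP.
  pose proof (integrand_lim zeta phi Hz Hphi P HP) as H.
  apply (Filter_prod _ _ _ (fun x => x = 0) (fun V => P (RInt (integrand zeta phi) 0 V))).
  - reflexivity.
  - exact H.
  - intros x V -> HV. exists (RInt (integrand zeta phi) 0 V). split; [|exact HV].
    apply (RInt_correct (V := R_CompleteNormedModule)), ex_RInt_integrand, Hz.
Qed.

Theorem mainTheorem12 (zeta : C -> C) (Hzeta : is_riemann_zeta zeta) :
  (forall phi : R, Rabs phi < PI ->
     ex_RInt_gen (integrand zeta phi) (at_point 0) (Rbar_locally p_infty)) /\
  continued_value (zeta_integral zeta) (- PI) PI (- euler_gamma) /\
  filterlim (zeta_integral zeta) (at_left PI) (locally (- euler_gamma)).
Proof.
  assert (Hval : forall phi, Rabs phi < PI -> zeta_integral zeta phi = continuation phi).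
  { intros phi Hphi. unfold zeta_integral.
    pose proof (integrand_is_RInt_gen zeta phi Hzeta Hphi) as H.
    exact (is_RInt_gen_unique (V := R_CompleteNormedModule) _ _ H). }
  split; [|split].
  - intros phi Hphi. exists (continuation phi). now apply integrand_is_RInt_gen.
  - exists continuation. split; [|split].
    + intros x Hx. symmetry. apply Hval, Rabs_def1; lra.
    + intros x _. apply continuation_analytic.
    + apply continuation_PI.
  - apply (filterlim_ext_loc continuation).
    (* Within distance [pi] to the left of [pi] one has [0 < y < pi], where the integral equals
       [continuation]. *)
    + exists (mkposreal PI PI_RGT_0). intros y Hy Hlt.
      change (Rabs (y - PI) < PI) in Hy. apply Rabs_def2 in Hy.
      symmetry. apply Hval, Rabs_def1; lra.
    + rewrite <- continuation_PI.
      eapply filterlim_filter_le_1; [apply filter_le_within|].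
      apply analytic_at_continuous, continuation_analytic.
Qed.
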